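(* Let $p, q$ be distinct primes. The groups $G$ of order $p^2 q$ are, up to isomorphism, those of the following eleven types (notation in the context), each type occurring under the condition stated for it (types 1 and 5 occur with no condition), and their automorphism groups are, up to isomorphism, as listed. (1) $G = C_{p^2} \times C_q$; $\mathrm{Aut}(G) \cong C_p \times C_{p-1} \times C_{q-1}$. (2) Condition $p \mid q-1$: $G = C_{p^2} \ltimes_p C_q$; $\mathrm{Aut}(G) \cong C_p \times \mathrm{Hol}(C_q)$. (3) Condition $p^2 \mid q-1$: $G = C_{p^2} \ltimes_1 C_q$; $\mathrm{Aut}(G) \cong \mathrm{Hol}(C_q)$. (4) Condition $q \mid p-1$: $G = C_{p^2} \rtimes C_q$; $\mathrm{Aut}(G) \cong \mathrm{Hol}(C_{p^2})$. (5) $G = C_p \times C_p \times C_q$; $\mathrm{Aut}(G) \cong \mathrm{GL}(2,p) \times C_{q-1}$. (6) Condition $q \mid p-1$: $G = C_p \times (C_p \rtimes C_q)$; $\mathrm{Aut}(G) \cong C_{p-1} \times \mathrm{Hol}(C_p)$. (7) Condition $2 < q \mid p-1$: $G = (C_p \times C_p) \rtimes_S C_q$; $\mathrm{Aut}(G) \cong \mathrm{Hol}(C_p \times C_p)$. (8) Condition $3 < q \mid p-1$: $G = (C_p \times C_p) \rtimes_{D0} C_q$; $\mathrm{Aut}(G) \cong \mathrm{Hol}(C_p) \times \mathrm{Hol}(C_p)$. (9) Condition $2 < q \mid p-1$: $G = (C_p \times C_p) \rtimes_{D1} C_q$; $\mathrm{Aut}(G) \cong C_2 \ltimes (\mathrm{Hol}(C_p)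 \times \mathrm{Hol}(C_p))$. (10) Condition $2 < q \mid p+1$: $G = (C_p \times C_p) \rtimes_C C_q$; $\mathrm{Aut}(G) \cong (C_2 \ltimes C_{p^2-1}) \ltimes (C_p \times C_p)$. (11) Condition $p \mid q-1$: $G = C_p \times (C_p \ltimes C_q)$; $\mathrm{Aut}(G) \cong \mathrm{Hol}(C_p) \times \mathrm{Hol}(C_q)$.
   Context: Notation. $C_n$ denotes a cyclic group of order $n$. $\mathrm{Aut}(A)$ is the automorphism group of a group $A$, and $\mathrm{Hol}(A) = A \rtimes \mathrm{Aut}(A)$ is its holomorph, with $\mathrm{Aut}(A)$ acting naturally on $A$. $\mathrm{GL}(2,p)$ is the group of invertible $2 \times 2$ matrices over the field with $p$ elements. In a semidirect product $A \rtimes B$ the left factor $A$ is normal; in $A \ltimes B$ the right factor $B$ is normal. A condition such as $2 < q \mid p-1$ means that $q > 2$ and $q$ divides $p-1$. The symbols $\rtimes$ and $\ltimes$, when they appear without subscripts, denote the unique (up to isomorphism) non-direct semidirect product that is possible in the given situation. The symbols with subscripts have the following meaning. - $C_{p^2} \ltimes_p C_q$: a semidirect product with centre of order $p$. - $C_{p^2} \ltimes_1 C_q$: a semidirect product with trivial centre. - $(C_p \times C_p) \rtimes_S C_q$: a semidirect product where a generator of $C_q$ acts on $C_p \times C_p$ (regarded as a 2-dimensional vector space over the field with $p$ elements, here and below) as a non-identity scalar matrix. - $(C_p \times C_p) \rtimes_{D0} C_q$: a semidirect product where a generator of $C_q$ acts as a diagonal, non-scalar matrix with no eigenvalue $1$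 and determinant different from $1$. - $(C_p \times C_p) \rtimes_{D1} C_q$: the same as the previous one, except that the diagonal, non-scalar matrix has determinant $1$ (and thus still no eigenvalue $1$). - $(C_p \times C_p) \rtimes_C C_q$: a semidirect product where a generator of $C_q$ acts as a suitable power of a Singer cycle (an element of order $p^2-1$ in $\mathrm{GL}(2,p)$); the determinant of the matrix of a generator of $C_q$ acting on $C_p \times C_p$ is then $1$.
   Formalization: The condition of type (7) is taken as q | p-1 instead of 2 < q | p-1, since for q = 2 and p odd the group (C_p x C_p) : C_2 with C_2 acting by inversion (e.g. order 18) would otherwise belong to none of the types. *)

(* Defs.v *)
From HB Require Import structures.
From mathcomp Require Import all_boot all_order all_fingroup all_algebra.
From mathcomp Require Import all_solvable.

Set Implicit Arguments.
Unset Strict Implicit.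
Unset Printing Implicit Defensive.

Import GroupScope GRing.Theory.

(* The cyclic group of order n > 0 is [Zp n], of order n also when n = 1
   (whereas ['Z_1] has two elements); n = 1 does occur below, for p.-1 and
   q.-1. *)

Definition Hol (gT : finGroupType) (A : {group gT}) :
    {group sdprod_by [Aut A]%gact} :=
  [set: sdprod_by [Aut A]%gact]%G.

Definition nondirect_sdprod (gT : finGroupType) (N H G : {set gT}) : Prop :=
  N ><| H = G /\ ~~ (H \subset 'C(N)).

(* [G] is a semidirect product of a normal copy [V] of C_p x C_p by a cyclic
   group of order [q], a generator [x] of which acts on [V] as a matrix
   satisfying [P] in some basis (the one given by [f]). *)
Definition matrix_sdprod (p q : nat) (P : 'M['F_p]_2 -> Prop)
    (gT : finGroupType) (G : {group gT}) : Prop :=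
  exists (V : {group gT}) (x : gT) (f : {morphism V >-> 'rV['F_p]_2})
         (M : 'M['F_p]_2),
    [/\ V ><| <[x]> = G, #[x] = q,
        isom V [set: 'rV['F_p]_2] f,
        {in V, forall v, f (v ^ x)%g = (f v *m M)%R}
      & P M].

Definition scalar_nonid (p : nat) (M : 'M['F_p]_2) : Prop :=
  is_scalar_mx M /\ M <> 1%:M%R.

Definition diag_nonscalar (p : nat) (M : 'M['F_p]_2) : Prop :=
  [/\ is_diag_mx M, ~~ is_scalar_mx M & ~~ eigenvalue M 1%R].

Definition D0_matrix (p : nat) (M : 'M['F_p]_2) : Prop :=
  diag_nonscalar M /\ (\det M <> 1)%R.

Definition D1_matrix (p : nat) (M : 'M['F_p]_2) : Prop :=
  diag_nonscalar M /\ (\det M = 1)%R.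

(* A Singer cycle is an element of order p^2 - 1 of GL(2,p); its suitable
   powers are those of order [q]. *)
Definition Singer_power (p q : nat) (M : 'M['F_p]_2) : Prop :=
  exists (S : {'GL_2(p)}) (k : nat),
    [/\ #[S] = (p ^ 2).-1, #[S ^+ k] = q & M = GLval (S ^+ k)].

(* C_2 |x (Hol(C_p) x Hol(C_p)), where C_2 exchanges the two factors. *)
Definition is_C2_Hol_Hol (p : nat) (aT : finGroupType) (A : {group aT}) :
    Prop :=
  exists (B1 B2 B : {group aT}) (t : aT),
    [/\ B ><| <[t]> = A, #[t] = 2, B1 \x B2 = B, B1 :^ t = B2
      & B1 \isog Hol (Zp_group p) /\ B2 \isog Hol (Zp_group p)].

(* (C_2 |x C_{p^2-1}) |x (C_p x C_p): here C_{p^2-1} is generated by a Singer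
   cycle, so C_2 |x C_{p^2-1} is a subgroup of GL(2,p), that is, it acts
   faithfully on C_p x C_p. *)
Definition is_C2_Singer_plane (p : nat) (aT : finGroupType) (A : {group aT}) :
    Prop :=
  exists V K S T : {group aT},
    [/\ nondirect_sdprod V K A, V \isog setX (Zp p) (Zp p), 'C_K(V) = 1
      & [/\ nondirect_sdprod S T K, S \isog Zp (p ^ 2).-1 & T \isog Zp 2]].

Inductive p2q_type : Set :=
  Type1 | Type2 | Type3 | Type4 | Type5 | Type6
| Type7 | Type8 | Type9 | Type10 | Type11.

Definition type_cond (p q : nat) (t : p2q_type) : Prop :=
  match t with
  | Type1 | Type5 => True
  | Type2 | Type11 => p %| q.-1
  | Type3 => p ^ 2 %| q.-1
  | Type4 | Type6 => q %| p.-1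
  (* The value q = 2 must be allowed here: -1 is then a non-identity scalar,
     and the resulting group of order 2p^2 (generalised dihedral over
     C_p x C_p) belongs to none of the other types. *)
  | Type7 => q %| p.-1
  | Type8 => 3 < q /\ q %| p.-1
  | Type9 => 2 < q /\ q %| p.-1
  | Type10 => 2 < q /\ q %| p.+1
  end%N.

Definition type_shape (p q : nat) (t : p2q_type)
    (gT : finGroupType) (G : {group gT}) : Prop :=
  match t with
  | Type1 => G \isog setX (Zp (p ^ 2)) (Zp q)
  | Type2 => exists N H : {group gT},
      [/\ N ><| H = G, N \isog Zp q, H \isog Zp (p ^ 2) & #|'Z(G)| = p]
  | Type3 => exists N H : {group gT},
      [/\ N ><| H = G, N \isog Zp q, H \isog Zp (p ^ 2) & 'Z(G) = 1]
  | Type4 => exists N H : {group gT},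
      [/\ nondirect_sdprod N H G, N \isog Zp (p ^ 2) & H \isog Zp q]
  | Type5 => G \isog setX (setX (Zp p) (Zp p)) (Zp q)
  | Type6 => exists A B N H : {group gT},
      [/\ A \x B = G, A \isog Zp p,
          nondirect_sdprod N H B, N \isog Zp p & H \isog Zp q]
  | Type7 => matrix_sdprod q (@scalar_nonid p) G
  | Type8 => matrix_sdprod q (@D0_matrix p) G
  | Type9 => matrix_sdprod q (@D1_matrix p) G
  | Type10 => matrix_sdprod q (@Singer_power p q) G
  | Type11 => exists A B N H : {group gT},
      [/\ A \x B = G, A \isog Zp p,
          nondirect_sdprod N H B, N \isog Zp q & H \isog Zp p]
  end.

Definition has_type (p q : nat) (t : p2q_type)
    (gT : finGroupType) (G : {group gT}) : Prop :=
  type_cond p q t /\ type_shape p q t G.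

Definition type_Aut (p q : nat) (t : p2q_type)
    (aT : finGroupType) (A : {group aT}) : Prop :=
  match t with
  | Type1 => A \isog setX (setX (Zp p) (Zp p.-1)) (Zp q.-1)
  | Type2 => A \isog setX (Zp p) (Hol (Zp_group q))
  | Type3 => A \isog Hol (Zp_group q)
  | Type4 => A \isog Hol (Zp_group (p ^ 2))
  | Type5 => A \isog setX 'GL_2(p) (Zp q.-1)
  | Type6 => A \isog setX (Zp p.-1) (Hol (Zp_group p))
  | Type7 => A \isog Hol (setX_group (Zp_group p) (Zp_group p))
  | Type8 => A \isog setX (Hol (Zp_group p)) (Hol (Zp_group p))
  | Type9 => is_C2_Hol_Hol p A
  | Type10 => is_C2_Singer_plane p A
  | Type11 => A \isog setX (Hol (Zp_group p)) (Hol (Zp_group q))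
  end.

(* Main.v *)
Require Import Defs.
From mathcomp Require Import all_boot all_order all_fingroup all_algebra.
From mathcomp Require Import all_solvable.
From mathcomp Require Import mxrepresentation mxabelem finfield ring.

Set Implicit Arguments.
Unset Strict Implicit.
Unset Printing Implicit Defensive.

Import GroupScope GRing.Theory FinRing.Theory.

(** A group G of order p^2 q splits over a normal Sylow subgroup
([sylow_split]): if the Sylow q-subgroup is not normal, then either q divides
p - 1 and the Sylow p-subgroup is normal by counting, or the q-subgroups
account for all but p^2 elements of G, which therefore form the only subgroup
of order p^2. As the orders are coprime, G is known once the action of one
Sylow subgroup P or Q on the other, normal one is known. Trivial actions give
the types 1 and 5.

If Q is normal and P acts nontrivially, it acts through the cyclic group Aut Q,
and the order of the kernel, which is then the centre of G, gives the types 2,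
3 and 11. If P is normal and cyclic, Aut P is cyclic as well, hence type 4. In
both situations two actions whose images have the same order differ by an
isomorphism ([cyclic_Aut_transport]).

If P is normal and elementary abelian, then P is the direct product of [P, Q]
and C_P(Q), and a nontrivial C_P(Q) splits off as a central factor: type 6.
Otherwise a generator of Q acts on P as a matrix g of order q without the
eigenvalue 1, and G is the subgroup [model g] of the affine group of the plane
generated by the translations and by g. The order p (p - 1)^2 (p + 1) of GL(2,
p) leaves two cases. If q divides p - 1, then X^p - X annihilates g, so that g
is diagonalisable: the types 7, 8 and 9. If not, then q divides p + 1, g has no
eigenvalue at all and its centraliser, the unit group of a field with p^2
elements, is generated by a Singer cycle: type 10. Two models are isomorphic
exactly when the subgroups generated by the matrices are conjugate
([model_conj], [model_isog_conj]); this separates the types 7, 8 and 9, and it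
shows that each of the types 7, 9 and 10 is a single isomorphism class. The
other types are separated by the order of the centre, by the presence of an
element of order p^2, and by the conditions on p and q ([type_unique]).

For the automorphism groups, let G be V ><| X with V abelian of order prime to
that of X. By Schur-Zassenhaus every automorphism of G becomes, after an inner
automorphism given by an element of V, one that preserves X ([Aut_move_compl]).
If X acts faithfully and without nontrivial fixed points, then Aut G is V ><|
N(X), with the normaliser taken in Aut V ([Aut_sdprod_norm]). When Aut V is
abelian this is the whole holomorph of V (types 3 and 4, and the factor of
order p q in type 6); for a model it is the semidirect product of the plane and
of the normaliser of the subgroup generated by g in GL(2, p), which is
everything for a scalar g, the diagonal torus in type 8, and an extension of
the centraliser of g by an involution inverting g in the types 9 and 10. If the
action has a kernel but no nontrivial fixed points, and Aut V is abelian (types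
2 and 11), then Aut G is the direct product of Hol V and of the group of the
automorphisms of X that preserve the action ([Aut_sdprod_unfaithful]). The
types 1, 5 and 6 are direct products of characteristic subgroups. *)

(** * Isomorphisms between semidirect products *)

Section SdprodIso.

Variables gT rT : finGroupType.
Variables (K L A : {group gT}) (K' L' A' : {group rT}).
Variable f : {morphism K >-> rT}.

Hypotheses (defA : K ><| L = A) (defA' : K' ><| L' = A') (isoK : isom K K' f).

Lemma sdprod_extend_isom (g : {morphism L >-> rT}) :
    isom L L' g -> {in K & L, forall k l, f (k ^ l) = f k ^ g l} ->
  exists F : {morphism A >-> rT},
    [/\ isom A A' F, {in K, F =1 f} & {in L, F =1 g}].
Proof.
move=> isoL actfg.
exists (sdprodm_morphism defA actfg); split=> [|k Kk|l Ll].
- have [injf imf] := isomP isoK; have [injg img] := isomP isoL.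
  have [_ defKL _ tiKL] := sdprodP defA'.
  apply/isomP; split; last by rewrite im_sdprodm imf img.
  by rewrite injm_sdprodm injf injg imf img tiKL eqxx.
- exact: sdprodmEl.
exact: sdprodmEr.
Qed.

(** Since the actions are faithful, each [l] determines the [l'] that acts as
[l] does, so the correspondence is a morphism; it is onto by cardinality. *)
Lemma faithful_sdprod_isog :
    'C_L(K) = 1 -> 'C_L'(K') = 1 -> #|L'| <= #|L| ->
    (forall l, l \in L ->
       exists2 l', l' \in L' & {in K, forall k, f (k ^ l) = f k ^ l'}) ->
  A \isog A'.
Proof.
move=> ffL ffL' leL'L actL.
have [injf imf] := isomP isoK.
have [_ _ nKL _] := sdprodP defA.
have Kf k : k \in K -> f k \in K' by move=> Kk; rewrite -imf mem_morphim.
pose acts l l' := (l' \in L') && [forall k in K, f (k ^ l) == f k ^ l'].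
pose g l := odflt 1 [pick l' | acts l l'].
have gP l : l \in L -> g l \in L' /\ {in K, forall k, f (k ^ l) = f k ^ g l}.
  move=> Ll; rewrite /g; case: pickP => [l' /andP[L'l' /forall_inP act] | no].
    by split=> // k Kk; apply/eqP/act.
  have [l' L'l' act] := actL l Ll; have /negP[] := no l'.
  by rewrite /acts L'l'; apply/forall_inP=> k Kk; apply/eqP/act.
have uniq_act l1 l2 : l1 \in L' -> l2 \in L' ->
    {in K, forall k, f k ^ l1 = f k ^ l2} -> l1 = l2.
  move=> L1 L2 act; apply/eqP; rewrite eq_mulgV1 -in_set1 -set1gE -ffL'.
  rewrite inE groupM ?groupV //= -imf; apply/centP=> _ /morphimP[k _ Kk ->].
  apply/commute_sym/commgP/conjg_fixP.
  by rewrite conjgM act // -conjgM mulgV conjg1.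
have gM : {in L &, {morph g : x y / x * y}}.
  move=> x y Lx Ly; have [L1 a1] := gP _ Lx; have [L2 a2] := gP _ Ly.
  have [L3 a3] := gP _ (groupM Lx Ly); apply: uniq_act => [||k Kk].
  - by [].
  - by rewrite groupM.
  rewrite -a3 // !conjgM a2 ?a1 //.
  by rewrite memJ_norm ?(subsetP nKL).
pose g' := Morphism gM.
have injg : 'injm g'.
  apply/subsetP=> x /morphpreP[Lx /set1P gx1]; rewrite -ffL inE Lx.
  apply/centP=> k Kk; apply/commute_sym/commgP/conjg_fixP.
  apply: (injmP injf); rewrite ?memJ_norm ?(subsetP nKL) //.
  by have [_ ->] := gP _ Lx; rewrite // [g x]gx1 conjg1.
have img : g' @* L = L'.
  apply/eqP; rewrite eqEcard card_injm // leL'L andbT.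
  by apply/subsetP=> _ /morphimP[x _ Lx ->]; case: (gP _ Lx).
have isoL : isom L L' g' by apply/isomP.
have [|F [/isom_isog-> //]] := sdprod_extend_isom isoL.
by move=> k l Kk Ll; case: (gP _ Ll) => _; apply.
Qed.

End SdprodIso.

(** * Automorphisms of coprime semidirect products *)

Section AutGeneral.

Variable gT : finGroupType.
Implicit Types G V X A B : {group gT}.

(** The image of the complement [X] is another complement of the normal Hall
subgroup [V], hence conjugate to [X] under [V] by the Schur-Zassenhaus theorem.
*)
Lemma Aut_move_compl V X G a :
    V ><| X = G -> coprime #|V| #|X| -> solvable V -> a \in Aut G ->
  exists2 v, v \in V & (a * conj_aut G v^-1) @: X = X.
Proof.
move=> defG coVX solV AutGa.
have [nsVG sXG defVX nVX tiVX] := sdprod_context defG.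
have EaX : autm AutGa @* X = a @: X by rewrite morphimEsub.
have [v Vv defaX] : exists2 v, v \in V & a @: X = X :^ v.
  rewrite -EaX; apply: (SchurZassenhaus_trans_sol solV nVX) => //.
    by rewrite defVX (subset_trans (morphimS _ sXG)) ?im_autm.
  by rewrite card_injm ?injm_autm.
exists v => //; have Gv := subsetP (normal_sub nsVG) _ Vv.
have nGv : v^-1 \in 'N(G) by rewrite groupV (subsetP (normG G)).
apply/setP=> x; apply/imsetP/idP=> [[y Xy ->] | Xx].
  rewrite permM norm_conj_autE // ?Aut_closed ?(subsetP sXG) //.
  by rewrite -mem_conjg -defaX imset_f.
have: x ^ v \in a @: X by rewrite defaX memJ_conjg.
case/imsetP=> y Xy def_xv; exists y => //.
by rewrite permM -def_xv norm_conj_autE ?conjgK ?memJ_norm ?(subsetP sXG) //;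
   rewrite -[v]invgK groupV.
Qed.

(** Conjugation embeds [A] in [Aut G]; it is onto because [A] contains [V], so
only the automorphisms that preserve [X] remain to be realised. *)
Lemma Aut_isog_conj V X G A :
    V ><| X = G -> coprime #|V| #|X| -> solvable V ->
    V \subset A -> A \subset 'N(G) -> 'C_A(G) = 1 ->
    (forall a, a \in Aut G -> a @: X = X ->
       exists2 b, b \in A & {in G, forall g, a g = g ^ b}) ->
  Aut G \isog A.
Proof.
move=> defG coVX solV sVA nGA cAG indA; rewrite isog_sym.
have injA : 'injm (restrm nGA (conj_aut G)).
  by rewrite ker_restrm ker_conj_aut cAG.
suffices imA : restrm nGA (conj_aut G) @* A = Aut G.
  by rewrite -[X in _ \isog X]imA; apply: sub_isog.
rewrite morphim_restrm setIid.
apply/eqP; rewrite eqEsubset Aut_conj_aut /=; apply/subsetP=> a AutGa.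
have [v Vv aX] := Aut_move_compl defG coVX solV AutGa.
have Av := subsetP sVA _ Vv.
have [|//|b Ab defa'] := indA (a * conj_aut G v^-1).
  by rewrite groupM ?Aut_aut.
have nGv : v \in 'N(G) by rewrite (subsetP nGA).
apply/morphimP; exists (b * v); rewrite ?groupM // ?(subsetP nGA) //.
apply: (eq_Aut AutGa); first exact: Aut_aut.
move=> x Gx; rewrite norm_conj_autE ?groupM // ?(subsetP nGA) // conjgM -defa' //.
by rewrite permM norm_conj_autE ?Aut_closed ?groupV // conjgKV.
Qed.

Lemma coprime_sdprod_char V X G :
  V ><| X = G -> coprime #|V| #|X| -> V \char G.
Proof.
move=> defG coVX; have [nsVG _ _ _ _] := sdprod_context defG.
have hallV : Hall G V.
  rewrite /Hall (normal_sub nsVG) -divgS ?(normal_sub nsVG) //=.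
  by rewrite -(sdprod_card defG) mulKn.
by rewrite -(normal_Hall_pcore (Hall_pi hallV) nsVG) pcore_char.
Qed.

Lemma char_imset V G a : V \char G -> a \in Aut G -> a @: V = V.
Proof.
case/charP=> sVG fixV AutGa; have /= := fixV _ (injm_autm AutGa) (im_autm _).
by rewrite morphimEsub.
Qed.

(** An automorphism of [G] that preserves [X] is determined by its restriction
to [V], as [X] acts faithfully; so it is enough to realise the latter by an
element normalising [X]. *)
Lemma Aut_faithful_sdprod V X G A :
    V ><| X = G -> coprime #|V| #|X| -> abelian V ->
    V \subset A -> A \subset 'N(G) -> 'C_A(V) \subset V ->
    'C_X(V) = 1 -> 'C_V(X) = 1 ->
    (forall a, a \in Aut G -> a @: X = X ->
       exists2 b, b \in 'N_A(X) & {in V, forall v, a v = v ^ b}) ->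
  Aut G \isog A.
Proof.
move=> defG coVX abV sVA nGA cAV ffX cVX indA.
have [_ sXG defVX nVX tiVX] := sdprod_context defG.
have sVG : V \subset G by rewrite -defVX mulG_subl.
have charV := coprime_sdprod_char defG coVX.
apply: (Aut_isog_conj defG coVX) => //; first exact: abelian_sol.
  apply/trivgP; rewrite -cVX subsetI (subset_trans _ cAV) ?setIS ?centS //=.
  by rewrite subIset // centS ?orbT.
move=> a AutGa aX; have [b /setIP[Ab nXb] ab] := indA a AutGa aX.
have nVb : b \in 'N(V) by rewrite (subsetP (char_norm_trans charV nGA)).
exists b => // g; rewrite -{1}defVX => /mulsgP[v x Vv Xx ->].
have [Gv Gx] := (subsetP sVG _ Vv, subsetP sXG _ Xx).
have -> : a (v * x) = a v * a x := morphM (autm AutGa) Gv Gx.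
rewrite conjMg ab //.
congr (_ * _); apply/eqP; rewrite eq_mulgV1 -in_set1 -set1gE -ffX.
have Xax : a x \in X by rewrite -aX imset_f.
have Xxb : x ^ b \in X by rewrite memJ_norm.
rewrite inE groupM ?groupV //=; apply/centP=> u.
rewrite -{1}(char_imset charV AutGa) => /imsetP[w Vw ->].
have Gw := subsetP sVG _ Vw.
apply/commute_sym/commgP/conjg_fixP.
have Vwx : w ^ x \in V by rewrite memJ_norm ?(subsetP nVX).
have E : a w ^ a x = a (w ^ x) := esym (morphJ (autm AutGa) Gw Gx).
rewrite conjgM E !ab //.
by rewrite [(w ^ x) ^ b]conjJg conjgK.
Qed.

End AutGeneral.

Lemma char_restr_perm (gT : finGroupType) (H G : {group gT}) a :
  H \char G -> a \in Aut G ->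
  [/\ a \in 'N(H | 'P), restr_perm H a \in Aut H & {in H, restr_perm H a =1 a}].
Proof.
move=> charH AutGa.
have nHa : a \in 'N(H | 'P).
  apply/astabsP=> x; rewrite /= apermE -{1}(char_imset charH AutGa).
  by rewrite mem_imset //; apply: perm_inj.
split=> //; first exact: Aut_restr_perm (char_sub charH) _ _.
by move=> x Hx; rewrite restr_permE.
Qed.

Lemma isog_Aut (gT rT : finGroupType) (G : {group gT}) (H : {group rT}) :
  G \isog H -> Aut G \isog Aut H.
Proof.
by case/isogP=> f injf <-; rewrite isog_sym injm_Aut.
Qed.

Lemma dprod_isog_setX (gT aT rT : finGroupType) (A B G : {group gT})
    (C : {group aT}) (D : {group rT}) :
  A \x B = G -> A \isog C -> B \isog D -> G \isog setX C D.
Proof.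
move=> defG AC BD; apply: (isog_dprod defG (setX_dprod C D)).
  exact: isog_trans AC (isog_setX1 _ _).
exact: isog_trans BD (isog_set1X _ _).
Qed.

Lemma setX_isog (gT1 gT2 rT1 rT2 : finGroupType) (A : {group gT1})
    (B : {group gT2}) (C : {group rT1}) (D : {group rT2}) :
  A \isog C -> B \isog D -> setX A B \isog setX C D.
Proof.
move=> AC BD; apply: (dprod_isog_setX (setX_dprod A B)).
  by apply: isog_trans AC; rewrite isog_sym; apply: isog_setX1.
by apply: isog_trans BD; rewrite isog_sym; apply: isog_set1X.
Qed.

(** Restriction to the two characteristic factors is injective, and it is onto
because any pair of automorphisms glues to an automorphism of the product. *)
Lemma Aut_dprod (gT : finGroupType) (A B G : {group gT}) :
  A \x B = G -> A \char G -> B \char G -> Aut G \isog setX (Aut A) (Aut B).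
Proof.
move=> defG charA charB.
have defGsd : A ><| B = G := dprodWsd defG.
have [_ _ defAB _ _] := sdprod_context defGsd.
pose r a := (restr_perm A a, restr_perm B a).
have rM : {in Aut G &, {morph r : a b / a * b}}.
  move=> a b Aa Ab; have [nAa _ _] := char_restr_perm charA Aa.
  have [nAb _ _] := char_restr_perm charA Ab.
  have [nBa _ _] := char_restr_perm charB Aa.
  have [nBb _ _] := char_restr_perm charB Ab.
  by rewrite /r !morphM.
have injr : 'injm (Morphism rM).
  apply/injmP=> a b Aa Ab /= [eqA eqB]; apply: (eq_Aut Aa Ab) => g.
  rewrite -defAB => /mulsgP[x y Ax By ->].
  have [_ _ rAa] := char_restr_perm charA Aa.
  have [_ _ rAb] := char_restr_perm charA Ab.
  have [_ _ rBa] := char_restr_perm charB Aa.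
  have [_ _ rBb] := char_restr_perm charB Ab.
  have [Gx Gy] := (subsetP (char_sub charA) _ Ax, subsetP (char_sub charB) _ By).
  have -> : a (x * y) = a x * a y := morphM (autm Aa) Gx Gy.
  have -> : b (x * y) = b x * b y := morphM (autm Ab) Gx Gy.
  by rewrite -rAa // -rBa // eqA eqB rAb ?rBb.
apply/isogP; exists (Morphism rM) => //; apply/eqP; rewrite eqEsubset.
apply/andP; split.
  apply/subsetP=> _ /morphimP[a _ Aa ->]; rewrite inE /=.
  have [_ -> _] := char_restr_perm charA Aa.
  by have [_ -> _] := char_restr_perm charB Aa.
apply/subsetP=> [[a b]] /setXP[Aa Ab].
have isoA : isom A A (autm Aa) by apply/isomP; rewrite injm_autm im_autm.
have isoB : isom B B (autm Ab) by apply/isomP; rewrite injm_autm im_autm.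
have fixBA x y : x \in A -> y \in B -> x ^ y = x.
  have [_ _ cAB _] := dprodP defG => Ax By.
  by apply/conjg_fixP/commgP/commute_sym/(centsP cAB).
have [|F [/isomP[injF imF] FA FB]] :=
    sdprod_extend_isom defGsd defGsd isoA isoB.
  by move=> x y Ax By; rewrite /= !fixBA ?Aut_closed.
apply/morphimP; exists (aut injF imF); rewrite ?Aut_aut //=.
have [_ rA rAE] := char_restr_perm charA (Aut_aut injF imF).
have [_ rB rBE] := char_restr_perm charB (Aut_aut injF imF).
congr (_, _); apply/esym; [apply: (eq_Aut rA) | apply: (eq_Aut rB)] => // x Hx.
  by rewrite rAE // autE ?FA // (subsetP (char_sub charA)).
by rewrite rBE // autE ?FB // (subsetP (char_sub charB)).
Qed.

Lemma card_conj_aut (gT : finGroupType) (K L : {group gT}) :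
  L \subset 'N(K) -> 'C_L(K) = 1 -> #|conj_aut K @* L| = #|L|.
Proof.
move=> nKL ffL.
have injL : 'injm (restrm nKL (conj_aut K)) by rewrite ker_restrm ker_conj_aut ffL.
by have:= card_injm injL (subxx L); rewrite morphim_restrm setIid.
Qed.

Lemma faithful_full_act (gT : finGroupType) (K L : {group gT}) :
    L \subset 'N(K) -> 'C_L(K) = 1 -> #|Aut K| <= #|L| ->
  forall a, a \in Aut K ->
  exists2 l, l \in L & {in K, forall k, a k = k ^ l}.
Proof.
move=> nKL ffL leL a Aa; have: a \in conj_aut K @* L.
  suffices -> : conj_aut K @* L = Aut K by [].
  apply/eqP; rewrite eqEcard Aut_conj_aut /=.
  by rewrite card_conj_aut.
case/morphimP=> l nKl Ll ->; exists l => // k Kk.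
exact: norm_conj_autE.
Qed.

Lemma full_sdprod_isog (gT rT : finGroupType) (K L A : {group gT})
    (K' L' A' : {group rT}) :
    K ><| L = A -> K' ><| L' = A' -> K \isog K' ->
    'C_L(K) = 1 -> 'C_L'(K') = 1 -> #|Aut K'| <= #|L'| -> #|L'| <= #|L| ->
  A \isog A'.
Proof.
move=> defA defA' /isog_isom[f isof] ffL ffL' fullL' leL.
apply: (faithful_sdprod_isog defA defA' isof) => // l Ll.
have [_ _ _ nKL _] := sdprod_context defA.
have [_ _ _ nKL' _] := sdprod_context defA'.
have [injf imf] := isomP isof.
have Al : conj_aut K l \in Aut K by apply: Aut_aut.
pose al := Aut_isom injf (subxx K) (conj_aut K l).
have Aal : al \in Aut K' by rewrite -imf Aut_Aut_isom.
have [l' L'l' al'] := faithful_full_act nKL' ffL' fullL' Aal.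
exists l' => // k Kk; rewrite -al' ?Aut_isomE //.
  by rewrite norm_conj_autE // (subsetP nKL).
by rewrite -imf mem_morphim.
Qed.

(** * Holomorphs *)

Section Holomorph.

Variables (gT : finGroupType) (W : {group gT}).

Definition HolN := (sdpair1 [Aut W]%gact @* W)%G.
Definition HolA := (sdpair2 [Aut W]%gact @* Aut W)%G.

Lemma Hol_sdprod : HolN ><| HolA = Hol W.
Proof. exact: sdprod_sdpair. Qed.

Lemma Hol_act : {in W & Aut W, forall w a,
  sdpair1 [Aut W]%gact w ^ sdpair2 [Aut W]%gact a = sdpair1 [Aut W]%gact (a w)}.
Proof. by move=> w a Ww Aa; rewrite -sdpair_act. Qed.

Lemma isom_HolN : isom W HolN (sdpair1 [Aut W]%gact).
Proof. by apply/isomP; rewrite injm_sdpair1. Qed.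

Lemma isom_HolA : isom (Aut W) HolA (sdpair2 [Aut W]%gact).
Proof. by apply/isomP; rewrite injm_sdpair2. Qed.

Lemma Hol_faithful : 'C_HolA(HolN) = 1.
Proof.
apply/trivgP/subsetP=> _ /setIP[/morphimP[a _ Aa ->] /centP caW].
rewrite inE -(morph1 (sdpair2_morphism [Aut W]%gact)); apply/eqP.
congr (sdpair2 _ _); apply: (eq_Aut Aa) => // w Ww; rewrite perm1.
apply: (injmP (injm_sdpair1 [Aut W]%gact)); rewrite ?Aut_closed //=.
rewrite -Hol_act //; apply/conjg_fixP/commgP/commute_sym/caW.
exact: mem_morphim.
Qed.

End Holomorph.

(** The bound forces the faithful group [L] to act as the full automorphism
group. *)
Lemma isog_Hol (gT rT : finGroupType) (K L A : {group gT}) (W : {group rT}) :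
    K ><| L = A -> 'C_L(K) = 1 -> K \isog W -> #|Aut W| <= #|L| ->
  A \isog Hol W.
Proof.
move=> defA ffL KW leL; have WN := isom_isog _ (subxx _) (isom_HolN W).
have oA := card_isog (isom_isog _ (subxx _) (isom_HolA W)).
apply: (full_sdprod_isog defA (Hol_sdprod W)); rewrite ?Hol_faithful //.
- exact: isog_trans KW WN.
- by rewrite -(card_isog (isog_Aut WN)) oA.
by rewrite -oA.
Qed.

Lemma Hol_isog (gT rT : finGroupType) (V : {group gT}) (W : {group rT}) :
  V \isog W -> Hol V \isog Hol W.
Proof.
move=> VW; apply: (isog_Hol (Hol_sdprod V) (Hol_faithful V)).
  apply: isog_trans VW; rewrite isog_sym.
  exact: isom_isog (isom_HolN V).
by rewrite -(card_isog (isog_Aut VW)) (card_isog (isom_isog _ (subxx _) (isom_HolA V))).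
Qed.

Lemma sdprod_sub (gT : finGroupType) (K L A X : {group gT}) :
  K ><| L = A -> X \subset L -> K ><| X = K <*> X.
Proof.
move=> /sdprod_context[_ _ _ nKL tiKL] sXL.
rewrite sdprodEY ?(subset_trans sXL) //; apply/trivgP.
by rewrite -tiKL setIS.
Qed.

Lemma faithful_cent (gT : finGroupType) (K L A : {group gT}) :
  K ><| L = A -> abelian K -> 'C_L(K) = 1 -> 'C_A(K) = K.
Proof.
move=> defA abK ffL; have [nsKA _ defKL nKL tiKL] := sdprod_context defA.
apply/eqP; rewrite eqEsubset subsetI (normal_sub nsKA) -abelianE abK andbT.
by rewrite -defKL -group_modl // ffL mulg1 subxx.
Qed.

Section AutNorm.

Variable gT : finGroupType.
Variables K L A X G : {group gT}.

Hypotheses (defA : K ><| L = A) (abK : abelian K).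
Hypotheses (ffL : 'C_L(K) = 1) (fullL : #|Aut K| <= #|L|).
Hypotheses (sXL : X \subset L) (defG : K ><| X = G).
Hypotheses (coKX : coprime #|K| #|X|) (cKX : 'C_K(X) = 1).

(** [A] is in effect the holomorph of [K]. An automorphism of [G] that
preserves [X] restricts on [K] to conjugation by some [l] in [L]; its values on
[X] are then forced by faithfulness to be the conjugates by [l], so [l]
normalises [X]. *)
Lemma Aut_sdprod_norm : Aut G \isog K <*> 'N_L(X).
Proof.
have [_ sLA _ nKL _] := sdprod_context defA.
have [nsKG sXG defKX nKX tiKX] := sdprod_context defG.
have charK := coprime_sdprod_char defG coKX.
have sNA : K <*> 'N_L(X) \subset A.
  rewrite join_subG subIset ?sLA // andbT.
  by case/sdprod_context: defA => /andP[].
have ffX : 'C_X(K) = 1 by apply/trivgP; rewrite -ffL setSI.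
apply: (Aut_faithful_sdprod defG coKX abK) => //.
- exact: joing_subl.
- rewrite join_subG (subset_trans (normal_sub nsKG)) ?normG //=.
  rewrite -defKX normsM // ?subsetIr //.
  by rewrite (subset_trans (subsetIl _ _)).
- by rewrite (subset_trans (setSI _ sNA)) // (faithful_cent defA).
move=> a Aa aX; have [nKa rKa aK] := char_restr_perm charK Aa.
have [l Ll al] := faithful_full_act nKL ffL fullL rKa.
have {}al : {in K, forall k, a k = k ^ l} by move=> k Kk; rewrite -al ?aK.
have sKG := subsetP (char_sub charK).
suffices nXl : l \in 'N(X).
  by exists l; rewrite // inE nXl mem_gen // inE inE Ll nXl orbT.
rewrite inE; apply/subsetP=> _ /imsetP[x Xx ->].
have [Xax Gx] : a x \in X /\ x \in G by rewrite -aX imset_f ?(subsetP sXG).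
suffices -> : x ^ l = a x by [].
have [Lx Lax] := (subsetP sXL _ Xx, subsetP sXL _ Xax).
apply/eqP; rewrite eq_mulgV1 -in_set1 -set1gE -ffL.
rewrite inE groupM ?groupV ?groupJ //=; apply/centP=> u.
rewrite -{1}(char_imset charK Aa) => /imsetP[k Kk ->].
have nKx : x \in 'N(K) := subsetP nKX x Xx.
apply/commute_sym/commgP/conjg_fixP.
have akx : a (k ^ x) = a k ^ a x := morphJ (autm Aa) (sKG _ Kk) Gx.
rewrite conjgM; apply: (canLR (conjgK _)).
by rewrite -akx !al ?memJ_norm // -conjJg.
Qed.

End AutNorm.

Lemma abelian_Aut_act (gT : finGroupType) (V Q : {group gT}) :
    Q \subset 'N(V) -> abelian (Aut V) ->
  {in Q, forall x, {in Aut V & V, forall (a : {perm gT}) v, a (v ^ x) = a v ^ x}}.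
Proof.
move=> nVQ abA x Qx a v Aa Vv; have nVx := subsetP nVQ x Qx.
have Ac : conj_aut V x \in Aut V by rewrite Aut_aut.
have Vav : a v \in V by apply: Aut_closed.
have /permP/(_ v) := centsP abA _ Aa _ Ac.
by rewrite !permM !norm_conj_autE.
Qed.

(** Embed [G] in [Hol V], with [Q] acting through a subgroup of [Aut V]. By
hypothesis that subgroup is central in [Aut V], hence normalised by all of it,
and [Aut_sdprod_norm] gives the whole holomorph. *)
Lemma Aut_sdprod_Hol (gT : finGroupType) (V Q G : {group gT}) :
    V ><| Q = G -> abelian V -> coprime #|V| #|Q| ->
    'C_Q(V) = 1 -> 'C_V(Q) = 1 ->
    {in Q, forall x, {in Aut V & V, forall (a : {perm gT}) v, a (v ^ x) = a v ^ x}} ->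
  Aut G \isog Hol V.
Proof.
move=> defG abV coVQ ffQ cVQ centQ.
have [_ _ _ nVQ _] := sdprod_context defG.
have [_ _ _ nNA _] := sdprod_context (Hol_sdprod V).
have [injN imN] := isomP (isom_HolN V).
have [injA imA] := isomP (isom_HolA V).
pose X := (sdpair2 [Aut V]%gact @* (conj_aut V @* Q))%G.
have sXA : X \subset HolA V by rewrite morphimS ?Aut_conj_aut.
have oX : #|X| = #|Q|.
  by rewrite card_injm ?Aut_conj_aut // -(card_conj_aut nVQ ffQ).
have oN : #|HolN V| = #|V| by rewrite card_injm.
have XP l : l \in X -> exists2 x, x \in Q & l = sdpair2 [Aut V]%gact (conj_aut V x).
  by case/morphimP=> _ _ /morphimP[x _ Qx ->] ->; exists x.
have actX x v : x \in Q -> v \in V ->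
    sdpair1 [Aut V]%gact v ^ sdpair2 [Aut V]%gact (conj_aut V x)
      = sdpair1 [Aut V]%gact (v ^ x).
  move=> Qx Vv; rewrite Hol_act ?Aut_aut // norm_conj_autE //.
  exact: subsetP nVQ _ Qx.
have defG' := sdprod_sub (Hol_sdprod V) sXA.
have GG' : G \isog HolN V <*> X.
  apply: (faithful_sdprod_isog defG defG' (isom_HolN V)); rewrite ?oX //.
    by apply/trivgP; rewrite -(Hol_faithful V) setSI.
  move=> x Qx; exists (sdpair2 [Aut V]%gact (conj_aut V x)).
    by rewrite !mem_morphim ?Aut_aut // (subsetP nVQ).
  by move=> v Vv; rewrite actX.
apply: isog_trans (isog_Aut GG') _.
suffices <- : HolN V <*> 'N_(HolA V)(X) = Hol V.
  apply: (Aut_sdprod_norm (Hol_sdprod V) _ _ _ sXA defG').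
  - by rewrite morphim_abelian.
  - exact: Hol_faithful.
  - rewrite -(card_isog (isog_Aut (isom_isog _ (subxx _) (isom_HolN V)))).
    by rewrite (card_isog (isom_isog _ (subxx _) (isom_HolA V))).
  - by rewrite oN oX.
  apply/trivgP/subsetP=> _ /setIP[/morphimP[v _ Vv ->] /centP cvX].
  rewrite inE -(morph1 (sdpair1_morphism [Aut V]%gact)); apply/eqP.
  congr (sdpair1 _ _); apply/set1P; rewrite -set1gE -cVQ inE Vv.
  apply/centP=> x Qx; apply/commgP/conjg_fixP.
  apply: (injmP injN); rewrite ?memJ_norm ?(subsetP nVQ) //= -actX //.
  apply/conjg_fixP/commgP/cvX.
  by rewrite !mem_morphim ?Aut_aut // (subsetP nVQ).
rewrite -(sdprodWY (Hol_sdprod V)); congr (_ <*> _); apply/setIidPl.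
suffices cAX : HolA V \subset 'C(X) by rewrite (subset_trans cAX) ?cent_sub.
apply/centsP=> _ /morphimP[a _ Aa ->] _ /XP[x Qx ->].
rewrite /commute -!morphM ?Aut_aut //; congr (sdpair2 _ _).
have Ax : conj_aut V x \in Aut V by apply: Aut_aut.
have nVx := subsetP nVQ _ Qx.
apply: (@eq_Aut _ V) => [||v Vv]; rewrite ?groupM //.
by rewrite !permM !norm_conj_autE ?Aut_closed // centQ.
Qed.

(** * Automorphisms when the action has a kernel *)

Section AutUnfaithful.

Variables (gT : finGroupType) (N P G : {group gT}) (L : {group {perm gT}}).

Hypotheses (defG : N ><| P = G) (coNP : coprime #|N| #|P|).
Hypotheses (abN : abelian N) (abAN : abelian (Aut N)) (cNP : 'C_N(P) = 1).
Hypothesis LP : forall c,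
  c \in L <-> c \in Aut P /\ {in N & P, forall n x, n ^ c x = n ^ x}.

Let sdG := sdprod_context defG.
Let nNP : P \subset 'N(N). Proof. by case: sdG. Qed.
Let sNG : N \subset G. Proof. by case: sdG => /andP[]. Qed.
Let sPG : P \subset G. Proof. by case: sdG. Qed.
Let charN : N \char G. Proof. exact: coprime_sdprod_char defG coNP. Qed.

Let Gn n : n \in N -> n \in G. Proof. exact: subsetP. Qed.
Let Gx x : x \in P -> x \in G. Proof. exact: subsetP. Qed.
Let Nnx n x : n \in N -> x \in P -> n ^ x \in N.
Proof. by move=> Nn Px; rewrite memJ_norm ?(subsetP nNP). Qed.

Let AutN_actC (a : {perm gT}) n x :
  a \in Aut N -> n \in N -> x \in P -> a (n ^ x) = a n ^ x.
Proof. by move=> Aa Nn Px; apply: (abelian_Aut_act nNP abAN). Qed.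

Let Aut_eqNP a b : a \in Aut G -> b \in Aut G ->
  {in N, a =1 b} -> {in P, a =1 b} -> a = b.
Proof.
move=> Aa Ab eqN eqP; apply: (eq_Aut Aa Ab) => g.
have [_ _ <- _ _] := sdG => /mulsgP[n x Nn Px ->].
have -> : a (n * x) = a n * a x := morphM (autm Aa) (Gn Nn) (Gx Px).
have -> : b (n * x) = b n * b x := morphM (autm Ab) (Gn Nn) (Gx Px).
by rewrite eqN ?eqP.
Qed.

(** The two automorphisms glue because [Aut N] is abelian: [a] commutes with
the action of [P], and [c] preserves it. *)
Let extAut a c : a \in Aut N -> c \in L ->
  exists b, [/\ b \in Aut G, {in N, b =1 a} & {in P, b =1 c}].
Proof.
move=> Aa /LP[Ac actc].
have isoa : isom N N (autm Aa) by apply/isomP; rewrite injm_autm im_autm.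
have isoc : isom P P (autm Ac) by apply/isomP; rewrite injm_autm im_autm.
have [|F [/isomP[injF imF] FN FP]] := sdprod_extend_isom defG defG isoa isoc.
  move=> n x Nn Px; rewrite /= actc ?Aut_closed //; exact: AutN_actC.
exists (aut injF imF); split=> [|n Nn|x Px]; first exact: Aut_aut.
  by rewrite autE ?FN ?Gn.
by rewrite autE ?FP ?Gx.
Qed.

(** The restriction of [a] to [N] commutes with the action of [P], and
cancelling it shows that [a x] acts on [N] as [x] does. *)
Let stabP a : a \in Aut G -> a @: P = P -> 
  [/\ a \in 'N(P | 'P), restr_perm P a \in L & {in P, restr_perm P a =1 a}].
Proof.
move=> Aa aP; have nPa : a \in 'N(P | 'P).
  apply/astabsP=> x; rewrite /= apermE -{1}aP.
  by rewrite mem_imset //; apply: perm_inj.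
have rE : {in P, restr_perm P a =1 a} by move=> x Px; rewrite restr_permE.
split=> //; apply/LP; split; first exact: Aut_restr_perm Aa.
have [_ rA rAE] := char_restr_perm charN Aa.
move=> n x; rewrite -{1}(char_imset charN Aa) => /imsetP[m Nm ->] Px.
rewrite rE // -(rAE m) // -(AutN_actC rA Nm Px) !rAE ?Nnx //.
exact: esym (morphJ (autm Aa) (Gn Nm) (Gx Px)).
Qed.

(** [Nh] consists of the inner automorphisms given by [N]; [L1] and [A2] of
those automorphisms that fix [P] pointwise, and of those that fix [N] pointwise
and preserve [P]. The factors are [Nh ><| L1], isomorphic to [Hol N], and [A2],
isomorphic to [L]. *)
Let Nh := (conj_aut G @* N)%G.
Let L1 := 'C_(Aut G)(P | 'P)%G.
Let A2 := ('C_(Aut G)(N | 'P) :&: 'N(P | 'P))%G.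

Let L1P a : a \in L1 <-> a \in Aut G /\ {in P, forall x, a x = x}.
Proof.
rewrite inE; split=> [/andP[-> /astabP fixP] | [-> fixP]] //=.
by apply/astabP.
Qed.

Let A2P a : a \in A2 <->
  [/\ a \in Aut G, {in N, forall n, a n = n} & a @: P = P].
Proof.
rewrite in_setI inE; split=> [/andP[/andP[-> /astabP fixN] nPa] | [Aa fixN aP]].
  by split=> //; have /= := astabs_setact nPa.
have [nPa _ _] := stabP Aa aP.
by rewrite Aa nPa andbT; apply/astabP.
Qed.

Let NhP a : a \in Nh -> exists2 n, n \in N & a = conj_aut G n.
Proof. by case/morphimP=> n _ Nn ->; exists n. Qed.

Let mem_Nh n : n \in N -> conj_aut G n \in Nh.
Proof. by move=> Nn; rewrite mem_morphim // (subsetP (normG G)) ?Gn. Qed.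

Let conjE n g : n \in N -> g \in G -> conj_aut G n g = g ^ n.
Proof. by move=> Nn Gg; rewrite norm_conj_autE // (subsetP (normG G)) ?Gn. Qed.

Let AutN_stab a n : a \in Aut G -> n \in N -> a n \in N.
Proof. by move=> Aa Nn; rewrite -(char_imset charN Aa) imset_f. Qed.

Let NhJ n a : n \in N -> a \in Aut G -> conj_aut G n ^ a = conj_aut G (a n).
Proof.
move=> Nn Aa; have An : conj_aut G n \in Aut G by apply: Aut_aut.
apply: (eq_Aut (groupJ An Aa)) => [|g Gg]; first exact: Aut_aut.
have Gag : a^-1 g \in G by rewrite Aut_closed ?groupV.
rewrite conjgE !permM (conjE Nn Gag) (conjE (AutN_stab Aa Nn) Gg).
have -> : a (a^-1 g ^ n) = a (a^-1 g) ^ a n := morphJ (autm Aa) Gag (Gn Nn).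
by rewrite permKV.
Qed.

(** The commutators of [n] with [P] lie in [N], and here also in [P], so [n]
centralises [P]. *)
Let CN1 n : n \in N -> {in P, forall x, x ^ n \in P} -> n = 1.
Proof.
move=> Nn nPn; apply/set1P; rewrite -set1gE -cNP inE Nn /=.
apply/centP=> x Px; apply/commgP; rewrite -in_set1 -set1gE.
have [_ _ _ _ <-] := sdG; rewrite inE {1}commgEl groupM ?Nnx ?groupV //=.
by rewrite commgEr groupM ?nPn ?groupV.
Qed.

Let nGN : N \subset 'N(G). Proof. exact: subset_trans sNG (normG G). Qed.

Let injNh : 'injm (restrm nGN (conj_aut G)).
Proof.
by rewrite ker_restrm ker_conj_aut; rewrite -cNP setIS ?centS.
Qed.

Let defA1 : Nh ><| L1 = Nh <*> L1.
Proof.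
rewrite sdprodEY //.
  apply/subsetP=> a /L1P[Aa _]; rewrite inE; apply/subsetP=> _ /imsetP[_ /NhP[n Nn ->] ->].
  by rewrite NhJ // mem_Nh // AutN_stab.
apply/trivgP/subsetP=> _ /setIP[/NhP[n Nn ->] /L1P[_ fixP]].
have -> : n = 1.
  by apply: CN1 => // x Px; rewrite -conjE ?fixP ?Gx.
by rewrite morph1 inE.
Qed.

Let A1_Hol : Nh <*> L1 \isog Hol N.
Proof.
have isoN : N \isog Nh.
  by have:= sub_isog (subxx N) injNh; rewrite morphim_restrm setIid.
apply: (isog_Hol defA1); last 2 first.
- by rewrite isog_sym.
- suffices <- : restr_perm N @* L1 = Aut N by apply: leq_morphim.
  apply/eqP; rewrite eqEsubset; apply/andP; split.
    apply/subsetP=> _ /morphimP[a _ /L1P[Aa _] ->].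
    by have [] := char_restr_perm charN Aa.
  apply/subsetP=> a Aa; have [b [Ab bN bP]] := extAut Aa (group1 L).
  have [nNb rA rE] := char_restr_perm charN Ab.
  apply/morphimP; exists b => //.
    by apply/L1P; split=> // x Px; rewrite bP // perm1.
  by apply: (eq_Aut Aa rA) => n Nn; rewrite rE ?bN.
apply/trivgP/subsetP=> a /setIP[/L1P[Aa aP] /centP caN]; rewrite inE.
apply/eqP/Aut_eqNP => // [n Nn|x Px]; rewrite perm1; last exact: aP.
apply: (injmP injNh); rewrite ?AutN_stab //.
change (conj_aut G (a n) = conj_aut G n); rewrite -NhJ //.
by apply/conjg_fixP/commgP/commute_sym/caN/mem_Nh.
Qed.

Lemma Aut_sdprod_unfaithful : Aut G \isog setX L (Hol N).
Proof.
have fixA1 a : a \in Nh -> {in N, forall n, a n = n}.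
  move=> /NhP[m Nm ->] n Nn; rewrite conjE ?Gn //.
  by apply/conjg_fixP/commgP/(centsP abN).
have sub1 : Nh <*> L1 \subset Aut G.
  by rewrite join_subG Aut_conj_aut subsetIl.
have cA12 : A2 \subset 'C(Nh <*> L1).
  rewrite centY subsetI; apply/andP; split; apply/centsP=> a /A2P[Aa aN aP].
    move=> _ /NhP[n Nn ->]; apply/commute_sym/commgP/conjg_fixP.
    by rewrite NhJ // aN.
  move=> b /L1P[Ab bP]; apply: Aut_eqNP => [||n Nn|x Px]; rewrite ?groupM //.
    by rewrite !permM aN // aN ?AutN_stab.
  by rewrite !permM bP ?bP // -aP imset_f.
have ti12 : Nh <*> L1 :&: A2 = 1.
  apply/trivgP/subsetP=> a /setIP[]; have [_ _ <- _ _] := sdprod_context defA1.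
  case/mulsgP=> b l Nb L1l -> /A2P[Abl blN blP].
  have [Al lP] := (L1P _).1 L1l; have /NhP[m Nm def_b] := Nb.
  have l1 : l = 1.
    apply: Aut_eqNP => // [n Nn|x Px]; rewrite perm1; last exact: lP.
    by rewrite -{2}(blN n Nn) permM (fixA1 b Nb n Nn).
  rewrite l1 mulg1 in blP *; rewrite def_b in blP *.
  have -> : m = 1.
    by apply: CN1 => // x Px; rewrite -conjE ?Gx // -blP imset_f.
  by rewrite morph1 inE.
have sub2 : A2 \subset Aut G by apply/subsetP=> a /A2P[].
have defAut : Nh <*> L1 \x A2 = Aut G.
  rewrite dprodE // -cent_joinEr //; apply/eqP; rewrite eqEsubset.
  rewrite join_subG sub1 sub2; apply/subsetP=> a Aa.
  have [n Nn aP] := Aut_move_compl defG coNP (abelian_sol abN) Aa.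
  set b := a * _ in aP; have Ab : b \in Aut G by rewrite groupM ?Aut_aut.
  have [_ rA rE] := char_restr_perm charN Ab.
  have [l [Al lN l1P]] := extAut rA (group1 L).
  have lP x : x \in P -> l x = x by move=> Px; rewrite l1P ?perm1.
  have L1l : l \in L1 by apply/L1P.
  have A2b : b * l^-1 \in A2.
    apply/A2P; split; first by rewrite groupM ?groupV.
      by move=> m Nm; rewrite (permM b) -rE // -lN // permK.
    apply/setP=> x; apply/imsetP/idP=> [[y Py ->]|Px].
      rewrite (permM b); have: b y \in P by rewrite -aP imset_f.
      by move=> Pby; rewrite -{1}(lP _ Pby) permK.
    have: x \in b @: P by rewrite aP.
    case/imsetP=> y Py ->; exists y => //; rewrite (permM b).
    have Pby : b y \in P by rewrite -aP imset_f.
    by rewrite -[in RHS](lP _ Pby) permK.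
  have -> : a = (b * l^-1) * l * conj_aut G n.
    rewrite mulgKV /b -mulgA -morphM ?groupV ?mulVg ?morph1 ?mulg1 //.
      by rewrite ?groupV (subsetP nGN).
    by rewrite (subsetP nGN).
  have J1 : (Nh <*> L1) \subset (Nh <*> L1) <*> A2 by apply: joing_subl.
  apply: groupM; first apply: groupM.
  - by rewrite (subsetP (joing_subr _ _)).
  - by rewrite (subsetP J1) // (subsetP (joing_subr _ _)).
  - by rewrite (subsetP J1) // (subsetP (joing_subl _ _)) // mem_Nh.
have A2L : A2 \isog L.
  have nA2 : A2 \subset 'N(P | 'P) by apply: subsetIr.
  have injr : 'injm (restrm nA2 (restr_perm P)).
    apply/injmP=> a b /A2P[Aa aN aP] /A2P[Ab bN bP] eqr.
    have {}eqr : restr_perm P a = restr_perm P b := eqr.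
    have [_ _ rEa] := stabP Aa aP; have [_ _ rEb] := stabP Ab bP.
    apply: Aut_eqNP => // [n Nn|x Px]; first by rewrite aN ?bN.
    by rewrite -rEa // -rEb // eqr.
  have:= sub_isog (subxx A2) injr; rewrite morphim_restrm setIid.
  suffices -> : restr_perm P @* A2 = L by [].
  apply/setP=> c; apply/morphimP/idP=> [[a _ /A2P[Aa aN aP] ->] | Lc].
    by have [] := stabP Aa aP.
  have [b [Ab bN bP]] := extAut (group1 _) Lc.
  have [Ac _] := (LP c).1 Lc.
  have bPP : b @: P = P.
    have := im_autm Ac; rewrite morphimEsub // => {2}<-.
    by apply: eq_in_imset => x Px; rewrite bP.
  have [nPb _ rE] := stabP Ab bPP; exists b => //.
    by apply/A2P; split=> // n Nn; rewrite bN ?perm1.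
  apply: (eq_Aut Ac); first by have [_ /LP[]] := stabP Ab bPP.
  by move=> x Px; rewrite rE ?bP.
have defAut2 : A2 \x (Nh <*> L1) = Aut G by rewrite dprodC.
exact: dprod_isog_setX defAut2 A2L A1_Hol.
Qed.

End AutUnfaithful.

(** * Cyclic normal subgroups *)

Lemma Zp_cyclic n : cyclic (Zp n).
Proof.
rewrite /Zp; case: ifP => _; last exact: cyclic1.
by apply/cyclicP; exists Zp1; rewrite Zp_cycle.
Qed.

Lemma isog_Zp (gT : finGroupType) (G : {group gT}) n :
  0 < n -> (G \isog Zp n) = cyclic G && (#|G| == n).
Proof.
move=> n_gt0; rewrite -[Zp n]/(gval (Zp_group n)) isog_sym.
by rewrite isog_cyclic_card ?Zp_cyclic // card_Zp.
Qed.

Lemma isog_Zp_prime (gT : finGroupType) (G : {group gT}) p :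
  prime p -> (G \isog Zp p) = (#|G| == p).
Proof.
move=> p_pr; rewrite isog_Zp ?prime_gt0 // andb_idl // => /eqP oG.
by rewrite prime_cyclic // oG.
Qed.

Lemma cyclic_Aut_psq (gT : finGroupType) (G : {group gT}) p :
  prime p -> cyclic G -> #|G| = (p ^ 2)%N -> cyclic (Aut G).
Proof.
move=> p_pr cycG oG; have pG : p.-group G by rewrite /pgroup oG pnatX pnat_id.
have ntG : G :!=: 1.
  by rewrite trivg_card1 oG -(expn0 p) eqn_exp2l // prime_gt1.
have En : (logn p #|G|).-1 = 1%N by rewrite oG pfactorK.
have [m [_ _]] := cyclic_pgroup_Aut_structure pG cycG ntG.
rewrite En /= => [[t [_ _ _]]].
case: ifP => _ [] //; first by case.
by move->; apply: cycle_cyclic.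
Qed.

Lemma cyclic_has_order (gT : finGroupType) (G : {group gT}) d :
  cyclic G -> d %| #|G| -> exists2 x, x \in G & #[x] = d.
Proof.
case/cyclicP=> x ->; rewrite -orderE => d_dv; exists (x ^+ (#[x] %/ d)).
  exact: mem_cycle.
have [k ox] := dvdnP d_dv; have d_gt0 : 0 < d.
  by have := order_gt0 x; rewrite ox; case: (d) => //; rewrite muln0.
have k_gt0 : 0 < k by have := order_gt0 x; rewrite ox; case: (k).
by rewrite ox mulnK // orderXdiv ox ?mulKn // dvdn_mulr.
Qed.

Lemma prime_cent_TI (gT : finGroupType) (N H : {group gT}) :
  prime #|N| -> ~~ (H \subset 'C(N)) -> 'C_N(H) = 1.
Proof. by move=> prN nCH; rewrite prime_TIg // centsC. Qed.

Lemma center_sdprod (gT : finGroupType) (N H G : {group gT}) :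
  N ><| H = G -> abelian H -> 'C_N(H) = 1 -> 'Z(G) = 'C_H(N).
Proof.
move=> defG abH cNH; have [nsNG sHG defNH nNH tiNH] := sdprod_context defG.
apply/eqP; rewrite eqEsubset; apply/andP; split; last first.
  rewrite subsetI subIset ?sHG //= -defNH centM subsetI subsetIr.
  by rewrite (subset_trans (subsetIl _ _)) ?abH.
apply/subsetP=> z /setIP[]; rewrite -{1}defNH => /mulsgP[n h Nn Hh ->] cGz.
have n1 : n = 1.
  apply/set1P; rewrite -set1gE -cNH inE Nn; apply/centP=> k Hk.
  have Gk := subsetP sHG _ Hk; apply: commute_sym.
  rewrite -(mulgK h n); apply: commuteM; first exact/commute_sym/(centP cGz).
  exact/commuteV/(centsP abH).
rewrite n1 mul1g in cGz *; rewrite inE Hh.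
by rewrite (subsetP (centS (normal_sub nsNG))).
Qed.

Lemma coprime_abel_dprod (gT : finGroupType) (N H : {group gT}) :
  H \subset 'N(N) -> coprime #|N| #|H| -> abelian N ->
  [~: N, H] \x 'C_N(H) = N.
Proof.
move=> nNH coNH abN; have sRN : [~: N, H] \subset N by rewrite commg_subl.
have nRH : H \subset 'N([~: N, H]) by rewrite commg_normr.
have nRN : N \subset 'N([~: N, H]) by rewrite commg_norml.
rewrite dprodE.
- apply/eqP; rewrite eqEsubset mul_subG ?subsetIl //=.
  rewrite -quotientSK // coprime_norm_quotient_cent //.
  + by rewrite subsetI subxx quotient_cents2r.
  + by rewrite (coprimeSg sRN).
  by rewrite (solvableS sRN) ?abelian_sol.
- by rewrite (subset_trans (subsetIl _ _)) // (subset_trans abN) ?centS.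
by rewrite setIA (setIidPl sRN) coprime_abel_cent_TI.
Qed.

(** [N] is the direct product of [[~: N, H]] and ['C_N(H)]; in a cyclic p-group
one of two independent subgroups is trivial. *)
Lemma coprime_cyclic_cent_TI (gT : finGroupType) (p : nat) (N H : {group gT}) :
  p.-group N -> cyclic N -> H \subset 'N(N) -> coprime #|N| #|H| ->
  ~~ (H \subset 'C(N)) -> 'C_N(H) = 1.
Proof.
move=> pN cycN nNH coNH ncHN.
have abN := cyclic_abelian cycN.
have defN := coprime_abel_dprod nNH coNH abN.
have cycS (K : {group gT}) : K \subset N -> cyclic K by move/cyclicS; apply.
have sRN : [~: N, H] \subset N by rewrite commg_subl.
have := cyclic_dprod defN (cycS _ sRN) (cycS _ (subsetIl N _)).
rewrite cycN => /esym coRC; have [// | ntC] := eqVneq 'C_N(H) 1.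
have [/commG1P cNH | ntR] := eqVneq [~: N, H] 1; first by rewrite centsC cNH in ncHN.
have [[p_pr pdvR _] pC] := (pgroup_pdiv (pgroupS sRN pN) ntR, pgroupS (subsetIl N 'C(H)) pN).
have [_ pdvC _] := pgroup_pdiv pC ntC.
have := dvdn_gcd p #|[~: N, H]| #|'C_N(H)|.
by rewrite pdvR pdvC (eqP coRC) dvdn1 => /eqP p1; rewrite p1 in p_pr.
Qed.

(** The cyclic group [Aut N'] has a single subgroup of each order, so [H] and
[H'] have the same image there. *)
Lemma cyclic_Aut_transport (gT rT : finGroupType) (N H : {group gT})
    (N' H' : {group rT}) (f : {morphism N >-> rT}) :
    isom N N' f -> cyclic (Aut N') -> H \subset 'N(N) -> H' \subset 'N(N') ->
    #|conj_aut N @* H| = #|conj_aut N' @* H'| ->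
  forall h, h \in H ->
  exists2 h', h' \in H' & {in N, forall n, f (n ^ h) = f n ^ h'}.
Proof.
move=> /isomP[injf imf] cycA nNH nNH' eqc h Hh.
have eqX : Aut_isom injf (subxx N) @* (conj_aut N @* H) = conj_aut N' @* H'.
  apply/eqP; rewrite (eq_subG_cyclic cycA) ?Aut_conj_aut //.
    by rewrite card_injm ?injm_Aut_isom ?Aut_conj_aut // eqc.
  apply: subset_trans (morphimS _ (Aut_conj_aut N H)) _.
  by rewrite im_Aut_isom imf.
have Ah : conj_aut N h \in Aut N by apply: Aut_aut.
have : Aut_isom injf (subxx N) (conj_aut N h) \in conj_aut N' @* H'.
  by rewrite -eqX !mem_morphim // (subsetP nNH).
case/morphimP=> h' nNh' Hh' eqh; exists h' => // n Nn.
have Nfn : f n \in N' by rewrite -imf mem_morphim.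
rewrite -(norm_conj_autE nNh') // -eqh Aut_isomE //.
by rewrite norm_conj_autE // (subsetP nNH).
Qed.

Lemma cyclic_faithful_isog (gT rT : finGroupType) (N H G : {group gT})
    (N' H' G' : {group rT}) :
    N ><| H = G -> N' ><| H' = G' -> N \isog N' -> cyclic (Aut N') ->
    'C_H(N) = 1 -> 'C_H'(N') = 1 -> #|H| = #|H'| ->
  G \isog G'.
Proof.
move=> defG defG' /isog_isom[f isof] cycA ffH ffH' oHH'.
have [_ _ _ nNH _] := sdprod_context defG.
have [_ _ _ nNH' _] := sdprod_context defG'.
apply: (faithful_sdprod_isog defG defG' isof); rewrite ?oHH' //.
by apply: (cyclic_Aut_transport isof); rewrite ?card_conj_aut.
Qed.

(** Both images in the automorphism groups have order [p]. A generator [y] of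
[H] acts as some [z] in [H'], and [z] generates [H'], since otherwise [z], and
with it [y], would act trivially. *)
Lemma cyclic_unfaithful_isog (gT rT : finGroupType) (p : nat) (N H G : {group gT})
    (N' H' G' : {group rT}) :
    prime p -> N ><| H = G -> N' ><| H' = G' -> N \isog N' -> cyclic (Aut N') ->
    cyclic H -> cyclic H' -> #|H| = (p ^ 2)%N -> #|H'| = (p ^ 2)%N ->
    #|'C_H(N)| = p -> #|'C_H'(N')| = p ->
  G \isog G'.
Proof.
move=> p_pr defG defG' /isog_isom[f isof] cycA cycH cycH' oH oH' oC oC'.
have [injf imf] := isomP isof.
have [_ _ _ nNH _] := sdprod_context defG.
have [_ _ _ nNH' _] := sdprod_context defG'.
have p_gt1 := prime_gt1 p_pr.
have oX (aT : finGroupType) (M K : {group aT}) : K \subset 'N(M) ->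
    #|K| = (p ^ 2)%N -> #|'C_K(M)| = p -> #|conj_aut M @* K| = p.
  move=> nMK oK oCK; rewrite card_morphim ker_conj_aut (setIidPr nMK).
  by rewrite -divgI oK oCK mulnK // prime_gt0.
have [y defH] := cyclicP cycH; have Hy : y \in H by rewrite defH cycle_id.
have eqc : #|conj_aut N @* H| = #|conj_aut N' @* H'| by rewrite !oX.
have [z Hz actyz] := cyclic_Aut_transport isof cycA nNH nNH' eqc Hy.
have oy : #[y] = (p ^ 2)%N by rewrite orderE -defH.
have oz : #[z] = (p ^ 2)%N.
  have /(dvdn_pfactor _ _ p_pr)[i le_i2 oz] : #[z] %| p ^ 2.
    by rewrite -oH' order_dvdG.
  have [le_i1|gt_i1] := leqP i 1; last first.
    by rewrite oz; congr (_ ^ _)%N; apply/eqP; rewrite eqn_leq le_i2.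
  have sCH' : 'C_H'(N') \subset H' by apply: subsetIl.
  have szC : <[z]> \subset 'C_H'(N').
    rewrite -(cardSg_cyclic cycH') ?cycle_subG // oC' -orderE oz.
    by rewrite -{2}(expn1 p) dvdn_exp2l.
  have cNy : y \in 'C(N).
    apply/centP=> n Nn; apply/commute_sym/commgP/conjg_fixP.
    apply: (injmP injf); rewrite ?memJ_norm ?(subsetP nNH) // actyz //.
    apply/conjg_fixP/commgP/commute_sym.
    have /setIP[_ /centP] : z \in 'C_H'(N') by rewrite (subsetP szC) ?cycle_id.
    by apply; rewrite -imf mem_morphim.
  move: oC; rewrite (setIidPl _) ?defH ?cycle_subG // -defH oH => /eqP.
  by rewrite -{2}(expn1 p) eqn_exp2l.
have defz : H' = <[z]> :> {set rT}.
  by apply/esym/eqP; rewrite eqEcard cycle_subG Hz -orderE oz oH' leqnn.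
have dv_zy : #[z] %| #[y] by rewrite oz oy.
have sHy : H \subset <[y]> by rewrite defH.
have injg : 'injm (restrm sHy (eltm dv_zy)).
  by rewrite injm_restrm // injm_eltm oz oy.
have isog_g : isom H H' (restrm sHy (eltm dv_zy)).
  apply/isomP; split=> //; rewrite morphim_restrm setIid defH defz.
  by rewrite im_eltm.
have [|F [/isom_isog-> //]] := sdprod_extend_isom defG defG' isof isog_g.
move=> n h Nn; rewrite {1}defH => /cycleP[k ->] /=.
rewrite /restrm eltmE; elim: k => [|k IHk]; first by rewrite !conjg1.
by rewrite !expgSr !conjgM actyz ?IHk // memJ_norm // groupX ?(subsetP nNH).
Qed.

(** The group is found inside the holomorph of [N]. *)
Lemma cyclic_sdprod_exists (gT : finGroupType) (N : {group gT}) d :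
    cyclic (Aut N) -> d %| #|Aut N| ->
  exists (rT : finGroupType) (N' H' : {group rT}),
    [/\ N' ><| H' = N' <*> H', N' \isog N, cyclic H', #|H'| = d & 'C_H'(N') = 1].
Proof.
move=> cycA d_dv; have [a Aa oa] := cyclic_has_order cycA d_dv.
pose H' := (sdpair2 [Aut N]%gact @* <[a]>)%G.
have sH : H' \subset HolA N by rewrite morphimS ?cycle_subG.
exists _, (HolN N), H'; split.
- exact: sdprod_sub (Hol_sdprod N) sH.
- by rewrite isog_sym; apply: isom_isog (isom_HolN N).
- by rewrite morphim_cyclic ?cycle_cyclic.
- by rewrite card_injm ?injm_sdpair2 ?cycle_subG // -orderE.
by apply/trivgP; rewrite -(Hol_faithful N) setSI.
Qed.

(** Pulling the action of [H] back along the surjection C_(p^2) -> C_p: the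
complement is generated by the pair of a generator of [H] and a generator of
C_(p^2), in the direct product of the ambient group with C_(p^2). *)
Lemma fibre_sdprod_exists (p : nat) (gT : finGroupType) (N H B : {group gT}) :
    prime p -> N ><| H = B -> #|H| = p -> 'C_H(N) = 1 -> 'C_N(H) = 1 ->
  exists (rT : finGroupType) (N1 H1 : {group rT}),
    [/\ N1 ><| H1 = N1 <*> H1, N1 \isog N, cyclic H1, #|H1| = (p ^ 2)%N
      & #|'Z(N1 <*> H1)| = p].
Proof.
move=> p_pr defB oH ffH cNH; have [_ _ _ nNH _] := sdprod_context defB.
have cycH : cyclic H by rewrite prime_cyclic // oH.
have [h defH] := cyclicP cycH; have Hh : h \in H by rewrite defH cycle_id.
have oh : #[h] = p by rewrite orderE -defH.
have p2_gt0 : 0 < p ^ 2 by rewrite expn_gt0 prime_gt0.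
have [zT [z oz]] : exists (zT : finGroupType) (z : zT), #[z] = (p ^ 2)%N.
  have [z defZ] := cyclicP (Zp_cyclic (p ^ 2)).
  by exists _, z; rewrite orderE -defZ card_Zp.
pose x := (h, z); pose N1 := setX_group N [1 zT]%G.
have xE k : x ^+ k = (h ^+ k, z ^+ k).
  by elim: k => // k IHk; rewrite !expgS IHk.
have ox : #[x] = (p ^ 2)%N.
  apply/eqP; rewrite eqn_dvd order_dvdn xE; apply/andP; split.
    by rewrite -oz expg_order oz expnS expgM -oh expg_order expg1n.
  by have := congr1 snd (expg_order x); rewrite xE -oz order_dvdn /= => ->.
have N1E u : u \in N1 = (u.1 \in N) && (u.2 == 1) by rewrite !inE.
have actx n : (n, 1) ^ x = (n ^ h, 1).
  by rewrite /conjg /x; congr (_, _); rewrite /= mul1g mulVg.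
have nN1 : <[x]> \subset 'N(N1).
  rewrite cycle_subG inE; apply/subsetP=> _ /imsetP[[n m] /setXP[/= Nn /set1P->] ->].
  by rewrite actx inE /= memJ_norm ?(subsetP nNH) // Nn set11.
have tiN : N1 :&: <[x]> = 1.
  apply/trivgP/subsetP=> u /setIP[N1u /cycleP[k def_u]].
  move: N1u; rewrite def_u N1E inE -order_dvdn ox -oz order_dvdn xE.
  by case/andP.
have defG : N1 ><| <[x]> = N1 <*> <[x]> by rewrite sdprodEY.
exists _, N1, <[x]>%G; split; rewrite ?cycle_cyclic -?orderE //.
  by rewrite isog_sym isog_setX1.
rewrite (center_sdprod defG) ?cycle_abelian //.
  suffices -> : 'C_<[x]>(N1) = <[x ^+ p]>.
    by rewrite -orderE orderXdiv ox ?dvdn_exp // mulnK // prime_gt0.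
  apply/eqP; rewrite eqEsubset; apply/andP; split; last first.
    rewrite cycle_subG inE mem_cycle; apply/centP=> u; rewrite N1E.
    case/andP=> Nu /eqP u2; rewrite xE -oh expg_order.
    by case: u Nu u2 => u1 u2 /= _ ->; rewrite /commute; congr (_, _); rewrite /= ?mulg1 ?mul1g.
  apply/subsetP=> _ /setIP[/cycleP[k ->] /centP cNx].
  have /eqP : h ^+ k = 1.
    apply/set1P; rewrite -set1gE -ffH inE groupX //=; apply/centP=> n Nn.
    have /cNx : (n, 1) \in N1 by rewrite N1E /= Nn eqxx.
    by rewrite xE => /(congr1 fst).
  by rewrite -order_dvdn oh => /dvdnP[j ->]; rewrite mulnC expgM mem_cycle.
apply/trivgP/subsetP=> [[n m]] /setIP[/setXP[/= Nn /set1P->] /centP cx].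
have := cx x (cycle_id x) => /(congr1 fst) /= cnh.
suffices -> : n = 1 by rewrite inE.
apply/set1P; rewrite -set1gE -cNH inE Nn defH cent_cycle; apply/cent1P.
exact: esym.
Qed.

(** * Automorphisms of the acting group that preserve the action *)

Section PreservingAction.

Variables (gT : finGroupType) (N P : {group gT}).

Definition act_Aut := [set c in Aut P |
  [forall n in N, forall x in P, n ^ c x == n ^ x]].

Lemma act_AutP (c : {perm gT}) :
  c \in act_Aut <-> c \in Aut P /\ {in N & P, forall n x, n ^ c x = n ^ x}.
Proof.
rewrite inE; split=> [/andP[-> /forall_inP act] | [-> act]].
  by split=> // n x Nn Px; apply/eqP; move/forall_inP: (act n Nn); apply.
by apply/forall_inP=> n Nn; apply/forall_inP=> x Px; apply/eqP/act.
Qed.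

Lemma group_set_act_Aut : group_set act_Aut.
Proof.
apply/group_setP; split=> [|a b /act_AutP[Aa acta] /act_AutP[Ab actb]].
  by apply/act_AutP; split=> // n x _ _; rewrite perm1.
apply/act_AutP; split=> [|n x Nn Px]; first exact: groupM.
by rewrite permM actb ?acta ?Aut_closed.
Qed.
Canonical act_Aut_group := Group group_set_act_Aut.

(** Both [c x] and [x] act in the same way on [N]. *)
Lemma act_Aut_cent c x : P \subset 'N(N) -> c \in act_Aut -> x \in P ->
  c x * x^-1 \in 'C_P(N).
Proof.
move=> nNP /act_AutP[Ac actc] Px.
rewrite inE groupM ?groupV ?Aut_closed //=; apply/centP=> n Nn.
apply/commute_sym/commgP/conjg_fixP.
by rewrite conjgM actc // conjgK.
Qed.

End PreservingAction.

(** Such an automorphism multiplies a generator of [P] by an element of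
['C_P(N)], which leaves at most [p] of them. Conversely an automorphism of
order [p] has the form x |-> x^m with m^p = 1 mod p^2, so m = 1 mod p by
Fermat, and it multiplies each element by one of ['C_P(N)]. *)
Lemma act_Aut_cyclic (p : nat) (gT : finGroupType) (N P : {group gT}) :
    prime p -> P \subset 'N(N) -> cyclic P -> #|P| = (p ^ 2)%N ->
    #|'C_P(N)| = p ->
  act_Aut N P \isog Zp p.
Proof.
move=> p_pr nNP cycP oP oC; rewrite isog_Zp_prime //.
have p_gt0 := prime_gt0 p_pr.
have [y defP] := cyclicP cycP; have Py : y \in P by rewrite defP cycle_id.
have gen_eq a b : a \in Aut P -> b \in Aut P -> a y = b y -> a = b.
  move=> Aa Ab eqy; apply: (eq_Aut Aa Ab) => _ /[1!defP] /cycleP[k ->].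
  have -> : a (y ^+ k) = a y ^+ k := morphX (autm Aa) k Py.
  have -> : b (y ^+ k) = b y ^+ k := morphX (autm Ab) k Py.
  by rewrite eqy.
rewrite eqn_leq; apply/andP; split.
  rewrite -oC -(card_in_imset (f := fun c : {perm gT} => c y * y^-1) (D := act_Aut N P)).
    apply/subset_leq_card/subsetP=> _ /imsetP[c Lc ->].
    exact: act_Aut_cent.
  move=> a b /act_AutP[Aa _] /act_AutP[Ab _] /mulIg; exact: gen_eq.
have pA : p %| #|Aut P|.
  by rewrite card_Aut_cyclic // oP totient_pfactor // dvdn_mull.
have [c Ac oc] := Cauchy p_pr pA.
suffices Lc : c \in act_Aut N P.
  by rewrite -oc subset_leq_card // cycle_subG.
apply/act_AutP; split=> // n x Nn; rewrite {1}defP => /cycleP[k ->].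
have Py' : c y \in P by rewrite Aut_closed.
have [m cy] : exists m, c y = y ^+ m by move: Py'; rewrite defP => /cycleP.
have -> : c (y ^+ k) = c y ^+ k := morphX (autm Ac) k Py.
have oy : #[y] = (p ^ 2)%N by rewrite orderE -defP.
have Cyp : y ^+ p \in 'C_P(N).
  have sC : 'C_P(N) \subset P by apply: subsetIl.
  rewrite -cycle_subG -(cardSg_cyclic cycP) ?cycle_subG ?groupX // oC.
  by rewrite -orderE orderXdiv oy ?dvdn_exp // mulnK.
have /= cX i : (c ^+ i) y = y ^+ (m ^ i).
  elim: i => [|i IHi]; first by rewrite perm1.
  rewrite expgSr permM IHi expnSr expgM.
  have -> : c (y ^+ (m ^ i)) = c y ^+ (m ^ i) := morphX (autm Ac) _ Py.
  by rewrite cy -!expgM mulnC.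
(* m^p = 1 mod p^2 and m^p = m mod p. *)
have mp : m = 1 %[mod p].
  have : y ^+ (m ^ p) == y ^+ 1 by rewrite -cX -oc expg_order perm1.
  rewrite eq_expg_mod_order oy -(fermat_little m p_pr) => /eqP eqm.
  rewrite -(modn_dvdm (m ^ p) (dvdn_exp (ltn0Sn 1) (dvdnn p))) eqm.
  by rewrite modn_dvdm ?dvdn_exp.
have [j def_m] : exists j, m = (1 + p * j)%N.
  exists (m %/ p); rewrite {1}(divn_eq m p) mp modn_small ?prime_gt1 //.
  by rewrite addnC mulnC.
rewrite cy def_m expgD expgM expg1 expgMn; last first.
  exact: commuteX (commuteX _ (commute_refl _)).
have Nnk : n ^ (y ^+ k) \in N by rewrite memJ_norm // (subsetP nNP) ?groupX.
rewrite conjgM; apply/conjg_fixP/commgP/commute_sym.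
have /setIP[_ /centP] : ((y ^+ p) ^+ j) ^+ k \in 'C_P(N).
  by do 2!apply: groupX.
by apply.
Qed.

(** With [y] a generator of [H], these automorphisms [c] are given by an
arbitrary automorphism of [A] and by the value [c y = u * y] for an arbitrary
[u] in [A] (this is [ext]). They form the affine group of the line [A]: [T]
below collects the translations, [D] the automorphisms that fix [y]. *)
Lemma act_Aut_dprod (p : nat) (gT : finGroupType) (N P A H : {group gT}) :
    prime p -> P \subset 'N(N) -> A \x H = P -> #|A| = p -> #|H| = p ->
    'C_P(N) = A ->
  act_Aut N P \isog Hol (Zp_group p).
Proof.
move=> p_pr nNP defP oA oH defC; set L := act_Aut_group N P.
have [_ defAH cAH tiAH] := dprodP defP.
have defPsd := dprodWsd defP.
have [/andP[sAP _] sHP _ nAH _] := sdprod_context defPsd.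
have [y defH] := cyclicP (prime_cyclic (etrans (congr1 prime oH) p_pr : prime #|H|)).
have Hy : y \in H by rewrite defH cycle_id.
have Py := subsetP sHP _ Hy.
have LP c : c \in L <-> c \in Aut P /\ {in P, forall x, c x * x^-1 \in A}.
  rewrite -defC; split=> [Lc | [Ac Cc]].
    by have [Ac _] := (act_AutP _ _ _).1 Lc; split=> // x; apply: act_Aut_cent.
  apply/act_AutP; split=> // n x Nn Px.
  have /setIP[_ /centP cn] := Cc x Px.
  by apply: (conjg_inj x^-1); rewrite -!conjgM mulgV conjg1; apply/conjg_fixP/commgP/commute_sym/cn.
have abP : abelian P.
  have cyA : cyclic A by rewrite prime_cyclic ?oA.
  by rewrite -defAH abelianM !cyclic_abelian ?defH ?cycle_cyclic // -defH cAH.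
have ext a u : a \in Aut A -> u \in A ->
    exists c, [/\ c \in L, {in A, c =1 a} & c y = u * y].
  move=> Aa Au; have Pu := subsetP sAP _ Au.
  have cuy : commute u y by apply: (centsP abP).
  have oy : #[y] = p by rewrite orderE -defH.
  have nAuy : u * y \notin A.
    rewrite groupMl //; apply/negP=> Ay; have := order1 gT.
    have /set1P y1 : y \in [1 gT] by rewrite -tiAH inE Ay.
    by move: p_pr; rewrite -oy y1 order1.
  have ouy : #[u * y] = p.
    apply/nt_prime_order => //; last by apply: contraNneq nAuy => ->.
    rewrite expgMn // -{2}oy expg_order mulg1; apply/eqP.
    by rewrite -order_dvdn -oA order_dvdG.
  have tiAuy : A :&: <[u * y]> = 1.
    by rewrite setIC prime_TIg -?orderE ?ouy // cycle_subG.
  have defP' : A ><| <[u * y]> = P.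
    have suP : <[u * y]> \subset P by rewrite cycle_subG groupM.
    rewrite sdprodE //; last by rewrite cents_norm // (subset_trans suP) // (subset_trans abP) ?centS.
    apply/eqP; rewrite eqEcard mul_subG //= TI_cardMg // -orderE ouy.
    by rewrite -(sdprod_card defPsd) oA oH.
  have isoa : isom A A (autm Aa) by apply/isomP; rewrite injm_autm im_autm.
  have dvuy : #[u * y] %| #[y] by rewrite ouy oy.
  have sHy : H \subset <[y]> by rewrite defH.
  have isog_g : isom H <[u * y]> (restrm sHy (eltm dvuy)).
    apply/isomP; rewrite injm_restrm ?injm_eltm ?ouy ?oy //.
    by rewrite morphim_restrm setIid defH im_eltm.
  have fixPP g k : g \in P -> k \in P -> g ^ k = g.
    by move=> Pg Pk; apply/conjg_fixP/commgP/(centsP abP).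
  have [|F [/isomP[injF imF] FA FH]] :=
      sdprod_extend_isom defPsd defP' isoa isog_g.
    move=> g k Ag Hk; rewrite /= !fixPP ?(subsetP sAP _ Ag) ?(subsetP sHP _ Hk) //.
      by rewrite (subsetP sAP) ?Aut_closed.
    by move: Hk; rewrite {1}defH => /cycleP[i ->]; rewrite /restrm eltmE groupX ?groupM.
  have Fy : F y = u * y by rewrite FH // [LHS]eltm_id.
  exists (aut injF imF); split=> [|g Ag|]; last by rewrite autE.
    apply/LP; split=> [|x Px]; first exact: Aut_aut.
    rewrite autE //; move: (Px); rewrite -{1}defAH defH => /mulsgP[g _ Ag /cycleP[k ->] ->].
    have Pg := subsetP sAP _ Ag.
    rewrite morphM ?groupX // morphX // FA // Fy expgMn // invMg /=.
    by rewrite !mulgA mulgK !groupM ?groupV ?groupX ?Aut_closed.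
  by rewrite autE ?FA // (subsetP sAP).
have Leq a b : a \in L -> b \in L -> {in A, a =1 b} -> a y = b y -> a = b.
  move=> /LP[Aa _] /LP[Ab _] eqA eqy; apply: (eq_Aut Aa Ab) => x.
  rewrite -{1}defAH defH => /mulsgP[g _ Ag /cycleP[k ->] ->].
  have Pg := subsetP sAP _ Ag; have Pyk : y ^+ k \in P by rewrite groupX.
  have -> : a (g * y ^+ k) = a g * a (y ^+ k) := morphM (autm Aa) Pg Pyk.
  have -> : b (g * y ^+ k) = b g * b (y ^+ k) := morphM (autm Ab) Pg Pyk.
  have -> : a (y ^+ k) = a y ^+ k := morphX (autm Aa) k Py.
  have -> : b (y ^+ k) = b y ^+ k := morphX (autm Ab) k Py.
  by rewrite eqA ?eqy.
have AutL c : c \in L -> c \in Aut P by case/LP.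
have LA c g : c \in L -> g \in A -> c g \in A.
  move=> /LP[Ac Cc] Ag; have := Cc g (subsetP sAP _ Ag).
  by rewrite groupMr ?groupV.
pose D := 'C_L([set y] | 'P)%G; pose T := 'C_L(A | 'P)%G.
have DP c : c \in D <-> c \in L /\ c y = y.
  rewrite [c \in D]inE; split=> [/andP[Lc /astab1P] | [-> cy]] //=.
  exact/astab1P.
have TP c : c \in T <-> c \in L /\ {in A, forall a, c a = a}.
  rewrite [c \in T]inE; split=> [/andP[Lc /astabP] | [-> cA]] //=.
  exact/astabP.
have AutA c : c \in L -> restr_perm A c \in Aut A /\ {in A, restr_perm A c =1 c}.
  move=> Lc; have nAc : c \in 'N(A | 'P).
    rewrite !inE /=; apply/subsetP=> g Ag; rewrite inE; exact: LA.
  split; first exact: Aut_restr_perm (AutL _ Lc).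
  by move=> g Ag; rewrite restr_permE.
have defL : T ><| D = L.
  have sTL : T \subset L by apply: subsetIl.
  have sDL : D \subset L by apply: subsetIl.
  have tiTD : T :&: D = 1.
    apply/trivgP/subsetP=> c /setIP[/TP[Lc cA] /DP[_ cy]]; rewrite inE; apply/eqP.
    by apply: Leq => // [g Ag|]; rewrite perm1 //; apply: cA.
  have nTD : D \subset 'N(T).
    apply/subsetP=> d /DP[Ld _]; rewrite inE; apply/subsetP=> _ /imsetP[c /TP[Lc cA] ->].
    apply/TP; split=> [|g Ag]; first exact: groupJ.
    have Adg : d^-1 g \in A by rewrite LA ?groupV.
    by rewrite conjgE !permM cA // permKV.
  rewrite sdprodE //; apply/eqP; rewrite eqEsubset mul_subG //=.
  apply/subsetP=> c Lc; have [Ar rE] := AutA c Lc.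
  have [d [Ld dA]] := ext _ 1 Ar (group1 A); rewrite mul1g => dy.
  have Dd : d \in D by apply/DP.
  have -> : c = (c * d^-1) * d by rewrite mulgKV.
  rewrite mem_mulg //; apply/TP; split=> [|g Ag]; first by rewrite groupM ?groupV.
  by rewrite permM -rE // -dA // permK.
have Tcard : #|T| = p.
  rewrite -oA -(card_in_imset (f := fun c : {perm gT} => c y * y^-1) (D := T)).
    congr #|pred_of_set _|; apply/setP=> g; apply/imsetP/idP=> [[c /TP[/LP[Ac Cc] _] ->] | Ag].
      exact: Cc.
    have [c [Lc cA cy]] := ext _ _ (group1 _) Ag.
    exists c; last by rewrite cy mulgK.
    by apply/TP; split=> // b Ab; rewrite cA ?perm1.
  move=> a b /TP[La aA] /TP[Lb bA] /mulIg; apply: Leq => // g Ag.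
  by rewrite aA ?bA.
apply: (isog_Hol defL).
- apply/trivgP/subsetP=> d /setIP[/DP[Ld dy] /centP cdT]; rewrite inE; apply/eqP.
  apply: Leq => // [g Ag|]; rewrite perm1 //.
  have [c [Lc cA cy]] := ext _ _ (group1 _) Ag.
  have Tc : c \in T by apply/TP; split=> // b Ab; rewrite cA ?perm1.
  have /permP/(_ y) := cdT c Tc; rewrite !permM dy cy.
  have -> : d (g * y) = d g * d y := morphM (autm (AutL _ Ld)) (subsetP sAP _ Ag) Py.
  by rewrite dy => /mulIg <-.
- by rewrite -[_ \isog _]/(T \isog Zp p) isog_Zp_prime ?Tcard.
have isoA : A \isog Zp_group p by rewrite -[_ \isog _]/(A \isog Zp p) isog_Zp_prime ?oA.
rewrite -(card_isog (isog_Aut isoA)).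
apply: leq_trans (leq_morphim (restr_perm_morphism A) D).
suffices -> : restr_perm A @* D = Aut A by [].
apply/eqP; rewrite eqEsubset; apply/andP; split.
  apply/subsetP=> _ /morphimP[c _ /DP[Lc _] ->].
  by case: (AutA c Lc).
apply/subsetP=> a Aa; have [d [Ld dA]] := ext _ 1 Aa (group1 A); rewrite mul1g => dy.
have [Ar rE] := AutA d Ld; apply/morphimP; exists d.
- rewrite !inE /=; apply/subsetP=> g Ag; rewrite inE; exact: LA.
- exact/DP.
by apply: (eq_Aut Aa Ar) => g Ag; rewrite rE ?dA.
Qed.

(** * Matrices of size two *)

Local Open Scope ring_scope.

Section Matrix2.

Variable F : fieldType.
Implicit Types (M g h : 'M[F]_2) (a b : F).

Lemma ord2P (P : 'I_2 -> Prop) : P 0 -> P 1 -> forall i, P i.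
Proof.
by move=> P0 P1 [[|[|i]] lti] //; [move: P0 | move: P1]; congr P; apply: val_inj.
Qed.

Lemma sum2E (V : zmodType) (f : 'I_2 -> V) : \sum_(i < 2) f i = f 0 + f 1.
Proof.
rewrite !big_ord_recl big_ord0 addr0; congr (f _ + f _); exact: val_inj.
Qed.

Lemma mulmx2E m n (A : 'M[F]_(m, 2)) (B : 'M[F]_(2, n)) i j :
  (A *m B) i j = A i 0 * B 0 j + A i 1 * B 1 j.
Proof. by rewrite mxE sum2E. Qed.

Lemma mx2P M g : M 0 0 = g 0 0 -> M 0 1 = g 0 1 -> M 1 0 = g 1 0 ->
  M 1 1 = g 1 1 -> M = g.
Proof.
by move=> e00 e01 e10 e11; apply/matrixP; do 2!elim/ord2P.
Qed.

Lemma row2P (u v : 'rV[F]_2) : u 0 0 = v 0 0 -> u 0 1 = v 0 1 -> u = v.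
Proof. by move=> e0 e1; apply/rowP; elim/ord2P. Qed.

Definition mx2 a b c d : 'M[F]_2 :=
  \matrix_(i, j) if i == 0 then if j == 0 then a else b
                 else if j == 0 then c else d.

Lemma mx2E a b c d : ((mx2 a b c d 0 0 = a) * (mx2 a b c d 0 1 = b) *
  (mx2 a b c d 1 0 = c) * (mx2 a b c d 1 1 = d))%type.
Proof. by rewrite !mxE. Qed.

Lemma det2E M : \det M = M 0 0 * M 1 1 - M 0 1 * M 1 0.
Proof.
rewrite (expand_det_row _ 0) sum2E /cofactor !det_mx11 !mxE /= expr0 expr1.
rewrite mul1r mulN1r mulrN; congr (_ * M _ _ - _ * M _ _); exact: val_inj.
Qed.

Lemma tr2E M : \tr M = M 0 0 + M 1 1.
Proof. by rewrite /mxtrace sum2E. Qed.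

Lemma Cayley2 M : M *m M = \tr M *: M - (\det M)%:M.
Proof.
rewrite tr2E det2E; apply: mx2P; rewrite mulmx2E !mxE /=; ring.
Qed.

Definition noeig M := forall a, ~~ eigenvalue M a.

Lemma eigenvalue_det M a : eigenvalue M a = (\det (M - a%:M) == 0).
Proof.
apply/eigenvalueP/det0P => [[v vM nzv] | [v nzv vM]]; exists v => //.
  by rewrite mulmxBr vM mul_mx_scalar subrr.
by apply/eqP; rewrite -subr_eq0 -mul_mx_scalar -mulmxBr vM.
Qed.

(** The algebra generated by a matrix without eigenvalues is a field. *)
Lemma noeig_unit M a b :
  noeig M -> (a, b) != (0, 0) -> a%:M + b *: M \in unitmx.
Proof.
move=> nM; have [->|nzb] := eqVneq b 0 => nzab.
  rewrite scale0r addr0 unitmxE det_scalar unitrX // unitfE.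
  by apply: contraNneq nzab => ->.
have -> : a%:M + b *: M = b *: (M - (- (a / b))%:M).
  rewrite scalerBr scale_scalar_mx mulrN mulrCA divff // mulr1.
  by rewrite [(- a)%:M]raddfN /= opprK addrC.
rewrite unitmxE detZ unitrM unitrX ?unitfE //=.
by rewrite -eigenvalue_det nM.
Qed.

Lemma noeig_nz01 M : noeig M -> M 0 1 != 0.
Proof.
move=> nM; apply: contraNneq (nM (M 0 0)) => M01; rewrite eigenvalue_det det2E.
by rewrite !mxE /= mulr1n mulr0n subrr subr0 M01 !mul0r subrr.
Qed.

Lemma noeig_commutant M g : noeig M -> M *m g = g *m M ->
  exists a b, g = a%:M + b *: M.
Proof.
move=> nM cMg; have nz01 := noeig_nz01 nM.
exists (g 0 0 - g 0 1 / M 0 1 * M 0 0), (g 0 1 / M 0 1).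
have e00 := congr1 (fun A : 'M_2 => A 0 0) cMg.
have e01 := congr1 (fun A : 'M_2 => A 0 1) cMg.
rewrite /= !mulmx2E in e00 e01.
apply: mx2P; rewrite !mxE /=.
- by rewrite mulr1n subrK.
- by rewrite mulr0n add0r divfK.
- rewrite mulr0n add0r; apply: (mulfI nz01).
  rewrite mulrA mulrCA divff // mulr1; apply: (addrI (M 0 0 * g 0 0)).
  by rewrite e00 mulrC.
rewrite mulr1n; apply: (mulfI nz01); apply: (addrI (M 0 0 * g 0 1)).
by rewrite e01; field.
Qed.

Lemma noeig_inj M a b a' b' : noeig M ->
  a%:M + b *: M = a'%:M + b' *: M -> (a, b) = (a', b').
Proof.
move=> nM eqM; apply/eqP; rewrite -subr_eq0; apply: contraT => nz.
have /(noeig_unit nM) := nz : (a - a', b - b') != (0, 0).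
rewrite raddfB /= scalerBl addrACA -opprD eqM subrr => u0.
by rewrite unitmxE det0 unitr0 in u0.
Qed.

(** An eigenvalue is an n-th root of unity, hence 1, and so is the determinant.
Both eigenvalues are then 1, so that M^k = 1 + k (M - 1); as n is invertible in
the field, M^n = 1 gives M = 1. *)
Lemma noeig_order M n : n%:R != 0 :> F -> M ^+ n = 1 -> M != 1 ->
  (forall a : F, a ^+ n = 1 -> a = 1) -> \det M = 1 /\ noeig M.
Proof.
move=> nzn Mn M1 cop.
have n_gt0 : (0 < n)%N by case: (n) nzn => //; rewrite eqxx.
have detM : \det M = 1.
  apply: cop; have := congr1 determinant Mn; rewrite det1 => <-.
  by elim: (n) => [|k IHk]; rewrite ?det1 // !exprS IHk det_mulmx.
split=> // a; apply/negP=> eva; have [v vM nzv] := eigenvalueP eva.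
have a1 : a = 1.
  apply: cop; have vMk k : v *m M ^+ k = a ^+ k *: v.
    elim: k => [|k IHk]; first by rewrite mulmx1 scale1r.
    by rewrite exprS mulmxA vM -scalemxAl IHk scalerA -exprS.
  have := vMk n; rewrite Mn mulmx1 => /esym/eqP.
  rewrite -subr_eq0 -{2}[v]scale1r -scalerBl scaler_eq0 (negPf nzv) orbF subr_eq0.
  by move/eqP.
have := eigenvalue_det M a; rewrite eva a1 => /esym/eqP detM1.
have trM : \tr M = 1 + 1.
  move: detM1 detM; rewrite !det2E tr2E !mxE /= !mulr1n !mulr0n !subr0 => e1 e2.
  apply/eqP; rewrite -subr_eq0 -oppr_eq0 opprB -e1 -{1}e2; apply/eqP; ring.
have M2 : M * M = M + M - 1.
  by have := Cayley2 M; rewrite trM detM scalerDl !scale1r.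
have Mk k : M ^+ k = 1 + (M - 1) *+ k.
  elim: k => [|k IHk]; first by rewrite addr0.
  rewrite exprS IHk mulrDr mulr1 mulrnAr mulrBr M2 mulr1 mulrS.
  by rewrite [M + M - 1]addrAC addrK addrA; congr (_ + _); rewrite addrC subrK.
have /eqP : (M - 1) *+ n = 0 by apply: (addrI 1); rewrite addr0 -Mk Mn.
by rewrite -scaler_nat scaler_eq0 (negPf nzn) subr_eq0 (negPf M1).
Qed.

(** The two factors are those of h^2 - (M + M^-1) h + 1, which vanishes because
M + M^-1 is the scalar [\tr M]. *)
Lemma trace_root M h : \det M = 1 -> \det h = 1 -> \tr h = \tr M ->
  M *m h = h *m M -> (h - M) *m (h *m M - 1) = 0.
Proof.
move=> dM dh th cMh; change ((h - M) * (h * M - 1) = 0).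
have hh : h * h = \tr M *: h - 1 by have := Cayley2 h; rewrite dh th.
have MM : M * M = \tr M *: M - 1 by have := Cayley2 M; rewrite dM.
have {}cMh : M * h = h * M := cMh.
rewrite mulrBl !mulrBr !mulr1 !mulrA hh cMh -(mulrA h M M) MM.
rewrite mulrBl mulrBr mul1r mulr1 -scalerAl -scalerAr.
by apply/eqP; rewrite subr_eq0 addrAC.
Qed.

End Matrix2.

Local Close Scope ring_scope.

(** * Centralisers and normalisers in GL(2, F) *)

Section GL2.

Variable F : finFieldType.
Implicit Types g h t : {'GL_2[F]}.

(** The value is [1] on singular matrices. *)
Definition toGL (A : 'M[F]_2) : {'GL_2[F]} := insubd (1 : {'GL_2[F]}) A.

Lemma toGLK (A : 'M[F]_2) : A \in unitmx -> GLval (toGL A) = A.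
Proof. by move=> uA; rewrite /toGL [LHS]val_insubd uA. Qed.

Lemma GL_inj g h : GLval g = GLval h -> g = h.
Proof. exact: val_inj. Qed.

Lemma GL_X g n : GLval (g ^+ n) = (GLval g ^+ n)%R.
Proof. by elim: n => // n IHn; rewrite expgS exprS -IHn. Qed.

Lemma GL_mul_eq g h k : GLval g = (GLval h *m GLval k)%R -> g = h * k.
Proof. by move=> gE; apply: GL_inj; rewrite GL_MxE. Qed.

Lemma GL_exp_order g : (GLval g ^+ #[g] = 1)%R.
Proof. by rewrite -GL_X; have /= -> := expg_order g. Qed.

Lemma GL_order1 g : GLval g = 1%:M%R -> #[g] = 1%N.
Proof. by move=> g1; apply/eqP; rewrite order_eq1; apply/eqP/GL_inj. Qed.

Lemma GL_norm_cycle g h : h \in 'N(<[g]>) -> g ^ h \in <[g]>.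
Proof. by move=> nh; rewrite memJ_norm ?cycle_id. Qed.

Lemma GL_cent1 g h : (h \in 'C[g]) = (GLval g *m GLval h == GLval h *m GLval g)%R.
Proof.
apply/cent1P/eqP => [cgh | cgh].
  have /= := congr1 (@GLval _ _) cgh; exact.
by apply: GL_inj; rewrite !GL_MxE cgh.
Qed.

Lemma GL_cent1P g h : noeig (GLval g) -> h \in 'C[g] ->
  exists a b, GLval h = (a%:M + b *: GLval g)%R.
Proof. by move=> ng; rewrite GL_cent1 => /eqP/(noeig_commutant ng). Qed.

Lemma noeig_cent_abelian g : noeig (GLval g) -> abelian 'C[g].
Proof.
move=> ng; apply/centsP=> h /(GL_cent1P ng)[a [b hE]] k /(GL_cent1P ng)[c [d kE]].
apply: GL_inj; rewrite !GL_MxE hE kE !mulmxDl !mulmxDr.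
rewrite !mul_scalar_mx !mul_mx_scalar -!scalemxAl -!scalemxAr !scalerA.
by rewrite !scale_scalar_mx addrACA (mulrC c a) (mulrC d b).
Qed.

(** The centraliser consists of the nonzero polynomials of degree at most 1 in
[g]. *)
Lemma noeig_cent_card g : noeig (GLval g) -> #|'C[g]| = (#|F| ^ 2).-1.
Proof.
move=> ng; pose phi (ab : F * F) := toGL (ab.1%:M + ab.2 *: GLval g)%R.
have phiE ab : ab != (0, 0)%R -> GLval (phi ab) = (ab.1%:M + ab.2 *: GLval g)%R.
  by case: ab => a b nz; rewrite toGLK // noeig_unit.
have -> : (#|F| ^ 2).-1 = #|[set~ ((0, 0)%R : F * F)]|.
  by rewrite cardsC1 card_prod.
rewrite -(card_in_imset (f := phi)).
  apply: eq_card => h; apply/idP/imsetP => [Ch | [ab nz ->]].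
    have [a [b hE]] := GL_cent1P ng Ch; exists (a, b).
      rewrite !inE; apply/eqP=> [[a0 b0]]; have := GL_unit h.
      by rewrite hE a0 b0 scale0r addr0 raddf0 unitr0.
    apply: GL_inj; rewrite phiE // -?hE //; apply/eqP=> [[a0 b0]].
    by have := GL_unit h; rewrite hE a0 b0 scale0r addr0 raddf0 unitr0.
  rewrite GL_cent1 phiE; last by rewrite !inE in nz.
  by rewrite mulmxDl mulmxDr scalar_mxC -scalemxAl -scalemxAr.
move=> [a b] [c d] nz1 nz2 /(congr1 (@GLval _ _)); rewrite !inE in nz1 nz2.
by rewrite !phiE //; apply: noeig_inj.
Qed.

(** The differences [h - 1] are invertible, so the centraliser embeds in the
unit group of a field. *)
Lemma noeig_cent_cyclic g : noeig (GLval g) -> cyclic 'C[g].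
Proof.
move=> ng; apply: (@div_ring_mul_group_cyclic _ 'C[g] _ (@GLval 2 F)) => //.
  move=> h /setD1P[h1 Ch]; have [a [b hE]] := GL_cent1P ng Ch.
  have -> : (GLval h - 1 = (a - 1)%:M + b *: GLval g)%R.
    by rewrite hE raddfB /= addrAC.
  apply: noeig_unit => //; apply: contraNneq h1 => -[a1 b0].
  apply/eqP/GL_inj; rewrite hE b0 scale0r addr0.
  by move/eqP: a1; rewrite subr_eq0 => /eqP->.
exact: noeig_cent_abelian.
Qed.

End GL2.

(** The last hypothesis bounds the index of ['C[g]] in the normaliser by 2. *)
Lemma inverted_norm (gT : finGroupType) (g t : gT) :
    t ^+ 2 = 1 -> g ^ t = g^-1 -> g != g^-1 ->
    (forall n, n \in 'N(<[g]>) -> (g ^ n == g) || (g ^ n == g^-1)) ->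
  [/\ #[t] = 2 , t \notin 'C[g] & 'C[g] ><| <[t]> = 'N(<[g]>)].
Proof.
move=> t2 gt gV nP.
have t1 : t != 1 by apply: contraNneq gV => t1; rewrite -gt t1 conjg1.
have ot : #[t] = 2 by apply: nt_prime_order.
have Cfix h : (h \in 'C[g]) = (g ^ h == g).
  by apply/cent1P/eqP => [/commute_sym/commgP/conjg_fixP|/conjg_fixP/commgP/commute_sym].
have nCt : t \notin 'C[g] by rewrite Cfix gt eq_sym.
split=> //; rewrite sdprodE; last first.
- rewrite setIC prime_TIg -?orderE ?ot // cycle_subG //.
- rewrite cycle_subG inE; apply/subsetP=> _ /imsetP[h Ch ->].
  have gVt : g^-1 ^ t = g by rewrite conjVg gt invgK.
  by rewrite Cfix -{1}gVt -conjJg conjVg (eqP (_ : g ^ h == g)) ?gVt // -Cfix.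
apply/eqP; rewrite eqEsubset mul_subG.
- apply/subsetP=> n nn; have /orP[] := nP n nn; rewrite -?Cfix.
    by move=> Cn; rewrite -[n]mulg1 mem_mulg.
  move/eqP=> gn; rewrite -[n](mulgK t) mem_mulg ?groupV ?cycle_id //.
  by rewrite Cfix conjgM gn conjVg gt invgK.
- by have := cent_sub <[g]>; rewrite cent_cycle.
by rewrite cycle_subG inE -cycleJ gt cycleV.
Qed.

(** * The affine group of the plane over F_p *)

Lemma isog_Zp2 (p : nat) (gT : finGroupType) (G : {group gT}) :
  prime p -> (G \isog setX (Zp p) (Zp p)) = p.-abelem G && (#|G| == (p ^ 2)%N).
Proof.
move=> p_pr; have p_gt0 := prime_gt0 p_pr.
have oZ : #|setX (Zp p) (Zp p)| = (p ^ 2)%N by rewrite cardsX card_Zp.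
have abZ : p.-abelem (setX (Zp_group p) (Zp_group p)).
  rewrite (dprod_abelem _ (setX_dprod _ _)).
  rewrite -(isog_abelem (isog_setX1 _ _) p) -(isog_abelem (isog_set1X _ _) p).
  by rewrite prime_abelem //= card_Zp.
rewrite -[setX _ _]/(gval (setX_group (Zp_group p) (Zp_group p))).
by rewrite isog_sym (isog_abelem_card _ abZ) oZ.
Qed.

Lemma row_eqmx (R : nzRingType) m n (A B : 'M[R]_(m, n)) :
  (forall u : 'rV_m, u *m A = u *m B)%R -> A = B.
Proof. by move=> eqAB; apply/row_matrixP=> i; rewrite !rowE eqAB. Qed.

Section Plane.

Variable p : nat.
Hypothesis p_pr : prime p.

Local Notation plane := 'rV['F_p]_2.
Local Notation GL2p := 'GL_2['F_p].

Lemma plane_abelem : p.-abelem [set: plane].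
Proof. exact: mx_Fp_abelem. Qed.

Lemma card_plane : #|[set: plane]| = (p ^ 2)%N.
Proof. by rewrite cardsT card_mx card_Fp. Qed.

(** An additive map is F_p-linear, since every scalar is a multiple of 1. *)
Lemma plane_morph_lin (f : plane -> plane) :
    {morph f : u v / (u + v)%R} -> forall u, f u = (u *m lin1_mx f)%R.
Proof.
move=> fD u; have f0 : (f 0 = 0)%R by apply: (addrI (f 0%R)); rewrite -fD !addr0.
have fM k v : (f (v *+ k) = f v *+ k)%R.
  by elim: k => [|k IHk]; rewrite ?mulr0n // !mulrS fD IHk.
have fZ c v : (f (c *: v) = c *: f v)%R by rewrite -[c]natr_Zp !scaler_nat fM.
rewrite {1}(row_sum_delta u) mulmx_sum_row.
rewrite (big_morph f fD f0); apply: eq_bigr => i _; rewrite fZ.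
by rewrite rowE -rowE /lin1_mx; congr (_ *: _)%R; apply/rowP=> j; rewrite !mxE.
Qed.

(** The natural action of GL(2, p) on row vectors, by right multiplication. *)
Definition affine := sdprod_by ('MR (GLrepr 'F_p 1))%gact.

Definition trans (u : plane) : affine := sdpair1 ('MR (GLrepr 'F_p 1))%gact u.
Definition lin (g : {'GL_2['F_p]}) : affine := sdpair2 ('MR (GLrepr 'F_p 1))%gact g.

Canonical trans_morphism := [morphism [set: plane] of trans].
Canonical lin_morphism := [morphism GL2p of lin].

(** The subgroup of translations; [Li] below is that of the linear maps. *)
Definition Tr := (trans @* [set: plane])%G.
Definition Li := (lin @* GL2p)%G.

Lemma affine_sdprod : Tr ><| Li = [set: affine].
Proof. exact: sdprod_sdpair. Qed.

Lemma injm_trans : 'injm trans. Proof. exact: injm_sdpair1. Qed.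
Lemma injm_lin : 'injm lin. Proof. exact: injm_sdpair2. Qed.

Lemma trans_inj : injective trans.
Proof. by move=> u v; apply: (injmP injm_trans); rewrite inE. Qed.

Lemma lin_inj : injective lin.
Proof. by move=> u v; apply: (injmP injm_lin); rewrite inE. Qed.

Lemma isom_trans : isom [set: plane] Tr trans.
Proof. by apply/isomP; rewrite injm_trans. Qed.

Lemma trans_lin u g : trans u ^ lin g = trans (u *m GLval g)%R.
Proof. by rewrite /trans /lin -sdpair_act ?inE //= mx_repr_actE ?inE. Qed.

Lemma linP l : reflect (exists g, l = lin g) (l \in Li).
Proof.
by apply: (iffP morphimP) => [[g _ _ ->] | [g ->]]; [exists g | exists g; rewrite ?inE].
Qed.

Lemma transP l : reflect (exists u, l = trans u) (l \in Tr).
Proof.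
by apply: (iffP morphimP) => [[g _ _ ->] | [g ->]]; [exists g | exists g; rewrite ?inE].
Qed.

Lemma affine_faithful : 'C_Li(Tr) = 1.
Proof.
apply/trivgP/subsetP=> _ /setIP[/linP[g ->] /centP cgT].
suffices -> : g = 1 by rewrite morph1 inE.
apply/GL_inj/row_eqmx => u; rewrite mulmx1.
apply: trans_inj; rewrite -trans_lin.
by apply/conjg_fixP/commgP/commute_sym/cgT/transP; exists u.
Qed.

Lemma Tr_isog : Tr \isog setX (Zp p) (Zp p).
Proof.
rewrite isog_Zp2 // -(isog_abelem (isom_isog _ (subxx _) isom_trans) p).
rewrite plane_abelem -(card_isog (isom_isog _ (subxx _) isom_trans)).
by rewrite card_plane eqxx.
Qed.

(** The automorphisms of the additive group of the plane are linear. *)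
Lemma affine_full : #|Aut Tr| <= #|Li|.
Proof.
have [injT imT] := isomP isom_trans.
rewrite -(card_isog (isog_Aut (isom_isog _ (subxx _) isom_trans))).
rewrite (card_injm injm_lin) //.
pose h (a : {perm plane}) := toGL (lin1_mx a).
have aD (a : {perm plane}) : a \in Aut [set: plane] -> {morph a : u v / (u + v)%R}.
  by move=> Aa u v; have := morphM (autm Aa) (in_setT u) (in_setT v).
have aE a u : a \in Aut [set: plane] -> a u = (u *m GLval (h a))%R.
  move=> Aa; rewrite toGLK; first exact: plane_morph_lin (aD a Aa) u.
  suffices aV : (lin1_mx a *m lin1_mx (a^-1)%g = 1%:M)%R by exact: (mulmx1_unit aV).1.
  apply: row_eqmx => v; rewrite mulmxA mulmx1.
  rewrite -(plane_morph_lin (aD a Aa)) -(plane_morph_lin (aD _ _)) ?groupV //.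
  exact: permK.
have injh : {in Aut [set: plane] &, injective h}.
  by move=> a b Aa Ab eqh; apply/permP=> u; rewrite !aE ?eqh.
rewrite -(card_in_imset injh); exact: subset_leq_card (subsetT _).
Qed.

Lemma affine_Hol : [set: affine] \isog Hol (setX_group (Zp_group p) (Zp_group p)).
Proof.
have := Tr_isog; rewrite -[setX _ _]/(gval (setX_group (Zp_group p) (Zp_group p))).
move=> TZ; apply: (isog_Hol affine_sdprod affine_faithful TZ).
by rewrite -(card_isog (isog_Aut TZ)) affine_full.
Qed.

End Plane.

(** * The groups generated by the translations and a matrix *)

Section Model.

Variable p : nat.
Hypothesis p_pr : prime p.

Local Notation lin := (@lin p).
Local Notation trans := (@trans p).
Local Notation Tr := (Tr p).
Local Notation Li := (Li p).
Implicit Types g h : {'GL_2['F_p]}.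

(** Up to isomorphism these are the groups (C_p x C_p) ><| C_n with a faithful
action, where n is the order of [g]. *)
Definition model g := (Tr <*> <[lin g]>)%G.

Lemma lin_X g k : lin (g ^+ k) = lin g ^+ k.
Proof. by rewrite morphX ?inE. Qed.

Lemma order_lin g : #[lin g] = #[g].
Proof. by rewrite -(order_injm (injm_lin p)) ?inE. Qed.

Lemma lin_cycle g : lin @* <[g]> = <[lin g]>.
Proof. by rewrite morphim_cycle ?inE. Qed.

Lemma lin_cycle_sub g : <[lin g]> \subset Li.
Proof. by rewrite -lin_cycle morphimS ?subsetT. Qed.

Lemma model_sdprod g : Tr ><| <[lin g]> = model g.
Proof. exact: sdprod_sub (affine_sdprod p) (lin_cycle_sub g). Qed.

Lemma card_Tr : #|Tr| = (p ^ 2)%N.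
Proof. by rewrite (card_injm (injm_trans p)) ?card_plane. Qed.

Lemma abelian_Tr : abelian Tr.
Proof.
have [_ <-] := isomP (isom_trans p); rewrite morphim_abelian //.
by have /and3P[] := plane_abelem p_pr.
Qed.

Lemma card_model g : #|model g| = (p ^ 2 * #[g])%N.
Proof. by rewrite -(sdprod_card (model_sdprod g)) card_Tr -orderE order_lin. Qed.

Lemma faithful_lin (K : {group affine p}) : K \subset Li -> 'C_K(Tr) = 1.
Proof. by move=> sKL; apply/trivgP; rewrite -(affine_faithful p) setSI. Qed.

Lemma cent_lin g : ~~ eigenvalue (GLval g) 1%R -> 'C_Tr(<[lin g]>) = 1.
Proof.
move=> ng; apply/trivgP/subsetP=> _ /setIP[/transP[u ->]].
move/centP/(_ _ (cycle_id _))/commgP/conjg_fixP.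
rewrite trans_lin => /trans_inj ug; rewrite inE.
have [-> | nzu] := eqVneq u 0%R; first by rewrite morph1.
by case/eigenvalueP: ng; exists u; rewrite ?scale1r.
Qed.

Lemma center_model g : ~~ eigenvalue (GLval g) 1%R -> 'Z(model g) = 1.
Proof.
move=> ng; rewrite (center_sdprod (model_sdprod g)) ?cycle_abelian ?cent_lin //.
exact/faithful_lin/lin_cycle_sub.
Qed.

Lemma norm_lin g : 'N_Li(<[lin g]>) = lin @* 'N(<[g]>).
Proof.
rewrite -lin_cycle -(injm_subnorm (injm_lin p)) ?subsetT //.
by congr (_ @* _); apply/setIidPr/subsetT.
Qed.

Definition model_norm g := (Tr <*> lin @* 'N(<[g]>))%G.

(** This is [Aut_sdprod_norm] in the affine group, which is the holomorph of
its subgroup of translations. *)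
Lemma Aut_model g : coprime p #[g] -> ~~ eigenvalue (GLval g) 1%R ->
  Aut (model g) \isog model_norm g.
Proof.
move=> cog ng; rewrite /= -norm_lin.
apply: (Aut_sdprod_norm (affine_sdprod p) abelian_Tr _ _ _ (model_sdprod g)).
- exact: affine_faithful.
- exact: affine_full.
- exact: lin_cycle_sub.
- by rewrite card_Tr -orderE order_lin coprimeXl.
exact: cent_lin.
Qed.

Lemma model_conj g h (k : {'GL_2['F_p]}) :
  <[g]> :^ k = <[h]> -> model g \isog model h.
Proof.
move=> gkh; suffices <- : (model g :^ lin k)%G = model h by apply: conj_isog.
apply: val_inj; rewrite /= joingE conjYg; congr (_ <*> _).
  have nTL := sdprod_context (affine_sdprod p).
  case: nTL => _ _ _ /subsetP nTL _; apply/normP/nTL/linP; by exists k.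
rewrite -lin_cycle -morphimJ ?subsetT ?inE //.
by rewrite gkh lin_cycle.
Qed.

Lemma model_matrix_sdprod (P : 'M['F_p]_2 -> Prop) g :
  P (GLval g) -> matrix_sdprod #[g] P (model g).
Proof.
move=> Pg; exists Tr, (lin g), (invm_morphism (injm_trans p)), (GLval g).
have [injT imT] := isomP (isom_trans p).
split=> //; first exact: model_sdprod.
- exact: order_lin.
- by apply/isomP; rewrite injm_invm im_invm.
move=> _ /transP[u ->]; rewrite trans_lin /=.
by rewrite !invmE ?inE.
Qed.

(** The relations [f (v ^ x) = f v *m M] and [#[x] = q] give [M ^+ q = 1]; as
[M] is not the identity and [q] is prime, the order of [M] is [q], so that [x]
acts faithfully. *)
Lemma matrix_sdprod_model q (P : 'M['F_p]_2 -> Prop) (gT : finGroupType)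
    (G : {group gT}) :
    prime q -> (forall M, P M -> M <> 1%:M%R) -> matrix_sdprod q P G ->
  exists g, [/\ P (GLval g), #[g] = q & G \isog model g].
Proof.
move=> q_pr P1 [V [x [f [M [defG ox isof fx PM]]]]].
have [injf imf] := isomP isof.
have [_ _ _ nVx _] := sdprod_context defG.
have fxk k v : v \in V -> f (v ^ (x ^+ k)) = (f v *m M ^+ k)%R.
  move=> Vv; elim: k => [|k IHk]; first by rewrite conjg1 mulmx1.
  rewrite expgSr conjgM fx ?IHk ?exprSr ?mulmxA //.
  by rewrite memJ_norm // (subsetP nVx) ?mem_cycle.
have Mq : (M ^+ q = 1)%R.
  apply: row_eqmx => u; have : u \in f @* V by rewrite imf inE.
  by case/morphimP=> v _ Vv ->; rewrite -fxk // -ox expg_order conjg1 mulmx1.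
have uM : M \in unitmx.
  have : (M ^+ q \is a GRing.unit)%R by rewrite Mq unitr1.
  by rewrite unitrX_pos ?prime_gt0.
have gM := toGLK uM; have og : #[toGL M] = q.
  apply: nt_prime_order => //; first by apply: GL_inj; rewrite GL_X gM Mq.
  by apply/eqP=> g1; apply: (P1 M PM); rewrite -gM g1.
exists (toGL M); rewrite gM; split=> //.
have f1M : {in V &, {morph (fun v => trans (f v)) : u v / u * v}}.
  by move=> u v Vu Vv /=; rewrite morphM // morphM ?inE.
have iso1 : isom V Tr (Morphism f1M).
  apply/isomP; split.
    by apply/injmP=> u v Vu Vv /trans_inj; apply: (injmP injf).
  apply/setP=> t; apply/morphimP/transP => [[v _ Vv ->] | [u ->]].
    by exists (f v).
  have : u \in f @* V by rewrite imf inE.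
  by case/morphimP=> v _ Vv ->; exists v.
apply: (faithful_sdprod_isog defG (model_sdprod (toGL M)) iso1).
- rewrite prime_TIg -?orderE ?ox // cycle_subG; apply/negP=> /centP cVx.
  apply: (P1 M PM); apply: row_eqmx => u; rewrite mulmx1.
  have : u \in f @* V by rewrite imf inE.
  case/morphimP=> v _ Vv ->; rewrite -fx //; congr (f _).
  by apply/conjg_fixP/commgP/commute_sym/cVx.
- exact/faithful_lin/lin_cycle_sub.
- by rewrite -!orderE order_lin ox og.
move=> _ /cycleP[k ->]; exists (lin (toGL M) ^+ k); first exact: mem_cycle.
move=> v Vv; rewrite -lin_X /= trans_lin fxk //.
by rewrite GL_X gM.
Qed.

End Model.

(** * Normalisers of the scalar and Singer subgroups *)

Lemma prime_primitive (F : fieldType) q (a : F) :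
  prime q -> (a ^+ q = 1)%R -> a != 1%R -> (q.-primitive_root a)%R.
Proof.
move=> q_pr aq a1; have [m pm m_dv] := prim_order_exists (prime_gt0 q_pr) aq.
have /primeP[_ /(_ m m_dv)/orP[]/eqP E] := q_pr; last by rewrite -E.
by have := prim_expr_order pm; rewrite E expr1 => /eqP; rewrite (negPf a1).
Qed.

Section Normalisers.

Variable p : nat.
Hypothesis p_pr : prime p.

Local Notation lin := (@lin p).
Local Notation Tr := (Tr p).
Local Notation Li := (Li p).
Local Notation model := (@model p).
Local Notation model_norm := (@model_norm p).
Implicit Types g h n : {'GL_2['F_p]}.

(** [noeig_order] applies: a nontrivial q-th root of unity in F_p would make q
divide p - 1 as well as p + 1, hence 2. *)
Lemma noeig_Singer q g : prime q -> 2 < q -> q %| p.+1 -> #[g] = q ->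
  noeig (GLval g) /\ (\det (GLval g) = 1)%R.
Proof.
move=> q_pr q_gt2 q_dv og.
have q_ndp : ~~ (p %| q).
  rewrite dvdn_prime2 //; apply: contraL q_dv => /eqP->.
  by rewrite -addn1 dvdn_addr // dvdn1; case: (q) q_gt2 => [|[]].
have [||||] := @noeig_order 'F_p (GLval g) q; last by split.
- by rewrite -(dvdn_pcharf (pchar_Fp p_pr)).
- by rewrite -og GL_exp_order.
- apply: contraTneq q_gt2 => g1; rewrite -og.
  by rewrite (GL_order1 g1).
move=> a aq; apply/eqP; apply: contraT => a1.
have pa := prime_primitive q_pr aq a1.
have nza : a != 0%R.
  apply: contraTneq (oner_neq0 'F_p) => a0; rewrite -aq a0 expr0n.
  by rewrite gtn_eqF ?prime_gt0 // eqxx.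
have : q %| p.-1.
  rewrite (prim_order_dvd pa); have := expf_card a; rewrite card_Fp // => ap.
  by apply/eqP/(mulfI nza); rewrite -exprS prednK ?prime_gt0 // mulr1.
have -> : p.-1 = (p.+1 - 2)%N by rewrite subSS subn1.
rewrite dvdn_subr //; last by rewrite ltnS prime_gt0.
by move/dvdn_leq => /(_ isT); rewrite leqNgt q_gt2.
Qed.

Lemma scalar_noeig1 (M : 'M['F_p]_2) : scalar_nonid M -> ~~ eigenvalue M 1%R.
Proof.
case=> /is_scalar_mxP[a ->] a1; apply/eigenvalueP=> [[v]].
rewrite mul_mx_scalar scale1r => /eqP; rewrite -subr_eq0 -{2}[v]scale1r -scalerBl.
rewrite scaler_eq0 subr_eq0 => /orP[/eqP a1'|/eqP->]; last by rewrite eqxx.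
by case: a1; rewrite a1'.
Qed.

Lemma norm_scalar g : is_scalar_mx (GLval g) -> 'N(<[g]>) = [set: {'GL_2['F_p]}].
Proof.
case/is_scalar_mxP=> a ga; apply/setP=> h; rewrite in_setT.
apply: (subsetP (cent_sub _)); rewrite cent_cycle GL_cent1 ga.
by rewrite mul_scalar_mx mul_mx_scalar.
Qed.

Lemma Aut_model_scalar g : coprime p #[g] -> scalar_nonid (GLval g) ->
  Aut (model g) \isog Hol (setX_group (Zp_group p) (Zp_group p)).
Proof.
move=> cog sg; apply: isog_trans (Aut_model p_pr cog (scalar_noeig1 sg)) _.
suffices -> : model_norm g = [set: affine p]%G by apply: affine_Hol.
apply: val_inj; rewrite /= (norm_scalar sg.1); exact: sdprodWY (affine_sdprod p).
Qed.

(** An involution that inverts [g] when [\det (GLval g) = 1]: it is chosen so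
that [flip g *m g *m flip g = \tr g - g], the right-hand side being the inverse
of [g]. *)
Definition flip g : {'GL_2['F_p]} :=
  toGL (mx2 1 0 ((GLval g 1 1 - GLval g 0 0) / GLval g 0 1) (- 1))%R.

(** If [n] normalises the subgroup generated by [g], then [g ^ n] commutes with
[g] and has the trace and the determinant of [g]; by [trace_root] in the field
generated by [g] it is [g] or its inverse. *)
Lemma noeig_norm g : noeig (GLval g) -> (\det (GLval g) = 1)%R ->
  [/\ #[flip g] = 2, flip g \notin 'C[g] & 'C[g] ><| <[flip g]> = 'N(<[g]>)].
Proof.
move=> ng dg.
have nz01 := noeig_nz01 ng.
have gV : (GLval g^-1 = (\tr (GLval g))%:M - GLval g)%R.
  apply: (mulIr (GL_unit g)); rewrite -GL_ME mulVg mulrBl.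
  have -> : (GLval g * GLval g = \tr (GLval g) *: GLval g - 1)%R.
    by have := Cayley2 (GLval g); rewrite dg.
  have -> : ((\tr (GLval g))%:M * GLval g = \tr (GLval g) *: GLval g)%R.
    exact: mul_scalar_mx.
  by rewrite opprB addrC subrK.
(* [tt] says that the matrix of [flip g] is its own inverse. *)
have tt : (mx2 1 0 ((GLval g 1 1 - GLval g 0 0) / GLval g 0 1) (- 1) *m
   mx2 1 0 ((GLval g 1 1 - GLval g 0 0) / GLval g 0 1) (- 1) = 1%:M)%R.
  by apply: mx2P; rewrite !mulmx2E !mx2E !mxE /=; ring.
have tE := toGLK (mulmx1_unit tt).1; rewrite -/(flip g) in tE.
apply: inverted_norm.
- by apply: GL_inj; rewrite expgS expg1 GL_MxE tE tt.
- apply: (mulgI (flip g)); rewrite -conjgC; apply: GL_inj.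
  rewrite !GL_MxE gV tE.
  by apply: mx2P; rewrite !mulmx2E !mx2E !mxE /= tr2E; field.
- apply/eqP=> gg.
  have g2 : (GLval g * GLval g = 1)%R by rewrite -GL_ME {2}gg mulgV.
  have : ((1%:M + 1 *: GLval g) *m (- (1%:M) + 1 *: GLval g) = 0)%R.
    rewrite scale1r mulmxDl mul1mx mulmxDr mulmxN mulmx1.
    have -> : (GLval g *m GLval g = 1%:M)%R := g2.
    by rewrite addrA addrK addNr.
  move=> u0; have: ((1%:M + 1 *: GLval g) *m ((- 1)%:M + 1 *: GLval g) \in unitmx)%R.
    by rewrite unitmx_mul !noeig_unit // -pair_eqE /= ?oner_eq0 ?oppr_eq0 ?oner_eq0 ?andbF.
  by rewrite [(- 1)%:M%R]raddfN /= u0 unitmxE det0 unitr0.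
move=> n nn; set h := g ^ n.
have Ch : h \in 'C[g].
  have: h \in <[g]> := GL_norm_cycle nn.
  by apply: subsetP; rewrite -cent_cycle; apply: cycle_abelian.
have [a [b hE]] := GL_cent1P ng Ch.
have gn : (GLval g *m GLval n = GLval n *m GLval h)%R by rewrite -!GL_MxE -conjgC.
have dh : (\det (GLval h) = 1)%R.
  have := congr1 determinant gn; rewrite !det_mulmx dg mul1r => dn.
  by apply: (mulfI (GL_det n)); rewrite mulr1 -dn.
have th : (\tr (GLval h) = \tr (GLval g))%R.
  have -> : (GLval h = GLval n^-1 *m (GLval g *m GLval n))%R.
    by rewrite gn -!GL_MxE mulKg.
  by rewrite mxtrace_mulC -mulmxA -GL_MxE mulgV mulmx1.
have [// | hg] := eqVneq h g; apply/eqP.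
have := trace_root dg dh th (eqP (etrans (esym (GL_cent1 g h)) Ch)).
have -> : (GLval h - GLval g = a%:M + (b - 1) *: GLval g)%R.
  by rewrite hE scalerBl scale1r addrA.
have /(noeig_unit ng) u : ((a, b - 1) != (0, 0))%R.
  apply: contraNneq hg => ab0; have a0 : a = 0%R := congr1 fst ab0.
  have /eqP : (b - 1 = 0)%R := congr1 snd ab0.
  rewrite subr_eq0 => /eqP b1.
  by apply/eqP/GL_inj; rewrite hE a0 b1 raddf0 add0r scale1r.
move/(congr1 (mulmx (invmx (a%:M + (b - 1) *: GLval g)%R))).
rewrite mulKmx // mulmx0 => /eqP; rewrite subr_eq0 => /eqP hg1.
by apply: (mulIg g); rewrite mulVg; apply: GL_inj; rewrite GL_MxE hg1.
Qed.

(** The centraliser of [g] is cyclic of order p^2 - 1, and the involution [flip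
g] acts on it nontrivially as it does not centralise [g]. *)
Lemma model_norm_Singer g : noeig (GLval g) -> (\det (GLval g) = 1)%R ->
  is_C2_Singer_plane p (model_norm g).
Proof.
move=> ng dg; have [ot nCt defN] := noeig_norm ng dg.
pose S := (lin @* 'C[g])%G; pose T := (lin @* <[flip g]>)%G.
pose K := (lin @* 'N(<[g]>))%G.
have sKL : K \subset Li by rewrite morphimS ?subsetT.
have defK : S ><| T = K := injm_sdprod (subsetT _) (injm_lin p) defN.
exists Tr, K, S, T; split.
- split; first exact: sdprod_sub (affine_sdprod p) sKL.
  apply/negP=> cTK; have: K \subset 'C_K(Tr) by rewrite subsetI subxx.
  rewrite faithful_lin // => sK1; have: lin (flip g) \in K.
    apply: mem_morphim; rewrite ?in_setT //; have [_ <- _ _] := sdprodP defN.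
    by have := mem_mulg (group1 'C[g]) (cycle_id (flip g)); rewrite mul1g.
  move/(subsetP sK1)/set1P=> l1; have := order_lin (flip g).
  by rewrite l1 order1 ot.
- exact: Tr_isog.
- exact: faithful_lin.
split; last 2 first.
- rewrite isog_Zp ?morphim_cyclic ?noeig_cent_cyclic //; last first.
    by rewrite -subn1 subn_gt0 -(expn0 p) ltn_exp2l ?prime_gt1.
  by rewrite (card_injm (injm_lin p)) ?subsetT // noeig_cent_card // card_Fp //= eqxx.
- rewrite isog_Zp // morphim_cyclic ?cycle_cyclic //.
  by rewrite (card_injm (injm_lin p)) ?subsetT // -orderE ot.
split=> //; apply/negP=> /subsetP/(_ (lin (flip g))).
rewrite [gval T]lin_cycle cycle_id => /(_ isT)/centP/(_ (lin g)).
have: lin g \in S by rewrite mem_morphim ?in_setT //; apply/cent1P.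
move=> Sg /(_ Sg) cfg; case/negP: nCt; apply/cent1P/(@lin_inj p).
by rewrite !morphM ?inE.
Qed.

Lemma isog_C2_Singer (aT rT : finGroupType) (A : {group aT}) (B : {group rT}) :
  A \isog B -> is_C2_Singer_plane p A -> is_C2_Singer_plane p B.
Proof.
case/isogP=> f injf fA [V [K [S [T [[defA nVK] Vi ffK [[defK nST] Si Ti]]]]]].
have [/andP[sVA _] sKA _ _ _] := sdprod_context defA.
have [/andP[sSK _] sTK _ _ _] := sdprod_context defK.
have [sSA sTA] := (subset_trans sSK sKA, subset_trans sTK sKA).
exists (f @* V)%G, (f @* K)%G, (f @* S)%G, (f @* T)%G; split.
- by rewrite /nondirect_sdprod -fA (injm_sdprod _ injf defA) //= injm_cents.
- by rewrite (isog_transl _ (sub_isog sVA injf)) in Vi.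
- by rewrite /= -injm_subcent // ffK morphim1.
split; first by rewrite /nondirect_sdprod (injm_sdprod _ injf defK) //= injm_cents.
  by rewrite (isog_transl _ (sub_isog sSA injf)) in Si.
by rewrite (isog_transl _ (sub_isog sTA injf)) in Ti.
Qed.

Lemma isog_C2_Hol_Hol (aT rT : finGroupType) (A : {group aT}) (B : {group rT}) :
  A \isog B -> is_C2_Hol_Hol p A -> is_C2_Hol_Hol p B.
Proof.
case/isogP=> f injf fA [B1 [B2 [C [t [defA ot defC B12 [H1 H2]]]]]].
have [/andP[sCA _] stA _ _ _] := sdprod_context defA.
have At : t \in A by rewrite -cycle_subG.
have [_ defC' _ _] := dprodP defC.
have sB1 : B1 \subset A by rewrite (subset_trans _ sCA) // -defC' mulG_subl.
have sB2 : B2 \subset A by rewrite (subset_trans _ sCA) // -defC' mulG_subr.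
exists (f @* B1)%G, (f @* B2)%G, (f @* C)%G, (f t); split.
- by rewrite /= -morphim_cycle // (injm_sdprod _ injf defA) // -fA.
- by rewrite (order_injm injf).
- exact: injm_dprod defC.
- by rewrite /= -morphimJ // B12.
by rewrite -(isog_transl _ (sub_isog sB1 injf)) -(isog_transl _ (sub_isog sB2 injf)).
Qed.

End Normalisers.

(** * Diagonal matrices *)

Section Diagonal.

Variable p : nat.
Hypothesis p_pr : prime p.

Local Notation lin := (@lin p).
Local Notation trans := (@trans p).
Local Notation Tr := (Tr p).
Implicit Types g h n : {'GL_2['F_p]}.

Definition isdiag h := ((GLval h 0 1 == 0) && (GLval h 1 0 == 0))%R.

Lemma isdiagP h : reflect (GLval h = mx2 (GLval h 0 0) 0 0 (GLval h 1 1))%R (isdiag h).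
Proof.
apply: (iffP andP) => [[/eqP h01 /eqP h10] | ->]; last by rewrite !mx2E.
by apply: mx2P; rewrite !mx2E.
Qed.

Lemma isdiag00 h : isdiag h -> (GLval h 0 0 != 0)%R.
Proof.
case/andP=> /eqP h01 _; have := GL_det h; rewrite det2E h01 mul0r subr0 mulf_eq0.
by case/norP.
Qed.

Definition swap : {'GL_2['F_p]} := toGL (mx2 0 1 1 0)%R.

Lemma swap_mul : (mx2 0 1 1 0 *m mx2 0 1 1 0 = 1%:M :> 'M['F_p]_2)%R.
Proof. by apply: mx2P; rewrite !mulmx2E !mx2E !mxE /=; ring. Qed.

Lemma swapE : GLval swap = mx2 0 1 1 0 %R.
Proof. exact: toGLK (mulmx1_unit swap_mul).1. Qed.

Lemma swap2 : swap ^+ 2 = 1.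
Proof. by apply: GL_inj; rewrite expgS expg1 GL_MxE swapE swap_mul. Qed.

Lemma swapV : swap^-1 = swap.
Proof. by apply: (mulgI swap); rewrite mulgV; have := swap2; rewrite expgS expg1. Qed.

Lemma swapJ h : GLval (h ^ swap) =
  (mx2 (GLval h 1 1) (GLval h 1 0) (GLval h 0 1) (GLval h 0 0))%R.
Proof.
rewrite conjgE !GL_MxE swapV swapE.
by apply: mx2P; rewrite !mulmx2E !mx2E; ring.
Qed.

Definition e0 : 'rV['F_p]_2 := delta_mx 0%R 0%R.

Lemma e0E : ((e0 0%R 0%R = 1%R) * (e0 0%R 1%R = 0%R))%type.
Proof. by rewrite !mxE. Qed.

(** [axis] is the first coordinate axis among the translations, and [dil] is
the group of the matrices diag(a, 1); they generate [Hol1], a copy of Hol(C_p).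
*)
Definition axis := (trans @* <[e0]>)%G.

Lemma axisP u : (trans u \in axis) = (u 0 1 == 0)%R.
Proof.
rewrite -[trans u \in _]sub1set -morphim_set1 ?in_setT //.
rewrite (injmSK (injm_trans p)) ?subsetT // sub1set.
apply/cycleP/eqP => [[k ->] | u01].
  by rewrite zmodXgE mulmxnE e0E mul0rn.
exists (u 0 0)%R; rewrite zmodXgE; apply: row2P; rewrite mulmxnE e0E.
  by rewrite natr_Zp.
by rewrite mul0rn.
Qed.

Lemma card_axis : #|axis| = p.
Proof.
rewrite (card_injm (injm_trans p)) ?subsetT // -orderE; apply: nt_prime_order => //.
  have /and3P[_ _ /exponentP] := plane_abelem p_pr; apply; exact: in_setT.
apply/eqP=> d0; have := congr1 (fun u : 'rV_2 => u 0 0)%R d0; rewrite e0E mxE.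
by move/eqP; rewrite oner_eq0.
Qed.

Definition dilation_set := [set h : {'GL_2['F_p]} | isdiag h && (GLval h 1 1 == 1)%R].

Lemma dilation_group_set : group_set dilation_set.
Proof.
apply/group_setP; split=> [|h k]; first by rewrite inE /isdiag !mxE /= !eqxx.
rewrite !inE => /andP[/isdiagP hE /eqP h11] /andP[/isdiagP kE /eqP k11].
rewrite /isdiag GL_MxE !mulmx2E hE kE !mx2E h11 k11.
by rewrite !mul0r !mulr0 !addr0 mulr1 !eqxx.
Qed.
Canonical dilation_group := Group dilation_group_set.

Definition dil := (lin @* dilation_group)%G.

Lemma dilP h : (lin h \in dil) = isdiag h && (GLval h 1 1 == 1)%R.
Proof.
rewrite -[lin h \in _]sub1set -morphim_set1 ?in_setT //.
by rewrite (injmSK (injm_lin p)) ?subsetT // sub1set inE.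
Qed.

Definition Hol1 := (axis <*> dil)%G.

Lemma Hol1_sdprod : axis ><| dil = Hol1.
Proof.
apply: sdprodEY.
  apply/subsetP=> _ /morphimP[h _ Dh ->]; rewrite inE.
  apply/subsetP=> _ /imsetP[_ /morphimP[u _ Au ->] ->].
  have: trans u \in axis by rewrite mem_morphim ?in_setT.
  rewrite trans_lin !axisP mulmx2E => /eqP->; move: Dh; rewrite inE.
  by case/andP=> /isdiagP-> _; rewrite !mx2E mulr0 mul0r addr0.
apply/trivgP; have [_ _ _ _ <-] := sdprod_context (affine_sdprod p).
by rewrite setISS ?morphimS ?subsetT.
Qed.

Lemma Hol1_isog : Hol1 \isog Hol (Zp_group p).
Proof.
apply: (isog_Hol Hol1_sdprod).
- apply/trivgP/subsetP=> _ /setIP[/morphimP[h _ Dh ->] /centP cA].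
  move: Dh; rewrite inE => /andP[/isdiagP hE /eqP h11].
  suffices -> : h = 1 by rewrite morph1 inE.
  apply: GL_inj; rewrite hE h11; have : trans e0 \in axis.
    by rewrite axisP e0E.
  move/cA/commute_sym/commgP/conjg_fixP; rewrite trans_lin => /trans_inj.
  move/(congr1 (fun u : 'rV_2 => u 0 0)%R); rewrite mulmx2E !e0E mul1r mul0r addr0 => h00.
  by apply: mx2P; rewrite !mx2E !mxE ?h00.
- by rewrite -[_ \isog _]/(axis \isog Zp p) isog_Zp_prime ?card_axis.
have -> : #|Aut (Zp_group p)| = p.-1.
  rewrite card_Aut_cyclic ?Zp_cyclic // card_Zp ?prime_gt0 //.
  by rewrite -{1}(expn1 p) totient_pfactor // muln1.
rewrite (card_injm (injm_lin p)) ?subsetT //.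
pose f (a : 'F_p) : {'GL_2['F_p]} := toGL (mx2 a 0 0 1)%R.
have fE a : a != 0%R -> GLval (f a) = (mx2 a 0 0 1)%R.
  by move=> nza; rewrite toGLK // unitmxE det2E !mx2E mulr1 mul0r subr0 unitfE.
have -> : p.-1 = #|[set~ (0 : 'F_p)%R]| by rewrite cardsC1 card_Fp.
rewrite -(card_in_imset (f := f)).
  apply/subset_leq_card/subsetP=> _ /imsetP[a nza ->]; rewrite !inE in nza.
  by rewrite inE /isdiag fE // !mx2E !eqxx.
move=> a b; rewrite !inE => nza nzb fab; have := fE a nza.
by rewrite fab (fE b nzb) => /(congr1 (fun M : 'M_2 => M 0 0)%R); rewrite !mx2E.
Qed.

Definition Hol2 := (Hol1 :^ lin swap)%G.

Lemma lin_swapV : (lin swap)^-1 = lin swap.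
Proof. by rewrite -morphV ?in_setT // swapV. Qed.

Lemma axis2P u : (trans u \in axis :^ lin swap) = (u 0 0 == 0)%R.
Proof.
rewrite mem_conjg lin_swapV trans_lin axisP mulmx2E swapE !mx2E.
by rewrite mulr1 mulr0 addr0.
Qed.

Lemma dil2P h : (lin h \in dil :^ lin swap) = isdiag h && (GLval h 0 0 == 1)%R.
Proof.
rewrite mem_conjg lin_swapV -morphJ ?in_setT // dilP /isdiag swapJ !mx2E.
by rewrite [(_ == 0)%R && _]andbC.
Qed.

Lemma axis_elt x : x \in axis -> exists u, x = trans u.
Proof. by case/morphimP=> u _ _ ->; exists u. Qed.

Lemma dil_elt x : x \in dil -> exists h, x = lin h.
Proof. by case/morphimP=> u _ _ ->; exists u. Qed.

Lemma axis2_elt x : x \in axis :^ lin swap -> exists u, x = trans u.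
Proof.
by rewrite mem_conjg => /axis_elt[u xE]; exists (u *m GLval swap)%R; rewrite -trans_lin -xE conjgKV.
Qed.

Lemma dil2_elt x : x \in dil :^ lin swap -> exists u, x = lin u.
Proof.
rewrite mem_conjg => /dil_elt[h xE]; exists (h ^ swap).
by rewrite morphJ ?in_setT //= -xE conjgKV.
Qed.

Lemma isdiag_comm g h : isdiag g -> isdiag h -> commute g h.
Proof.
move=> /isdiagP gE /isdiagP hE; apply: GL_inj; rewrite !GL_MxE gE hE.
by apply: mx2P; rewrite !mulmx2E !mx2E; ring.
Qed.

Lemma diag_cent1 g h : isdiag g -> (GLval g 0 0 != GLval g 1 1)%R ->
  (h \in 'C[g]) = isdiag h.
Proof.
move=> dg nab; apply/idP/idP; last first.
  by move=> dh; apply/cent1P; apply: isdiag_comm.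
rewrite GL_cent1 (isdiagP _ dg) => /eqP cgh.
have nz : (GLval g 0 0 - GLval g 1 1 != 0)%R by rewrite subr_eq0.
have := congr1 (fun A : 'M_2 => A 0 1)%R cgh.
have := congr1 (fun A : 'M_2 => A 1 0)%R cgh.
rewrite /= !mulmx2E !mx2E !mul0r !mulr0 !addr0 !add0r => e10 e01.
apply/andP; split; apply/eqP/(mulfI nz); rewrite mulr0 mulrBl.
  by rewrite e01 [X in (_ - X)%R]mulrC subrr.
by rewrite e10 [X in (X - _)%R]mulrC subrr.
Qed.

(** The affine maps that preserve each of the two coordinates form the direct
product of two copies of the affine group of the line, which [swap] exchanges;
the linear ones among them are the diagonal matrices, that is, the centraliser
of [g]. *)
Lemma Hol12_dprod g : isdiag g -> (GLval g 0 0 != GLval g 1 1)%R ->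
  Hol1 \x Hol2 = Tr <*> lin @* 'C[g].
Proof.
move=> dg nab; have [_ _ def1 _ _] := sdprod_context Hol1_sdprod.
have defJ : Hol2 = axis :^ lin swap <*> dil :^ lin swap :> {set _}.
  by rewrite /= -conjYg.
have def2 : Hol2 = (axis :^ lin swap) * (dil :^ lin swap) :> {set _}.
  by rewrite /= -[_ <*> _]/(gval Hol1) -def1 conjsMg.
have cHol : Hol2 \subset 'C(Hol1).
  rewrite defJ /= centY join_subG !subsetI -andbA; apply/and4P; split; apply/centsP=> x.
  - move=> /axis2_elt[u ->] _ /axis_elt[v ->].
    by rewrite /commute -!morphM ?in_setT //; congr (trans _); apply: zmod_mulgC.
  - move=> xA _ /morphimP[h _ Dh ->].
    have [u xE] := axis2_elt xA; move: xA; rewrite {}xE axis2P => /eqP u0.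
    apply/commgP/conjg_fixP; rewrite trans_lin; congr (trans _).
    move: Dh; rewrite inE => /andP[/isdiagP hE /eqP h11].
    by rewrite hE h11; apply: row2P; rewrite mulmx2E !mx2E u0; ring.
  - move=> xD y yA; have [h xE] := dil2_elt xD; have [u yE] := axis_elt yA.
    move: xD yA; rewrite {}xE {}yE dil2P axisP => /andP[/isdiagP hE /eqP h00] /eqP u1.
    apply/commute_sym/commgP/conjg_fixP; rewrite trans_lin; congr (trans _).
    by rewrite hE h00; apply: row2P; rewrite mulmx2E !mx2E u1; ring.
  move=> xD y yD; have [h xE] := dil2_elt xD; have [k yE] := dil_elt yD.
  move: xD yD; rewrite {}xE {}yE dil2P dilP => /andP[dh _] /andP[dk _].
  rewrite /commute -!morphM ?in_setT //; congr (lin _); exact: isdiag_comm.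
have tiHol : Hol1 :&: Hol2 = 1.
  apply/trivgP/subsetP=> x /setIP[]; rewrite -{1}def1 def2.
  case/mulsgP=> a b Aa Db -> /mulsgP[a' b' Aa' Db' E].
  have [u aE] := axis_elt Aa; have [h bE] := dil_elt Db.
  have [v a'E] := axis2_elt Aa'; have [k b'E] := dil2_elt Db'.
  have ti : a'^-1 * a = 1.
    have [_ _ _ _ tiTL] := sdprod_context (affine_sdprod p).
    apply/set1P; rewrite -set1gE -tiTL inE.
    have -> : a'^-1 * a \in Tr by rewrite groupM ?groupV ?aE ?a'E //; apply/transP; [exists v | exists u].
    have -> : a'^-1 * a = b' * b^-1.
      by apply: (mulgI a'); rewrite mulKVg mulgA -E mulgK.
    by rewrite groupM ?groupV ?bE ?b'E //; apply/linP; [exists k | exists h].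
  have aa' : a = a' by apply: (mulgI a'^-1); rewrite ti mulVg.
  have bb' : b = b' by apply: (mulgI a'); rewrite -E aa'.
  have uv : v = u by apply: (@trans_inj p); rewrite -aE -a'E aa'.
  have hk : k = h by apply: (@lin_inj p); rewrite -bE -b'E bb'.
  move: Aa Aa' Db Db'; rewrite aE a'E bE b'E uv hk axisP axis2P dilP dil2P.
  move=> /eqP u1 /eqP u0 /andP[/isdiagP hE /eqP h1] /andP[_ /eqP h0].
  have -> : u = 0%R by apply: row2P; rewrite ?u0 ?u1 mxE.
  have -> : h = 1.
    by apply: GL_inj; rewrite hE h0 h1; apply: mx2P; rewrite !mx2E mxE.
  by rewrite !morph1 mulg1 inE.
have lC h : isdiag h -> lin h \in Tr <*> lin @* 'C[g].
  move=> dh; rewrite (subsetP (joing_subr _ _)) // mem_morphim ?in_setT //.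
  by rewrite diag_cent1.
have tT u : trans u \in Tr <*> lin @* 'C[g].
  by rewrite (subsetP (joing_subl _ _)) //; apply/transP; exists u.
have inHol1 x : x \in Hol1 -> x \in Hol1 <*> Hol2 by apply/subsetP/joing_subl.
have inHol2 x : x \in Hol2 -> x \in Hol1 <*> Hol2 by apply/subsetP/joing_subr.
rewrite dprodE // -cent_joinEr //; apply/eqP; rewrite eqEsubset !join_subG defJ.
rewrite join_subG -!andbA; apply/and5P; split.
- by apply/subsetP=> _ /axis_elt[u ->].
- by apply/subsetP=> x xD; have [h xE] := dil_elt xD; move: xD; rewrite xE dilP => /andP[/lC].
- by apply/subsetP=> _ /axis2_elt[u ->].
- by apply/subsetP=> x xD; have [h xE] := dil2_elt xD; move: xD; rewrite xE dil2P => /andP[/lC].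
rewrite -defJ -join_subG; apply/subsetP=> x.
suffices sub : Tr <*> lin @* 'C[g] \subset Hol1 <*> Hol2 by apply/subsetP.
rewrite join_subG; apply/andP; split; apply/subsetP=> {}x.
  case/transP=> u ->; rewrite -[u](subrK (u 0 0 *: e0)%R) addrC -zmodMgE.
  rewrite morphM ?in_setT // groupM //.
    by rewrite inHol1 // (subsetP (joing_subl _ _)) // axisP mxE e0E mulr0.
  rewrite inHol2 // defJ (subsetP (joing_subl _ _)) // axis2P mxE mxE mxE e0E mulr1 subrr //.
case/morphimP=> h _; rewrite diag_cent1 // => dh ->.
have h00 := isdiag00 dh.
have h11 : (GLval h 1 1 != 0)%R.
  have := GL_det h; rewrite det2E; move/isdiagP: dh => ->; rewrite !mx2E mul0r subr0 mulf_eq0.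
  by case/norP.
have E1 : GLval (toGL (mx2 (GLval h 0 0) 0 0 1))%R = (mx2 (GLval h 0 0) 0 0 1)%R.
  by rewrite toGLK // unitmxE det2E !mx2E mulr1 mul0r subr0 unitfE.
have E2 : GLval (toGL (mx2 1 0 0 (GLval h 1 1)))%R = (mx2 1 0 0 (GLval h 1 1))%R.
  by rewrite toGLK // unitmxE det2E !mx2E mul1r mul0r subr0 unitfE.
have -> : h = toGL (mx2 (GLval h 0 0) 0 0 1)%R * toGL (mx2 1 0 0 (GLval h 1 1))%R.
  have hM : (GLval h = mx2 (GLval h 0 0) 0 0 1 *m mx2 1 0 0 (GLval h 1 1))%R.
    by apply: etrans (isdiagP _ dh) _; apply: mx2P; rewrite mulmx2E !mx2E; ring.
  exact/GL_mul_eq/(etrans hM)/esym/(f_equal2 mulmx E1 E2).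
rewrite morphM ?in_setT // groupM //.
  by rewrite inHol1 // (subsetP (joing_subr _ _)) // dilP /isdiag E1 !mx2E !eqxx.
by rewrite inHol2 // defJ (subsetP (joing_subr _ _)) // dil2P /isdiag E2 !mx2E !eqxx.
Qed.

End Diagonal.

(** * Normalisers of the diagonal subgroups *)

Lemma sdprod_joinA (gT : finGroupType) (K L A S T : {group gT}) :
  K ><| L = A -> S ><| T = L -> (K <*> S) ><| T = A.
Proof.
move=> defA defL; have [nsKA _ defKL nKL tiKL] := sdprod_context defA.
have [/andP[sSL _] sTL _ nST tiST] := sdprod_context defL.
rewrite -(sdprodWY defA) -(sdprodWY defL) joingA.
apply: sdprodEY; first by rewrite normsY // (subset_trans sTL nKL).
apply/trivgP; rewrite -tiST subsetI subsetIr andbT.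
rewrite /= norm_joinEr ?(subset_trans sSL nKL) //.
rewrite -{1}(setIidPr sTL) setIA.
by rewrite [_ :&: L]setIC -group_modr // [L :&: K]setIC tiKL mul1g subsetIl.
Qed.

Section Diagonal.

Variable p : nat.
Hypothesis p_pr : prime p.

Local Notation lin := (@lin p).
Local Notation Tr := (Tr p).
Local Notation model := (@model p).
Local Notation model_norm := (@model_norm p).
Local Notation swap := (swap p).
Local Notation Hol1 := (Hol1 p).
Local Notation Hol2 := (Hol2 p).
Implicit Types g h n : {'GL_2['F_p]}.

Lemma diag_nonscalarP g : diag_nonscalar (GLval g) ->
  [/\ isdiag g, (GLval g 0 0 != GLval g 1 1)%R, (GLval g 0 0 != 1)%R,
      (GLval g 1 1 != 1)%R & ~~ eigenvalue (GLval g) 1%R].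
Proof.
case=> dg nsg ng.
have idg : isdiag g by apply/andP; split; apply/eqP/(is_diag_mxP dg).
have gE := isdiagP _ idg; split=> //.
- apply: contraNneq nsg => ab; apply/is_scalar_mxP; exists (GLval g 1 1)%R.
  by rewrite gE ab; apply: mx2P; rewrite !mx2E !mxE /=.
- apply: contraNneq ng => a1; apply/eigenvalueP; exists (e0 p).
    rewrite scale1r gE a1; apply: row2P; rewrite mulmx2E !mx2E !e0E; ring.
  by apply/eqP=> /(congr1 (fun u : 'rV_2 => u 0 0)%R)/eqP; rewrite e0E mxE oner_eq0.
apply: contraNneq ng => b1; apply/eigenvalueP; exists (e0 p *m GLval swap)%R.
  by rewrite scale1r gE b1 swapE; apply: row2P; rewrite !mulmx2E !mx2E !e0E; ring.
apply/eqP=> /(congr1 (fun u : 'rV_2 => u 0 1)%R)/eqP.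
by rewrite mulmx2E swapE !mx2E !e0E mulr1 mul0r addr0 mxE oner_eq0.
Qed.

Lemma diag_exp g k : isdiag g ->
  GLval (g ^+ k) = (mx2 (GLval g 0 0 ^+ k) 0 0 (GLval g 1 1 ^+ k))%R.
Proof.
move=> dg; elim: k => [|k IHk].
  by rewrite !expr0; apply: mx2P; rewrite !mx2E !mxE.
rewrite expgSr GL_MxE IHk {3}(isdiagP _ dg).
by apply: mx2P; rewrite !mulmx2E !mx2E ?exprSr; ring.
Qed.

(** [g ^ n] is a power [g ^+ k] with the trace and the determinant of [g], so
its diagonal entries are those of [g], in the same or in the opposite order. *)
Lemma diag_norm g n : isdiag g -> n \in 'N(<[g]>) ->
  g ^ n = g \/ exists k, [/\ (GLval g 0 0 ^+ k = GLval g 1 1)%R,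
    (GLval g 1 1 ^+ k = GLval g 0 0)%R & g ^ n = g ^+ k].
Proof.
move=> dg nn; have: g ^ n \in <[g]> := GL_norm_cycle nn.
case/cycleP=> k gnk; have gkE := diag_exp k dg; have gE := isdiagP _ dg.
set a := (GLval g 0 0)%R in gE gkE *; set b := (GLval g 1 1)%R in gE gkE *.
have gn : (GLval g *m GLval n = GLval n *m GLval (g ^+ k))%R.
  by rewrite -gnk -!GL_MxE -conjgC.
have dk : (a ^+ k * b ^+ k = a * b)%R.
  have := congr1 determinant gn; rewrite !det_mulmx => dn.
  have <- : (\det (GLval (g ^+ k)) = a ^+ k * b ^+ k)%R.
    by rewrite gkE det2E !mx2E mul0r subr0.
  have <- : (\det (GLval g) = a * b)%R by rewrite gE det2E !mx2E mul0r subr0.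
  by apply: (mulfI (GL_det n)); rewrite -dn mulrC.
have tk : (a ^+ k + b ^+ k = a + b)%R.
  have <- : (\tr (GLval (g ^+ k)) = a ^+ k + b ^+ k)%R.
    by rewrite gkE tr2E !mx2E.
  have -> : (GLval (g ^+ k) = GLval n^-1 *m (GLval g *m GLval n))%R.
    by rewrite gn -!GL_MxE mulKg.
  by rewrite mxtrace_mulC -mulmxA -GL_MxE mulgV mulmx1 tr2E.
(* [a ^+ k] is a root of the characteristic polynomial of [g]. *)
have : ((a ^+ k - a) * (a ^+ k - b) = 0)%R.
  have -> : ((a ^+ k - a) * (a ^+ k - b) = a ^+ k * (a ^+ k - (a + b)) + a * b)%R by ring.
  by rewrite -tk -dk; ring.
move/eqP; rewrite mulf_eq0 !subr_eq0 => /orP[/eqP ak | /eqP ak].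
  left; rewrite gnk; apply: GL_inj; rewrite gkE ak gE; congr mx2.
  by apply: (addrI a); rewrite -{1}ak.
right; exists k; split=> //.
by apply: (addrI b); rewrite -{1}ak tk addrC.
Qed.

Lemma cent_norm g : 'C[g] \subset 'N(<[g]>).
Proof. by have := cent_sub <[g]>; rewrite cent_cycle. Qed.

(** If some element of the normaliser exchanges the two eigenvalues, they are
[a] and [a ^+ k] with k^2 = 1 mod q; as [q] is prime and [g] is not scalar,
k = -1 mod q, so the determinant is 1. *)
Lemma norm_D0 q g : prime q -> #[g] = q -> D0_matrix (GLval g) ->
  'N(<[g]>) = 'C[g].
Proof.
move=> q_pr og [/diag_nonscalarP[dg nab a1 b1 _] det_n1].
apply/eqP; rewrite eqEsubset cent_norm andbT; apply/subsetP=> n nn.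
have [gn | [k [ak bk _]]] := diag_norm dg nn.
  by apply/cent1P/commute_sym/commgP/conjg_fixP.
set a := GLval g 0%R 0%R in nab a1 ak bk; set b := GLval g 1%R 1%R in nab b1 ak bk.
have aq : (a ^+ q = 1)%R.
  have := diag_exp q dg; rewrite -og expg_order => /(congr1 (fun M : 'M_2 => M 0 0)%R).
  by rewrite mx2E mxE /= => <-.
have pa := prime_primitive q_pr aq a1.
have k_gt0 : 0 < k by case: (k) ak => // b0; rewrite -b0 expr0 eqxx in b1.
have : (a ^+ (k ^ 2) == a ^+ 1)%R by rewrite expnS expn1 exprM ak bk expr1.
rewrite (eq_prim_root_expr pa) eqn_mod_dvd ?expn_gt0 ?k_gt0 //.
rewrite -{2}(exp1n 2) subn_sqr Euclid_dvdM // => /orP[q1 | q2].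
  have: (a ^+ k == a ^+ 1)%R by rewrite (eq_prim_root_expr pa) eqn_mod_dvd.
  by rewrite ak expr1 eq_sym (negPf nab).
case: det_n1; rewrite det2E (isdiagP _ dg) !mx2E mul0r subr0 -/a -/b -ak -exprS.
by apply/eqP; rewrite -(prim_order_dvd pa) -addn1.
Qed.

Lemma Aut_model_D0 q g : prime q -> coprime p q -> #[g] = q ->
    D0_matrix (GLval g) ->
  Aut (model g) \isog setX (Hol (Zp_group p)) (Hol (Zp_group p)).
Proof.
move=> q_pr co_pq og D0; have [[dM _] [dg nab a1 b1 ng]] := (D0, diag_nonscalarP D0.1).
have cog : coprime p #[g] by rewrite og.
apply: isog_trans (Aut_model p_pr cog ng) _.
have defA : Hol1 \x Hol2 = model_norm g.
  by rewrite (Hol12_dprod dg nab) /= (norm_D0 q_pr og D0).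
apply: (dprod_isog_setX defA); first exact: Hol1_isog.
apply: isog_trans (Hol1_isog p_pr); rewrite isog_sym; exact: conj_isog.
Qed.

(** Exchanging the coordinates inverts a diagonal matrix of determinant 1. *)
Lemma norm_D1 g : D1_matrix (GLval g) ->
  [/\ #[swap] = 2, swap \notin 'C[g] & 'C[g] ><| <[swap]> = 'N(<[g]>)].
Proof.
move=> [/diag_nonscalarP[dg nab a1 b1 _] det1].
have gswap : g ^ swap = g^-1.
  apply: (mulgI g); rewrite mulgV; apply: GL_inj; rewrite GL_MxE swapJ.
  move: det1; rewrite det2E; case/andP: (dg) => /eqP g01 /eqP g10.
  rewrite g01 g10 mul0r subr0 => ab.
  apply: mx2P; rewrite !mulmx2E !mx2E ?g01 ?g10 ?mul0r ?mulr0 ?addr0 ?add0r !mxE //=.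
  by rewrite mulrC.
apply: inverted_norm.
- exact: swap2.
- exact: gswap.
- by rewrite -gswap; apply: contraNneq nab => gs; rewrite {1}gs swapJ mx2E.
move=> n nn; have [-> | [k [ak bk ->]]] := diag_norm dg nn.
  by rewrite eqxx.
apply/orP; right; rewrite -gswap; apply/eqP/GL_inj.
by rewrite diag_exp // swapJ ak bk; case/andP: dg => /eqP-> /eqP->.
Qed.

Lemma model_norm_D1 g : D1_matrix (GLval g) -> is_C2_Hol_Hol p (model_norm g).
Proof.
move=> D1; have [os nCs defN] := norm_D1 D1.
have [/diag_nonscalarP[dg nab a1 b1 _] det1] := D1.
have defB := Hol12_dprod dg nab.
have defK : lin @* 'C[g] ><| <[lin swap]> = lin @* 'N(<[g]>).
  by rewrite -lin_cycle; exact: (injm_sdprod (subsetT _) (injm_lin p) defN).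
have defA : Tr ><| lin @* 'N(<[g]>) = model_norm g.
  by apply: sdprod_sub (affine_sdprod p) _; rewrite morphimS ?subsetT.
exists Hol1, Hol2, (Tr <*> lin @* 'C[g])%G, (lin swap); split=> //.
- exact: sdprod_joinA defA defK.
- by rewrite order_lin.
split; first exact: Hol1_isog.
apply: isog_trans (Hol1_isog p_pr); rewrite isog_sym; exact: conj_isog.
Qed.

End Diagonal.

(** * Isomorphisms between models *)

Lemma matrix_sdprod_isog (p q : nat) (P : 'M['F_p]_2 -> Prop)
    (gT rT : finGroupType) (G : {group gT}) (H : {group rT}) :
  G \isog H -> matrix_sdprod q P G -> matrix_sdprod q P H.
Proof.
case/isogP=> f injf fG [V [x [k [M [defG ox isok kx PM]]]]].
have [/andP[sVG _] sxG _ nVx _] := sdprod_context defG.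
have Gx : x \in G by rewrite -cycle_subG.
have [injk imk] := isomP isok.
have sfV : f @* V \subset f @* G by apply: morphimS.
pose f1 := invm injf.
have f1V w : w \in f @* V -> f1 w \in V.
  by case/morphimP=> v Gv Vv ->; rewrite /f1 invmE.
have kM : {in (f @* V)%G &, {morph (fun w => k (f1 w)) : u v / u * v}}.
  move=> u v Vu Vv /=; rewrite /f1 morphM ?(subsetP sfV) // morphM //; exact: f1V.
exists (f @* V)%G, (f x), (Morphism kM), M; split=> //.
- by rewrite /= -morphim_cycle // (injm_sdprod _ injf defG) // -fG.
- by rewrite (order_injm injf).
- apply/isomP; split.
    apply/injmP=> u v Vu Vv /= /(injmP injk) eq_uv.
    apply: (injmP (injm_invm injf)); rewrite ?(subsetP sfV) //.
    by apply: eq_uv; apply: f1V.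
  apply/setP=> u; rewrite in_setT; apply/morphimP.
  have: u \in k @* V by rewrite imk inE.
  case/morphimP=> v _ Vv ->; have Gv := subsetP sVG _ Vv.
  by exists (f v); rewrite ?mem_morphim //= /f1 invmE.
move=> _ /morphimP[v Gv Vv ->] /=.
by rewrite -morphJ // /f1 !invmE ?groupJ // kx.
Qed.

Section Models.

Variables p q : nat.
Hypotheses (p_pr : prime p) (q_pr : prime q) (neq_pq : p != q).

Local Notation lin := (@lin p).
Local Notation trans := (@trans p).
Local Notation Tr := (Tr p).
Local Notation model := (@model p).
Implicit Types g h k : {'GL_2['F_p]}.

Lemma model_eq_gen g h : #[g] = q -> #[h] = q -> h \in <[g]> ->
  model g \isog model h.
Proof.
move=> og oh hg; apply: (@model_conj _ _ _ 1); rewrite conjsg1.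
by apply/esym/eqP; rewrite eqEcard cycle_subG hg -!orderE og oh leqnn.
Qed.

Lemma GL_exp1 g : #[g] = q -> (GLval g ^+ q = 1)%R.
Proof. by move=> <-; exact: GL_exp_order. Qed.

(** The scalars of order dividing [q] form a cyclic group. *)
Lemma scalar_model_isog g h : #[g] = q -> #[h] = q ->
  scalar_nonid (GLval g) -> scalar_nonid (GLval h) -> model g \isog model h.
Proof.
move=> og oh [/is_scalar_mxP[a ga] a1] [/is_scalar_mxP[b hb] _].
have sX (c : 'F_p) n : ((c%:M : 'M_2) ^+ n = (c ^+ n)%:M)%R.
  by elim: n => [|n IHn] //; rewrite !exprS IHn scalar_mxM.
have s1 (c : 'F_p) (g0 : {'GL_2['F_p]}) : #[g0] = q -> GLval g0 = c%:M%R -> (c ^+ q = 1)%R.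
  move=> og0 g0c; have := GL_exp1 og0; rewrite g0c sX.
  by move/(congr1 (fun M : 'M_2 => M 0 0)%R); rewrite !mxE.
have a_n1 : a != 1%R by apply: contra_not_neq a1 => a1; rewrite ga a1.
have pa := prime_primitive q_pr (s1 _ _ og ga) a_n1.
have [i bE] := prim_rootP pa (s1 _ _ oh hb).
apply: model_eq_gen => //; apply/cycleP; exists i.
by apply: GL_inj; rewrite GL_X ga sX -bE.
Qed.

(** The matrices diag(a, 1 / a) of order dividing [q] form a cyclic group. *)
Lemma D1_model_isog g h : #[g] = q -> #[h] = q ->
  D1_matrix (GLval g) -> D1_matrix (GLval h) -> model g \isog model h.
Proof.
move=> og oh [/diag_nonscalarP[dg nab a1 b1 _] detg] [/diag_nonscalarP[dh ncd c1 d1 _] deth].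
have s1 g0 : #[g0] = q -> isdiag g0 -> (GLval g0 0 0 ^+ q = 1)%R.
  move=> og0 dg0; have := diag_exp q dg0; rewrite -{1}og0 expg_order.
  by move/(congr1 (fun M : 'M_2 => M 0 0)%R); rewrite mx2E mxE /= => <-.
have pa := prime_primitive q_pr (s1 _ og dg) a1.
have [i cE] := prim_rootP pa (s1 _ oh dh).
apply: model_eq_gen => //; apply/cycleP; exists i.
apply: GL_inj; rewrite diag_exp // (isdiagP _ dh) cE; congr mx2.
have nza := isdiag00 dg.
apply: (mulfI (expf_neq0 i nza)); rewrite -exprMn.
move: detg deth; rewrite !det2E; case/andP: dg => /eqP-> _; case/andP: dh => /eqP-> _.
by rewrite !mul0r !subr0 => ab cd; rewrite ab expr1n -cE cd.
Qed.

(** The q-part of p (p - 1)^2 (p + 1) is that of p^2 - 1, so a Sylow q-subgroup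
of GL(2, p) is contained in the cyclic centraliser of any of its elements of
order [q]. Such subgroups being conjugate, so are the subgroups of order [q].
*)
Lemma Singer_model_isog g h : 2 < q -> q %| p.+1 -> #[g] = q -> #[h] = q ->
  model g \isog model h.
Proof.
move=> q_gt2 q_dv og oh.
have oGL : #|'GL_2['F_p]| = (p * p.-1 ^ 2 * p.+1)%N by rewrite card_GL_2 card_Fp.
have sylC g0 : #[g0] = q -> exists Q : {group {'GL_2['F_p]}},
    [/\ q.-Sylow('GL_2['F_p]) Q, cyclic Q & g0 \in Q].
  move=> og0; have [ng _] := noeig_Singer p_pr q_pr q_gt2 q_dv og0.
  have oC : #|'C[g0]| = (p.-1 * p.+1)%N.
    rewrite noeig_cent_card // card_Fp // -subn1 -{2}(exp1n 2) subn_sqr.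
    by rewrite subn1 addn1.
  have [Q sylQ] := Sylow_exists q 'C[g0].
  have abC := noeig_cent_abelian ng.
  exists Q; split.
  - have q'1 : ((p * p.-1)`_q = 1)%N.
      apply: part_p'nat; rewrite p'natE // Euclid_dvdM // negb_or dvdn_prime2 //.
      rewrite eq_sym neq_pq /=; apply/negP=> q_dv'.
      have p2 : (p.+1 - p.-1 = 2)%N.
        by case: (p) (prime_gt0 p_pr) => // r _; rewrite -addn2 addKn.
      have := dvdn_sub q_dv q_dv'; rewrite p2 => /(@dvdn_leq q 2 isT).
      by rewrite leqNgt q_gt2.
    have p1_gt0 : 0 < p.-1 by rewrite -ltnS prednK ?prime_gt0 ?prime_gt1.
    rewrite pHallE subsetT (card_Hall sylQ) oGL oC.
    have -> : (p * p.-1 ^ 2 * p.+1 = p.-1 * p.+1 * (p * p.-1))%N by ring.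
    have c1_gt0 : 0 < p.-1 * p.+1 by rewrite muln_gt0 p1_gt0.
    have c2_gt0 : 0 < p * p.-1 by rewrite muln_gt0 p1_gt0 prime_gt0.
    by rewrite (partnM _ c1_gt0 c2_gt0) q'1 muln1 eqxx.
  - exact: cyclicS (pHall_sub sylQ) (noeig_cent_cyclic ng).
  rewrite (mem_normal_Hall sylQ) ?/p_elt ?og0 ?pnat_id //.
    by rewrite -(sub_abelian_normal _ abC) (pHall_sub sylQ).
  exact/cent1P.
have [Q [sylQ cycQ Qg]] := sylC g og.
have [R [sylR cycR Rh]] := sylC h oh.
have [k _ defR] := Sylow_trans sylQ sylR.
apply: (model_conj (k := k)); apply/eqP.
rewrite -cycleJ (eq_subG_cyclic cycR) ?cycle_subG //.
  by rewrite -!orderE orderJ og oh.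
by rewrite defR memJ_conjg.
Qed.

(** An isomorphism maps the Sylow p-subgroup of translations to itself, hence
induces a linear map there, whose matrix conjugates [g] to the linear part of
the image of [lin g]. *)
Lemma model_isog_conj g h : #[g] = q -> #[h] = q -> model g \isog model h ->
  exists k i, g ^ k = h ^+ i.
Proof.
move=> og oh /isogP[f injf fG].
have coT g0 : #[g0] = q -> 'O_p(model g0) = Tr.
  move=> og0; have [nsT _ _ _ _] := sdprod_context (model_sdprod g0).
  apply: (normal_Hall_pcore _ nsT).
  have iT : #|model g0 : Tr| = q.
    rewrite -divgS ?(normal_sub nsT) //.
    rewrite [X in (X %/ _)%N](card_model p_pr) [X in (_ %/ X)%N](card_Tr p_pr).
    by rewrite og0 mulKn // expn_gt0 prime_gt0.
  rewrite /pHall (normal_sub nsT) iT /pgroup [X in p.-nat X](card_Tr p_pr).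
  by rewrite pnatX pnat_id //= p'natE // dvdn_prime2.
have fT : f @* Tr = Tr.
  by rewrite -{1}(coT g og) injm_pcore // fG coT.
have Gg u : trans u \in model g.
  by rewrite (subsetP (joing_subl _ _)) //; apply/transP; exists u.
have Glg : lin g \in model g by rewrite (subsetP (joing_subr _ _)) ?cycle_id.
have fTr u : f (trans u) \in Tr.
  by rewrite -fT mem_morphim //; apply/transP; exists u.
pose F u := invm (injm_trans p) (f (trans u)).
have FE u : trans (F u) = f (trans u) by rewrite invmK.
have FD : {morph F : u v / (u + v)%R}.
  move=> u v; apply: (@trans_inj p); rewrite FE -!zmodMgE !morphM ?in_setT ?Gg //.
  by rewrite -[RHS]/(trans (F u) * trans (F v)) !FE.
have FM := plane_morph_lin FD; set M := lin1_mx F in FM.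
have Finj : injective F.
  move=> u v eqF; apply: (@trans_inj p); apply: (injmP injf) => //.
  by rewrite -!FE eqF.
have uM : M \in unitmx.
  rewrite unitmxE unitfE; apply/det0P=> [[v nzv vM]]; case/eqP: nzv.
  by apply: Finj; rewrite !FM vM mul0mx.
have : f (lin g) \in model h by rewrite -fG mem_morphim.
have [_ _ <- _ _] := sdprod_context (model_sdprod h).
case/mulsgP=> y _ Ty /cycleP[i ->] flg.
have linX := lin_X h i.
have {}flg : f (lin g) = y * lin (h ^+ i).
  exact: etrans flg (congr1 (mulg y) (esym linX)).
have fixy u : f (trans u) ^ y = f (trans u).
  by apply/conjg_fixP/commgP/(centsP (abelian_Tr p_pr)).
have cy u : f (trans u) ^ f (lin g) = f (trans u) ^ lin (h ^+ i).
  apply: etrans (congr1 (conjg (f (trans u))) flg) _.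
  by apply: etrans (conjgM _ _ _) _; rewrite fixy.
exists (toGL M), i; apply: (mulgI (toGL M)); rewrite -conjgC; apply: GL_inj.
rewrite !GL_MxE toGLK //; apply: row_eqmx => u; rewrite !mulmxA -!FM.
apply: (@trans_inj p); rewrite -(trans_lin (F u)) !FE -cy.
by apply: etrans (morphJ f (Gg u) Glg); rewrite trans_lin.
Qed.

(** g^p = g because q divides p - 1, so the minimal polynomial of [g] divides
X^p - X, which has distinct roots in F_p. *)
Lemma diagonalize g : q %| p.-1 -> #[g] = q -> exists k, isdiag (g ^ k).
Proof.
move=> q_dv og.
have gp : (GLval g ^+ p = GLval g)%R.
  have pE := prednK (prime_gt0 p_pr).
  apply: etrans (congr1 (fun n => GLval g ^+ n)%R (esym pE)) _; rewrite exprS.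
  by have /dvdnP[m ->] := q_dv; rewrite mulnC exprM GL_exp1 // expr1n mulr1.
have /diagonalizableP[P uP dP] : exists2 rs, uniq rs &
    (mxminpoly (GLval g) %| \prod_(x <- rs) ('X - x%:P))%R.
  exists (enum 'F_p); first exact: enum_uniq.
  rewrite big_enum /= -finField_genPoly card_Fp //.
  apply: mxminpoly_min; rewrite rmorphB rmorphXn /= horner_mx_X gp subrr //.
have uP' : invmx P \in unitmx by rewrite unitmx_inv.
exists (toGL (invmx P)); rewrite /isdiag.
have -> : (GLval (g ^ toGL (invmx P)) = P *m GLval g *m invmx P)%R.
  rewrite conjgE !GL_MxE GL_VxE toGLK // invmxK mulmxA //.
have H := elimT (diagonalizable_forP (GLval g) uP) dP.
by rewrite !H ?eqxx.
Qed.

End Models.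

(** * Matrices of order q *)

Section Matrices.

Variables p q : nat.
Hypotheses (p_pr : prime p) (q_pr : prime q) (neq_pq : p != q).

Local Notation model := (@model p).
Implicit Types g h k : {'GL_2['F_p]}.

Lemma Fp_root : q %| p.-1 -> exists2 a : 'F_p, (a ^+ q = 1)%R & a != 1%R.
Proof.
move=> q_dv; have : q %| #|[set: {unit 'F_p}]| by rewrite card_finField_unit card_Fp.
case/(Cauchy q_pr) => u _ ou; exists (FinRing.uval u).
  by rewrite -FinRing.val_unitX -ou expg_order.
apply: contraTneq (prime_gt1 q_pr) => u1; rewrite -ou.
have -> : u = 1 by apply: val_inj.
by rewrite order1.
Qed.

Lemma diag_order (a b : 'F_p) : (a ^+ q = 1)%R -> (b ^+ q = 1)%R -> a != 1%R ->
  exists g, [/\ #[g] = q, isdiag g, (GLval g 0 0 = a)%R & (GLval g 1 1 = b)%R].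
Proof.
move=> aq bq a1; have q_gt0 := prime_gt0 q_pr.
have nz (c : 'F_p) : (c ^+ q = 1 -> c != 0)%R.
  by move=> cq; apply: contraTneq (oner_neq0 'F_p) => c0; rewrite -cq c0 expr0n gtn_eqF ?eqxx.
have gE : GLval (toGL (mx2 a 0 0 b)%R) = (mx2 a 0 0 b)%R.
  by rewrite toGLK // unitmxE det2E !mx2E mul0r subr0 unitfE mulf_neq0 ?nz.
have dg : isdiag (toGL (mx2 a 0 0 b)%R) by rewrite /isdiag gE !mx2E !eqxx.
exists (toGL (mx2 a 0 0 b)%R); rewrite gE !mx2E; split=> //.
apply: nt_prime_order => //.
  apply: GL_inj; rewrite diag_exp // gE !mx2E aq bq.
  by apply: mx2P; rewrite !mx2E !mxE.
apply: contraNneq a1 => g1; have := congr1 (fun M : 'M_2 => M 0 0)%R gE.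
by rewrite g1 mx2E mxE /= => <-.
Qed.

Lemma isdiag_nonscalar g : isdiag g -> (GLval g 0 0 != GLval g 1 1)%R ->
  ~~ eigenvalue (GLval g) 1%R -> diag_nonscalar (GLval g).
Proof.
move=> dg nab ng; split=> //.
  rewrite (isdiagP _ dg); apply/is_diag_mxP=> i j.
  by elim/ord2P: i; elim/ord2P: j; rewrite ?mx2E ?eqxx.
apply: contra nab => /is_scalar_mxP[a ->]; by rewrite !mxE.
Qed.

Lemma isdiag_noeig g : isdiag g -> (GLval g 0 0 != 1)%R -> (GLval g 1 1 != 1)%R ->
  ~~ eigenvalue (GLval g) 1%R.
Proof.
move=> dg a1 b1; rewrite eigenvalue_det (isdiagP _ dg) det2E !mxE /= !mulr1n !mulr0n.
by rewrite subr0 mul0r subr0 mulf_eq0 !subr_eq0 negb_or a1.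
Qed.

Lemma isdiag_scalar g : isdiag g -> (GLval g 0 0 = GLval g 1 1)%R ->
  is_scalar_mx (GLval g).
Proof.
move=> dg ab; apply/is_scalar_mxP; exists (GLval g 1 1)%R.
by rewrite {1}(isdiagP _ dg) ab; apply: mx2P; rewrite !mx2E !mxE.
Qed.

Lemma scalar_exists : q %| p.-1 -> exists2 g : {'GL_2['F_p]}, #[g] = q & scalar_nonid (GLval g).
Proof.
case/Fp_root=> a aq a1; have [g [og dg g00 g11]] := diag_order aq aq a1.
exists g => //; split; first by apply: isdiag_scalar; rewrite ?g00.
by move/(congr1 (fun M : 'M_2 => M 0 0)%R)/eqP; rewrite g00 mxE (negPf a1).
Qed.

(** The matrix is diag(a, a^2), of determinant a^3, for [a] of order [q]. *)
Lemma D0_exists : 3 < q -> q %| p.-1 -> exists2 g : {'GL_2['F_p]}, #[g] = q & D0_matrix (GLval g).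
Proof.
move=> q_gt3 /Fp_root[a aq a1]; have pa := prime_primitive q_pr aq a1.
have a2 : (a ^+ 2 != 1)%R.
  by rewrite -(prim_order_dvd pa) gtnNdvd // ltnW // ltnW.
have a3 : (a ^+ 3 != 1)%R by rewrite -(prim_order_dvd pa) gtnNdvd.
have a2q : ((a ^+ 2) ^+ q = 1)%R by rewrite exprAC aq expr1n.
have [g [og dg g00 g11]] := diag_order aq a2q a1; exists g => //; split.
  apply: isdiag_nonscalar; rewrite ?isdiag_noeig ?g00 ?g11 //.
  apply: contraNneq a1 => aa; have nza : a != 0%R by rewrite -g00 isdiag00.
  by apply/eqP/(mulfI nza); rewrite mulr1 [RHS]aa expr2.
rewrite det2E; case/andP: dg => /eqP-> _; rewrite g00 g11 mul0r subr0 -exprS.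
exact/eqP.
Qed.

Lemma D1_exists : 2 < q -> q %| p.-1 -> exists2 g : {'GL_2['F_p]}, #[g] = q & D1_matrix (GLval g).
Proof.
move=> q_gt2 /Fp_root[a aq a1]; have pa := prime_primitive q_pr aq a1.
have a2 : (a ^+ 2 != 1)%R by rewrite -(prim_order_dvd pa) gtnNdvd.
have aVq : ((a^-1) ^+ q = 1)%R by rewrite exprVn aq invr1.
have aV1 : a^-1%R != 1%R by rewrite -invr1 (inj_eq invr_inj).
have [g [og dg g00 g11]] := diag_order aq aVq a1; exists g => //.
have nza : a != 0%R by rewrite -g00 isdiag00.
split.
  apply: isdiag_nonscalar; rewrite ?isdiag_noeig ?g00 ?g11 //.
  by apply: contraNneq a2 => aa; rewrite expr2 {2}aa mulfV.
by rewrite det2E; case/andP: dg => /eqP-> _; rewrite g00 g11 mul0r subr0 mulfV.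
Qed.

Lemma order_q_Singer g : 2 < q -> q %| p.+1 -> #[g] = q -> Singer_power q (GLval g).
Proof.
move=> q_gt2 q_dv og; have [ng _] := noeig_Singer p_pr q_pr q_gt2 q_dv og.
have [S defC] := cyclicP (noeig_cent_cyclic ng).
have: g \in 'C[g] by apply/cent1P.
rewrite defC => /cycleP[k gS]; exists S, k; split; [| by rewrite -gS | by rewrite -gS].
by rewrite orderE -defC noeig_cent_card // card_Fp.
Qed.

Lemma Singer_exists : 2 < q -> q %| p.+1 ->
  exists2 g : {'GL_2['F_p]}, #[g] = q & Singer_power q (GLval g).
Proof.
move=> q_gt2 q_dv; have : q %| #|'GL_2['F_p]|.
  by rewrite card_GL_2 card_Fp // dvdn_mull.
by case/(Cauchy q_pr) => g _ og; exists g => //; apply: order_q_Singer.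
Qed.

(** In the diagonal case write the eigenvalues as [a] and [a ^+ i] with i < q.
No eigenvalue being 1, i is not 0; for i = 1 the matrix is scalar, and the
determinant is 1 exactly when i = q - 1. So type 8 needs 1 < i < q - 1, that
is, q > 3. *)
Lemma matrix_types g : #[g] = q -> ~~ eigenvalue (GLval g) 1%R ->
    [\/ q %| p.-1 /\ (exists h : {'GL_2['F_p]},
          [/\ #[h] = q, scalar_nonid (GLval h) & model g \isog model h]),
        3 < q /\ q %| p.-1 /\ (exists h : {'GL_2['F_p]},
          [/\ #[h] = q, D0_matrix (GLval h) & model g \isog model h]),
        2 < q /\ q %| p.-1 /\ (exists h : {'GL_2['F_p]},
          [/\ #[h] = q, D1_matrix (GLval h) & model g \isog model h])
      | 2 < q /\ q %| p.+1 /\ Singer_power q (GLval g)].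
Proof.
move=> og ng.
have : q %| #|'GL_2['F_p]| by rewrite -og order_dvdG ?in_setT.
rewrite card_GL_2 card_Fp // !Euclid_dvdM // orbb.
rewrite dvdn_prime2 // eq_sym (negPf neq_pq) /=.
have [q_dv _ | q_ndv /= q_dv] := boolP (q %| p.-1); last first.
  have q_gt2 : 2 < q.
    rewrite ltn_neqAle prime_gt1 // andbT eq_sym.
    apply: contraNneq q_ndv => q2; have := q_dv.
    rewrite q2 !dvdn2; case: (p) (prime_gt0 p_pr) => //= r _.
    by rewrite negbK.
  by constructor 4; split=> //; split=> //; apply: order_q_Singer.
have [k dk] := diagonalize p_pr q_dv og; set h := g ^ k in dk.
have oh : #[h] = q := etrans (orderJ g k) og.
have gh : model g \isog model h by apply: (model_conj (k := k)); rewrite -cycleJ.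
have nh : ~~ eigenvalue (GLval h) 1%R.
  rewrite eigenvalue_det; apply: contra ng => /eqP dh1; rewrite eigenvalue_det.
  have gh' : (GLval g - 1%:M = GLval k *m (GLval h - 1%:M) *m GLval k^-1)%R.
    have kh : k * h = g * k by rewrite /h -conjgC.
    by rewrite mulmxBr mulmxBl mulmx1 -!GL_MxE kh mulgK mulgV.
  by rewrite gh' !det_mulmx dh1 mulr0 mul0r.
have [ab | nab] := eqVneq (GLval h 0 0)%R (GLval h 1 1)%R.
  constructor 1; split=> //; exists h; split=> //; split.
    exact: isdiag_scalar.
  move=> h1; case/eigenvalueP: nh; exists (e0 p).
    by rewrite h1 mulmx1 scale1r.
  apply/eqP=> /(congr1 (fun u : 'rV_2 => u 0 0)%R)/eqP.
  by rewrite e0E mxE oner_eq0.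
have dns := isdiag_nonscalar dk nab nh.
have [_ _ a1 b1 _] := diag_nonscalarP dns.
set a := (GLval h 0 0)%R in nab a1; set b := (GLval h 1 1)%R in nab b1.
have hq := GL_exp1 oh.
have aq : (a ^+ q = 1)%R.
  have := diag_exp q dk; rewrite GL_X hq => /(congr1 (fun M : 'M_2 => M 0 0)%R).
  by rewrite mx2E mxE /= => <-.
have bq : (b ^+ q = 1)%R.
  have := diag_exp q dk; rewrite GL_X hq => /(congr1 (fun M : 'M_2 => M 1 1)%R).
  by rewrite mx2E mxE /= => <-.
have pa := prime_primitive q_pr aq a1; have [i bE] := prim_rootP pa bq.
have i0 : nat_of_ord i != 0%N by apply: contraNneq b1 => i0; rewrite bE i0.
have i1 : nat_of_ord i != 1%N by apply: contraNneq nab => i1; rewrite bE i1.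
have q_gt2 : 2 < q.
  by rewrite (leq_trans _ (ltn_ord i)) // ltnS; case: (nat_of_ord i) i0 i1 => [|[]].
have detE : (\det (GLval h) = a ^+ i.+1)%R.
  by rewrite det2E (isdiagP _ dk) !mx2E mul0r subr0 -/a -/b bE -exprS.
have [d1 | dn1] := eqVneq (\det (GLval h))%R 1%R.
  by constructor 3; do 2!split=> //; exists h.
constructor 2; split; last by split=> //; exists h; split=> //; split=> //; apply/eqP.
rewrite ltn_neqAle q_gt2 andbT; apply: contraNneq dn1 => q3.
rewrite detE -(prim_order_dvd pa).
have := ltn_ord i; move: (nat_of_ord i) i0 i1; rewrite -q3.
by case=> [|[|[|]]].
Qed.

End Matrices.

(** * Groups of order p^2 q have a normal Sylow subgroup *)

Section Classify.

Variables p q : nat.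
Hypotheses (p_pr : prime p) (q_pr : prime q) (neq_pq : p != q).

Let p_gt0 : 0 < p. Proof. exact: prime_gt0. Qed.
Let q_gt0 : 0 < q. Proof. exact: prime_gt0. Qed.
Let p_gt1 : 1 < p. Proof. exact: prime_gt1. Qed.
Let q_gt1 : 1 < q. Proof. exact: prime_gt1. Qed.
Let p2_gt0 : 0 < p ^ 2. Proof. by rewrite expn_gt0 p_gt0. Qed.

Lemma coprime_pq : coprime p q.
Proof. by rewrite prime_coprime // dvdn_prime2. Qed.

Lemma coprime_p2q : coprime (p ^ 2) q.
Proof. by rewrite coprimeXl // coprime_pq. Qed.

(** The first condition gives q < p, the second p < q. *)
Lemma dvd_pred_excl : q %| p.-1 -> p %| q.-1 -> False.
Proof.
have lt m n : prime m -> prime n -> m %| n.-1 -> m < n.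
  move=> m_pr n_pr m_dv; rewrite -(prednK (prime_gt0 n_pr)) ltnS dvdn_leq //.
  by rewrite -ltnS prednK ?prime_gt0 ?prime_gt1.
by move=> /lt lt1 /lt lt2; have := ltn_trans (lt1 q_pr p_pr) (lt2 p_pr q_pr); rewrite ltnn.
Qed.

Lemma dvd_succ_pred_excl : 2 < q -> q %| p.+1 -> q %| p.-1 -> False.
Proof.
move=> q_gt2 d1 d2; have p2 : (p.+1 - p.-1 = 2)%N.
  by case: (p) p_gt0 => // r _; rewrite -addn2 addKn.
by have := dvdn_sub d1 d2; rewrite p2 => /(@dvdn_leq q 2 isT); rewrite leqNgt q_gt2.
Qed.

Variable gT : finGroupType.
Implicit Types G P Q N H A B C : {group gT}.

Lemma psq_abelian P : #|P| = (p ^ 2)%N -> abelian P.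
Proof.
move=> oP; apply: (p2group_abelian (p := p)); first by rewrite /pgroup oP pnatX pnat_id.
by rewrite oP pfactorK.
Qed.

Lemma psq_cyclicVabelem P : #|P| = (p ^ 2)%N -> cyclic P \/ p.-abelem P.
Proof.
move=> oP; have [cycP | ncycP] := boolP (cyclic P); [by left | right].
apply/abelemP=> //; split=> [|x Px]; first exact: psq_abelian.
apply/eqP; rewrite -order_dvdn.
have : #[x] %| p ^ 2 by rewrite -oP order_dvdG.
case/(dvdn_pfactor _ _ p_pr) => i le_i2 ox.
move: le_i2; rewrite leq_eqVlt => /orP[/eqP i2 | lt_i2].
  case/negP: ncycP; apply/cyclicP; exists x; apply/eqP.
  by rewrite eq_sym eqEcard cycle_subG Px -orderE ox i2 oP leqnn.
by rewrite ox -{2}(expn1 p) dvdn_exp2l.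
Qed.

Lemma coprime_sdprodE N H G :
  N <| G -> H \subset G -> coprime #|N| #|H| -> #|G| = (#|N| * #|H|)%N ->
  N ><| H = G.
Proof.
move=> nsNG sHG coNH oG; have sNG := normal_sub nsNG.
rewrite sdprodE ?coprime_TIg ?(subset_trans sHG) ?normal_norm //.
by apply/eqP; rewrite eqEcard mul_subG //= coprime_cardMg // oG leqnn.
Qed.

(** The number of Sylow q-subgroups is p^i with i <= 2. For i = 1, it is 1 mod
q, so q divides p - 1 and the Sylow p-subgroup is normal by [dvd_pred_excl].
For i = 2 the Sylow q-subgroups are self-normalising and meet trivially, so
that exactly p^2 elements of G are not of order q. *)
Lemma sylow_split G : #|G| = (p ^ 2 * q)%N ->
  exists P Q, [/\ #|P| = (p ^ 2)%N, #|Q| = q & P ><| Q = G \/ Q ><| P = G].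
Proof.
move=> oG; have [P sylP] := Sylow_exists p G; have [Q sylQ] := Sylow_exists q G.
have sPG := pHall_sub sylP; have sQG := pHall_sub sylQ.
have oP : #|P| = (p ^ 2)%N.
  rewrite (card_Hall sylP) oG partnM // part_pnat_id ?pnatX ?pnat_id //.
  by rewrite part_p'nat ?muln1 // p'natE // dvdn_prime2.
have oQ : #|Q| = q.
  rewrite (card_Hall sylQ) oG partnM // [X in (_ * X)%N]part_pnat_id ?pnat_id //.
  by rewrite part_p'nat ?mul1n // p'natE // Euclid_dvdX // dvdn_prime2 // andbT eq_sym.
have coPQ : coprime #|P| #|Q| by rewrite oP oQ coprime_p2q.
have coQP : coprime #|Q| #|P| by rewrite coprime_sym.
have [nQ | nnQ] := boolP (Q <| G).
  by exists P, Q; split=> //; right; apply: coprime_sdprodE; rewrite // oG oP oQ mulnC.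
have [nP | nnP] := boolP (P <| G).
  by exists P, Q; split=> //; left; apply: coprime_sdprodE; rewrite // oG oP oQ.
have [i i_le2 iN] : exists2 i, i <= 2 & #|G : 'N_G(Q)| = (p ^ i)%N.
  apply/(dvdn_pfactor _ _ p_pr).
  have -> : (p ^ 2)%N = #|G : Q| by rewrite -divgS // oG oQ mulnK.
  have sQN : Q \subset 'N_G(Q) by rewrite subsetI sQG normG.
  by rewrite -(Lagrange_index (subsetIl G 'N(Q)) sQN) dvdn_mulr.
have modq : p ^ i %% q = 1%N.
  have <- : #|'Syl_q(G)| = (p ^ i)%N by exact: etrans (card_Syl sylQ) iN.
  exact: card_Syl_mod.
have i2 : i = 2.
  case: i i_le2 iN modq => [|[|[|//]]] _ iN modq //.
    case/negP: nnQ; rewrite /normal sQG.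
    by have /eqP := iN; rewrite expn0 indexg_eq1 subsetI subxx.
  case/negP: nnP; rewrite /normal sPG.
  have q_dv : q %| p.-1.
    by rewrite -subn1 -eqn_mod_dvd // -{1}(expn1 p) modq modn_small.
  have modp : #|G : 'N_G(P)| %% p = 1%N by have <- := card_Syl sylP; exact: card_Syl_mod.
  have : #|G : 'N_G(P)| %| q.
    have -> : q = #|G : P| by rewrite -divgS // oG oP mulKn.
    have sPN : P \subset 'N_G(P) by rewrite subsetI sPG normG.
    by rewrite -(Lagrange_index (subsetIl G 'N(P)) sPN) dvdn_mulr.
  case/primeP: (q_pr) => _ min_q /min_q/orP[].
    by rewrite indexg_eq1 subsetI subxx.
  move/eqP=> iP; rewrite iP in modp; case: dvd_pred_excl => //.
  by rewrite -subn1 -eqn_mod_dvd // modp modn_small.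
have oN : #|'N_G(Q)| = q.
  have := Lagrange (subsetIl G 'N(Q)); rewrite iN i2 oG mulnC => /eqP.
  by rewrite eqn_pmul2l // => /eqP.
have defN : 'N_G(Q) = Q.
  by apply/eqP; rewrite eq_sym eqEcard subsetI sQG normG oN oQ leqnn.
have tiQ : normedTI Q^# G Q.
  apply/normedTI_P; split=> [||g Gg].
  - by rewrite setD_eq0 subG1 trivg_card1 oQ gtn_eqF.
  - by rewrite subsetI sQG normD1 normG.
  case/pred0Pn=> x /= /andP[/setD1P[x1 Qx]]; rewrite conjD1g => /setD1P[_ Qgx].
  rewrite -defN inE Gg /=.
  have defQ (R : {group gT}) : #|R| = q -> x \in R -> <[x]> = R.
    move=> oR Rx; apply/eqP; rewrite eqEcard cycle_subG Rx oR.
    have: #[x] %| q by rewrite -oR order_dvdG.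
    case/primeP: (q_pr) => _ min_q /min_q/orP[|/eqP <-]; last by rewrite leqnn.
    by rewrite order_eq1 (negPf x1).
  apply/normP; have <- : <[x]> = Q :^ g by apply: (defQ (Q :^ g)%G); rewrite ?cardJg.
  exact: defQ.
(* [S] is the set of the elements of order q: (q - 1) p^2 of them. *)
pose S := class_support Q^# G.
have oS : #|S| = (q.-1 * p ^ 2)%N.
  rewrite (card_support_normedTI tiQ) -divgS // oG oQ mulnK //.
  by rewrite (cardsD1 1 Q) group1 /= in oQ; rewrite -oQ.
have dS (R : {group gT}) : #|R| = (p ^ 2)%N -> R \subset G -> R \subset G :\: S.
  move=> oR sRG; apply/subsetP=> x Rx; rewrite inE (subsetP sRG) // andbT.
  apply/imset2P=> [[y g /setD1P[y1 Qy] Gg def_x]].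
  have : #[y] %| gcdn (p ^ 2) q.
    by rewrite dvdn_gcd -{1}(orderJ y g) -def_x -oR -oQ !order_dvdG.
  by rewrite (eqP coprime_p2q) dvdn1 order_eq1 (negPf y1).
have oGS : #|G :\: S| = (p ^ 2)%N.
  rewrite cardsD (setIidPr _) ?oS ?oG; last first.
    by rewrite class_support_subG // subDset subsetU // sQG orbT.
  by rewrite -[in X in (_ * X - _)%N](prednK q_gt0) mulnS mulnC addnK.
case/negP: nnP; rewrite /normal sPG; apply/subsetP=> g Gg.
have defP (R : {group gT}) : #|R| = (p ^ 2)%N -> R \subset G -> R = G :\: S :> {set gT}.
  by move=> oR sRG; apply/eqP; rewrite eqEcard dS // oGS oR leqnn.
by rewrite inE {2}(defP P) // -(defP (P :^ g)%G) ?cardJg // conj_subG.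
Qed.

End Classify.

(** * The classification *)

Lemma dprod_card_eq (gT : finGroupType) (A B G : {group gT}) :
  A \subset G -> B \subset G -> B \subset 'C(A) -> A :&: B = 1 ->
  #|G| = (#|A| * #|B|)%N -> A \x B = G.
Proof.
move=> sAG sBG cAB tiAB oG; rewrite dprodE //.
by apply/eqP; rewrite eqEcard mul_subG // oG TI_cardMg ?leqnn.
Qed.

Lemma setX_isog_dprod (gT aT rT : finGroupType) (G : {group gT})
    (C : {group aT}) (D : {group rT}) : G \isog setX C D ->
  exists A B : {group gT}, [/\ A \x B = G, A \isog C & B \isog D].
Proof.
rewrite isog_sym => isoXG.
have /isogP[f injf imf] : (setX_group C D)%G \isog G by [].
have [_ _ _ tiX] := dprodP (setX_dprod C D).
have sC : setX C 1 \subset setX C D by rewrite setXS ?sub1G.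
have sD : setX 1 D \subset setX C D by rewrite setXS ?sub1G.
exists (f @* setX_group C 1)%G, (f @* setX_group 1 D)%G; split.
- by rewrite -imf /=; exact: injm_dprod injf (setX_dprod C D).
- by rewrite isog_sym; apply: isog_trans (isog_setX1 _ _) (sub_isog sC injf).
by rewrite isog_sym; apply: isog_trans (isog_set1X _ _) (sub_isog sD injf).
Qed.

Lemma index_cent_dvd (gT : finGroupType) (N H : {group gT}) :
  H \subset 'N(N) -> #|H : 'C_H(N)| %| #|Aut N|.
Proof.
move=> nNH.
suffices <- : #|conj_aut N @* H| = #|H : 'C_H(N)| by rewrite cardSg ?Aut_conj_aut.
by rewrite card_morphim ker_conj_aut (setIidPr nNH) [in RHS]indexgI.
Qed.

Lemma prime_faithful (gT : finGroupType) (N H : {group gT}) :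
  prime #|H| -> ~~ (H \subset 'C(N)) -> 'C_H(N) = 1.
Proof. by move=> H_pr ncNH; apply: prime_TIg. Qed.

Lemma faithful_dvd (gT : finGroupType) (N H : {group gT}) :
  H \subset 'N(N) -> 'C_H(N) = 1 -> #|H| %| #|Aut N|.
Proof. by move=> nNH ffH; rewrite -(indexg1 H) -ffH index_cent_dvd. Qed.

Lemma card_Aut_prime (gT : finGroupType) (N : {group gT}) n :
  prime n -> #|N| = n -> #|Aut N| = n.-1.
Proof.
by move=> n_pr oN; rewrite card_Aut_cyclic ?prime_cyclic ?oN // totient_prime.
Qed.

Lemma card_Aut_psq (gT : finGroupType) (N : {group gT}) p :
  prime p -> cyclic N -> #|N| = (p ^ 2)%N -> #|Aut N| = (p * p.-1)%N.
Proof.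
by move=> p_pr cN oN; rewrite card_Aut_cyclic // oN totient_pfactor // mulnC.
Qed.

Section Classify.

Variables p q : nat.
Hypotheses (p_pr : prime p) (q_pr : prime q) (neq_pq : p != q).

Let p_gt0 : 0 < p. Proof. exact: prime_gt0. Qed.
Let q_gt0 : 0 < q. Proof. exact: prime_gt0. Qed.
Let p2_gt0 : 0 < p ^ 2. Proof. by rewrite expn_gt0 p_gt0. Qed.

Section OneGroup.

Variable gT : finGroupType.
Implicit Types G P Q N H A B C : {group gT}.

Local Notation classified G := (exists t : p2q_type, has_type p q t G).

Lemma classify_dprod G P Q :
  P \x Q = G -> #|P| = (p ^ 2)%N -> #|Q| = q -> classified G.
Proof.
move=> defG oP oQ; have isoQ : Q \isog Zp q by rewrite isog_Zp_prime ?oQ.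
case: (psq_cyclicVabelem p_pr oP) => [cycP | abP].
  exists Type1; split=> //.
  by apply: (dprod_isog_setX (C := Zp_group _) (D := Zp_group _) defG); rewrite // isog_Zp // cycP oP /=.
exists Type5; split=> //.
apply: (dprod_isog_setX (C := setX_group (Zp_group p) (Zp_group p)) (D := Zp_group _) defG) => //.
by rewrite /= isog_Zp2 // abP oP /=.
Qed.

(** ['C_P(Q)] has order 1, p or p^2. In the first case P embeds in the cyclic
group Aut Q, so P is cyclic and p^2 divides q - 1. In the second case P is
cyclic, or ['C_P(Q)] has a complement [H] in P and splits off as a direct
factor. *)
Lemma classify_normal_q G P Q :
  Q ><| P = G -> #|P| = (p ^ 2)%N -> #|Q| = q -> classified G.
Proof.
move=> defG oP oQ; have [_ _ _ nQP tiQP] := sdprod_context defG.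
have [cQP | ncQP] := boolP (P \subset 'C(Q)).
  apply: (@classify_dprod G P Q) => //; rewrite dprodC.
  by rewrite -defG dprodEsd.
have isoQ : Q \isog Zp q by rewrite isog_Zp_prime ?oQ.
have Q_pr : prime #|Q| by rewrite oQ.
have abP := psq_abelian p_pr oP.
have cQ1 := prime_cent_TI Q_pr ncQP.
have defZ := center_sdprod defG abP cQ1.
have oAQ := card_Aut_prime q_pr oQ.
have ind_dv := index_cent_dvd nQP; rewrite oAQ in ind_dv.
have: #|'C_P(Q)| %| p ^ 2 by rewrite -oP cardSg ?subsetIl.
case/(dvdn_pfactor _ _ p_pr) => [[|[|[|//]]]] _ oC.
- have cycAQ : cyclic (Aut Q) by rewrite Aut_prime_cyclic ?oQ.
  have C1 : 'C_P(Q) = 1 by apply: card1_trivg; rewrite oC.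
  have cycP : cyclic P.
    have injP : 'injm (restrm nQP (conj_aut Q)).
      by rewrite ker_restrm ker_conj_aut C1.
    rewrite -(injm_cyclic injP) ?subxx // im_restrm.
    by apply: cyclicS cycAQ; apply: Aut_conj_aut.
  exists Type3; split=> /=; first by rewrite /= C1 indexg1 oP in ind_dv.
  exists Q, P; split=> //; last by rewrite defZ C1.
  by rewrite isog_Zp // cycP oP /=.
- have pq : p %| q.-1.
    rewrite -[X in X %| _](_ : #|P : 'C_P(Q)| = p) //.
    by rewrite -divgS ?subsetIl // oP oC expn1 mulnK.
  case: (psq_cyclicVabelem p_pr oP) => [cycP | abeP].
    exists Type2; split=> //; exists Q, P; split=> //; last by rewrite defZ.
    by rewrite isog_Zp // cycP oP /=.
  have [H defP] := abelem_split_dprod abeP (subsetIl P 'C(Q)).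
  have [_ defCH cHC tiCH] := dprodP defP.
  have oH : #|H| = p.
    have := dprod_card defP; rewrite oP oC expn1 => /eqP.
    by rewrite eqn_pmul2l // => /eqP.
  have sHP : H \subset P by rewrite -defCH mulG_subr.
  have nQH := subset_trans sHP nQP.
  have tiQH : Q :&: H = 1 by apply/trivgP; rewrite -tiQP setIS.
  have defB : Q ><| H = (Q <*> H)%G by rewrite sdprodEY.
  exists Type11; split=> //.
  exists 'C_P(Q)%G, (Q <*> H)%G, Q, H; split=> //; last by rewrite isog_Zp_prime ?oH.
  - apply: dprod_card_eq.
    + by rewrite subIset // -(sdprodW defG) mulG_subr.
    + rewrite join_subG -(sdprodW defG) mulG_subl.
      by apply: subset_trans sHP (mulG_subr _ _).
    + by rewrite join_subG cHC andbT centsC subsetIr.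
    + apply/trivgP; rewrite -tiCH subsetI subsetIl /=.
      rewrite norm_joinEr //; apply: subset_trans (setSI _ (subsetIl _ _)) _.
      by rewrite -group_modr // setIC tiQP mul1g.
    by rewrite -(sdprod_card defG) -(sdprod_card defB) oQ oP oC oH mulnCA.
  - by rewrite isog_Zp_prime ?oC.
  split=> //; apply: contra ncQP => cQH.
  by rewrite -defCH mul_subG // subsetIr.
have CP : 'C_P(Q) = P by apply/eqP; rewrite eqEcard subsetIl oC oP /=.
by case/negP: ncQP; rewrite -CP subsetIr.
Qed.

Lemma classify_normal_psq_cent G P Q :
    P ><| Q = G -> #|P| = (p ^ 2)%N -> #|Q| = q -> p.-abelem P ->
  'C_P(Q) != 1 -> ~~ (Q \subset 'C(P)) -> classified G.
Proof.
move=> defG oP oQ abeP ntC ncPQ; have [_ _ _ nPQ tiPQ] := sdprod_context defG.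
have coPQ : coprime #|P| #|Q| by rewrite oP oQ coprime_p2q.
have abP := psq_abelian p_pr oP.
have defP := coprime_abel_dprod nPQ coPQ abP; set N := [~: P, Q]%G in defP.
have [_ defNC cNC tiNC] := dprodP defP.
have sNP : N \subset P by rewrite -defNC mulG_subl.
have oC : #|'C_P(Q)| = p.
  have: #|'C_P(Q)| %| p ^ 2 by rewrite -oP cardSg ?subsetIl.
  case/(dvdn_pfactor _ _ p_pr) => [[|[|[|//]]]] _ oC //.
    by case/eqP: ntC; apply: card1_trivg; rewrite oC.
  have CP : 'C_P(Q) = P by apply/eqP; rewrite eqEcard subsetIl oC oP /=.
  by case/negP: ncPQ; rewrite centsC -CP subsetIr.
have oN : #|N| = p.
  have := dprod_card defP; rewrite oP oC mulnC => /eqP.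
  by rewrite eqn_pmul2l // => /eqP.
have ncNQ : ~~ (Q \subset 'C(N)).
  apply: contra ncPQ; rewrite centsC => cQN.
  by rewrite centsC -defNC mul_subG // subsetIr.
have nNQ : Q \subset 'N(N) by rewrite commg_normr.
have tiNQ : N :&: Q = 1 by apply/trivgP; rewrite -tiPQ setSI.
have defB : N ><| Q = (N <*> Q)%G by rewrite sdprodEY.
exists Type6; split=> /=.
  rewrite -(card_Aut_prime p_pr oN) -oQ; apply: faithful_dvd nNQ _.
  by apply: prime_faithful; rewrite ?oQ.
exists 'C_P(Q)%G, (N <*> Q)%G, N, Q; split=> //; rewrite ?isog_Zp_prime ?oC ?oN ?oQ //.
have sPG : P \subset G by rewrite -(sdprodW defG) mulG_subl.
apply: dprod_card_eq.
- by rewrite subIset // sPG.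
- by rewrite join_subG (subset_trans sNP) //= -(sdprodW defG) mulG_subr.
- by rewrite join_subG (centsC Q) subsetIr centsC cNC.
- apply/trivgP; rewrite -tiNC subsetI subsetIl andbT /=.
  rewrite norm_joinEr //; apply: subset_trans (setSI _ (subsetIl _ _)) _.
  by rewrite setIC -group_modl // setIC tiPQ mulg1.
by rewrite -(sdprod_card defG) -(sdprod_card defB) oQ oP oC oN mulnA.
Qed.

(** Carrying conjugation by a generator of [Q] over to the plane gives an
additive map, which is linear. *)
Lemma linear_sdprod G P Q :
    P ><| Q = G -> #|Q| = q -> #|P| = (p ^ 2)%N -> p.-abelem P ->
    'C_P(Q) = 1 -> ~~ (Q \subset 'C(P)) ->
  matrix_sdprod q (fun M : 'M['F_p]_2 => M <> 1%:M%R) G.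
Proof.
move=> defG oQ oP abeP CPQ ncPQ.
have [_ _ _ nPQ tiPQ] := sdprod_context defG.
have /cyclicP[x defQ] : cyclic Q by rewrite prime_cyclic ?oQ.
have Qx : x \in Q by rewrite defQ cycle_id.
have nPx := subsetP nPQ x Qx.
have /isogP[f injf imf] : P \isog [set: 'rV['F_p]_2]%G.
  by rewrite (isog_abelem_card _ abeP) plane_abelem //= card_plane // oP.
pose fi := invm injf.
have fPT u : u \in f @* P by rewrite imf inE.
have fiP u : fi u \in P.
  suffices : fi u \in fi @* (f @* P) by rewrite im_invm.
  by apply: mem_morphim; apply: fPT.
have fiK u : f (fi u) = u by apply: invmK.
pose c u := f (fi u ^ x).
have cD : {morph c : u v / (u + v)%R}.
  have fM : {in P &, {morph f : u v / u * v >-> (u + v)%R}} := morphM f.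
  have fiM u v : fi (u + v)%R = fi u * fi v.
    by apply: (injmP injf); rewrite ?groupM ?fM ?fiK ?fiP.
  by move=> u v; rewrite /c fiM conjMg fM ?memJ_norm ?fiP.
pose M := lin1_mx c; have cM u : c u = (u *m M)%R := plane_morph_lin cD u.
have fJ : {in P, forall v, f (v ^ x) = (f v *m M)%R}.
  by move=> v Pv; rewrite -cM /c /fi invmE.
exists P, x, f, M; split=> //; first by rewrite -defQ.
- by rewrite orderE -defQ.
- by apply/isomP.
move=> M1; case/negP: ncPQ; rewrite defQ cycle_subG; apply/centP=> v Pv.
apply/commute_sym/commgP/conjg_fixP; apply: (injmP injf); rewrite ?memJ_norm //.
by rewrite fJ // M1 mulmx1.
Qed.

(** A vector fixed by [g] is a central translation. *)
Lemma model_eigen1 (g : {'GL_2['F_p]}) :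
  'Z(model g) = 1 -> ~~ eigenvalue (GLval g) 1%R.
Proof.
move=> Z1; apply/negP=> /eigenvalueP[u]; rewrite scale1r => ug nzu.
have Tu : trans u \in Tr p by apply/transP; exists u.
suffices: trans u \in 'Z(model g).
  by rewrite Z1 => /set1gP u1; case/eqP: nzu; apply: trans_inj; rewrite u1 morph1.
rewrite inE -{1}(sdprodW (model_sdprod g)) -[trans u]mulg1 mem_mulg //= mulg1.
rewrite centY inE cent_cycle (subsetP (abelian_Tr p_pr)) //=.
by apply/cent1P/commgP/conjg_fixP; rewrite trans_lin ug.
Qed.

Lemma classify_normal_psq G P Q :
  P ><| Q = G -> #|P| = (p ^ 2)%N -> #|Q| = q -> classified G.
Proof.
move=> defG oP oQ; have [_ _ _ nPQ tiPQ] := sdprod_context defG.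
have [cPQ | ncPQ] := boolP (Q \subset 'C(P)).
  by apply: (@classify_dprod G P Q) => //; rewrite -defG dprodEsd.
have CQP : 'C_Q(P) = 1 by apply: prime_faithful; rewrite ?oQ.
have isoQ : Q \isog Zp q by rewrite isog_Zp_prime ?oQ.
case: (psq_cyclicVabelem p_pr oP) => [cycP | abeP].
  exists Type4; split=> /=; last first.
    by exists P, Q; split=> //; rewrite isog_Zp // cycP oP /=.
  have := faithful_dvd nPQ CQP; rewrite oQ (card_Aut_psq p_pr cycP oP).
  by rewrite Gauss_dvdr // coprime_sym coprime_pq.
have [CPQ | ntC] := eqVneq 'C_P(Q) 1; last exact: classify_normal_psq_cent ntC _.
have mxG := linear_sdprod defG oQ oP abeP CPQ ncPQ.
have [g [_ og isoG]] := matrix_sdprod_model q_pr (fun M h => h) mxG.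
have abQ : abelian Q by rewrite cyclic_abelian // prime_cyclic ?oQ.
have Z1 : 'Z(model g) = 1.
  apply: card1_trivg; have <- := card_isog (isog_center isoG).
  by have := center_sdprod defG abQ CPQ; rewrite CQP /= => ->; rewrite cards1.
have tr (P0 : 'M['F_p]_2 -> Prop) (h : {'GL_2['F_p]}) :
    P0 (GLval h) -> #[h] = q -> G \isog model h -> matrix_sdprod q P0 G.
  move=> Ph oh; rewrite isog_sym => isoh; apply: matrix_sdprod_isog isoh _.
  by rewrite -oh; apply: model_matrix_sdprod.
case: (matrix_types p_pr q_pr neq_pq og (model_eigen1 Z1)).
- case=> qp [h [oh Ph /(isog_trans isoG) isoh]].
  by exists Type7; split=> //; apply: tr Ph oh isoh.
- case=> q3 [qp [h [oh Ph /(isog_trans isoG) isoh]]].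
  by exists Type8; split=> //; apply: tr Ph oh isoh.
- case=> q3 [qp [h [oh Ph /(isog_trans isoG) isoh]]].
  by exists Type9; split=> //; apply: tr Ph oh isoh.
case=> q2 [qp Pg]; exists Type10; split=> //; exact: tr Pg og isoG.
Qed.

Lemma classify G : #|G| = (p ^ 2 * q)%N -> classified G.
Proof.
case/(sylow_split p_pr q_pr neq_pq)=> P [Q [oP oQ [defG | defG]]].
  exact: classify_normal_psq defG oP oQ.
exact: classify_normal_q defG oP oQ.
Qed.

End OneGroup.

End Classify.

(** * Invariants of the types *)

Section Invariants.

Variables p q : nat.
Hypotheses (p_pr : prime p) (q_pr : prime q) (neq_pq : p != q).

Let p_gt0 : 0 < p. Proof. exact: prime_gt0. Qed.
Let q_gt0 : 0 < q. Proof. exact: prime_gt0. Qed.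
Let p_gt1 : 1 < p. Proof. exact: prime_gt1. Qed.
Let p2_gt0 : 0 < p ^ 2. Proof. by rewrite expn_gt0 p_gt0. Qed.

Definition linear_pred t : 'M['F_p]_2 -> Prop :=
  match t with
  | Type7 => @scalar_nonid p
  | Type8 => @D0_matrix p
  | Type9 => @D1_matrix p
  | Type10 => @Singer_power p q
  | _ => fun _ => False
  end.

Definition linear_type t :=
  match t with Type7 | Type8 | Type9 | Type10 => true | _ => false end.

Lemma linear_model t (gT : finGroupType) (G : {group gT}) :
    linear_type t -> has_type p q t G ->
  exists g : {'GL_2['F_p]}, [/\ linear_pred t (GLval g), #[g] = q,
    ~~ eigenvalue (GLval g) 1%R & G \isog model g].
Proof.
move=> lin_t [cond_t shape_t].
have mxG : matrix_sdprod q (linear_pred t) G by case: t lin_t cond_t shape_t.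
have eig1 : ~~ eigenvalue (1%:M : 'M['F_p]_2)%R 1%R -> False.
  case/negP; rewrite eigenvalue_det subrr det0 eqxx; exact: isT.
have nz (M : 'M['F_p]_2) : linear_pred t M -> M <> 1%:M%R.
  case: t lin_t cond_t {shape_t mxG} => // _ cond_t /=.
  - by case.
  - by case=> [[_ _ neig] _] M1; rewrite M1 in neig; apply: eig1.
  - by case=> [[_ _ neig] _] M1; rewrite M1 in neig; apply: eig1.
  case=> S [k [_ oSk ->]] /GL_order1 Sk1.
  by move: (prime_gt1 q_pr); rewrite -oSk Sk1.
have [g [Pg og isoG]] := matrix_sdprod_model q_pr nz mxG.
exists g; split=> //.
case: t lin_t cond_t {shape_t mxG nz} Pg => // _ cond_t /=.
- exact: scalar_noeig1.
- by move=> Pg; have [_ _ _ _ ng] := diag_nonscalarP (proj1 Pg); exact: ng.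
- by move=> Pg; have [_ _ _ _ ng] := diag_nonscalarP (proj1 Pg); exact: ng.
by case: cond_t => q2 qp _; have [ng _] := noeig_Singer p_pr q_pr q2 qp og.
Qed.

Section OneGroup.

Variable gT : finGroupType.
Implicit Types G P Q N H K A B C : {group gT}.

(** By Sylow's theorem a cyclic subgroup of order p^2 would be conjugate to
[P]. *)
Lemma no_psq_elt G P x : P \subset G -> p.-abelem P -> #|P| = (p ^ 2)%N ->
  #|G| = (p ^ 2 * q)%N -> x \in G -> #[x] <> (p ^ 2)%N.
Proof.
move=> sPG abeP oP oG Gx ox.
have sylP : p.-Sylow(G) P.
  rewrite pHallE sPG /= oP oG partnM // part_pnat_id ?pnatX ?pnat_id //.
  by rewrite part_p'nat ?muln1 // p'natE // dvdn_prime2.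
have sxG : <[x]> \subset G by rewrite cycle_subG.
have [|y Gy] := Sylow_Jsub sylP sxG; first by rewrite /pgroup -orderE ox pnatX pnat_id.
rewrite -cycleJ cycle_subG => Pxy.
have [_ exP] := abelemP p_pr abeP.
have : #[x ^ y] %| p by rewrite order_dvdn exP.
by rewrite orderJ ox -[X in _ %| X](expn1 p) dvdn_Pexp2l.
Qed.

Lemma nondirect_prime N H B : nondirect_sdprod N H B -> prime #|N| ->
  prime #|H| -> [/\ 'C_N(H) = 1, 'C_H(N) = 1 & 'Z(B) = 1].
Proof.
move=> [defB ncNH] N_pr H_pr; have CNH := prime_cent_TI N_pr ncNH.
have CHN := prime_faithful H_pr ncNH.
by rewrite (center_sdprod defB) ?CHN ?cyclic_abelian ?prime_cyclic.
Qed.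

(** An index for the order of the centre, read by [center_order]. *)
Definition center_class t :=
  match t with
  | Type1 | Type5 => 2
  | Type2 | Type6 | Type11 => 1%N
  | _ => 0
  end%N.

Definition has_psq t :=
  match t with Type1 | Type2 | Type3 | Type4 => true | _ => false end.

Definition center_order (i : nat) :=
  match i with 0 => 1 | 1 => p | _ => p ^ 2 * q end%N.

Lemma center_order_inj t t' :
  center_order (center_class t) = center_order (center_class t') ->
  center_class t = center_class t'.
Proof.
have p1 : p = 1%N -> False by move=> p1; move: p_gt1; rewrite p1.
have pq1 : (p ^ 2 * q)%N = 1%N -> False.
  by move/eqP; rewrite muln_eq1 -mulnn muln_eq1 => /andP[/andP[/eqP/p1]].
have pqp : (p ^ 2 * q)%N = p -> False.
  move/eqP; rewrite expnS expn1 -mulnA -[X in _ == X]muln1 eqn_pmul2l // muln_eq1.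
  by case/andP=> /eqP/p1.
case: t; case: t' => //= e;
  first [case/p1: e | case/pq1: e | case/pqp: e | move/esym: e => e];
  by first [case/p1: e | case/pq1: e | case/pqp: e].
Qed.
Lemma dprod_order_center P Q G : P \x Q = G -> #|P| = (p ^ 2)%N -> #|Q| = q ->
  [/\ #|G| = (p ^ 2 * q)%N & #|'Z(G)| = (p ^ 2 * q)%N].
Proof.
move=> defG oP oQ; have oG : #|G| = (p ^ 2 * q)%N by rewrite -(dprod_card defG) oP oQ.
split=> //; have [_ <- cPQ _] := dprodP defG.
rewrite (center_idP _); first by rewrite (dprodW defG).
by rewrite abelianM (psq_abelian p_pr oP) cyclic_abelian ?prime_cyclic ?oQ.
Qed.

Lemma dprod_no_psq A B K G : A \x B = G -> #|A| = p -> K \subset B ->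
    #|K| = p -> #|G| = (p ^ 2 * q)%N ->
  forall x, x \in G -> #[x] <> (p ^ 2)%N.
Proof.
move=> defG oA sKB oK oG x Gx; have [_ defAB cAB tiAB] := dprodP defG.
have defP : A \x K = (A <*> K)%G.
  rewrite dprodEY ?(subset_trans sKB) //.
  by apply/trivgP; rewrite -tiAB setIS.
apply: (@no_psq_elt G (A <*> K)%G x) => //.
- by rewrite join_subG -defAB mulG_subl (subset_trans sKB) ?mulG_subr.
- by rewrite (dprod_abelem _ defP) !prime_abelem ?oA ?oK.
by rewrite -(dprod_card defP) oA oK mulnn.
Qed.

Lemma center_dprod_prime A B G : A \x B = G -> prime #|A| -> 'Z(B) = 1 ->
  #|'Z(G)| = #|A|.
Proof.
move=> defG A_pr ZB; rewrite -(dprod_card (center_dprod defG)) ZB cards1 muln1.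
by rewrite (center_idP _) ?cyclic_abelian ?prime_cyclic.
Qed.

End OneGroup.

Lemma has_type_invariants t (gT : finGroupType) (G : {group gT}) : has_type p q t G ->
  [/\ #|G| = (p ^ 2 * q)%N, #|'Z(G)| = center_order (center_class t)
    & if has_psq t then exists2 x, x \in G & #[x] = (p ^ 2)%N
      else forall x, x \in G -> #[x] <> (p ^ 2)%N].
Proof.
have Zpsq (N : {group gT}) : N \isog Zp (p ^ 2) -> cyclic N /\ #|N| = (p ^ 2)%N.
  by rewrite isog_Zp // => /andP[cN /eqP oN].
have psq (N : {group gT}) : cyclic N -> #|N| = (p ^ 2)%N -> N \subset G ->
    exists2 x, x \in G & #[x] = (p ^ 2)%N.
  move=> cN oN sNG; have [||x Nx ox] := @cyclic_has_order _ N (p ^ 2); rewrite ?oN //.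
  by exists x; rewrite ?(subsetP sNG).
have [lin_t /(linear_model lin_t)[g [_ og ng isoG]] | ] := boolP (linear_type t).
  have -> : center_class t = 0 by case: t lin_t.
  have -> : has_psq t = false by case: t lin_t.
  have oM : #|model g| = (p ^ 2 * q)%N by rewrite card_model // og.
  split; first by rewrite (card_isog isoG).
    by rewrite (card_isog (isog_center isoG)) /= (center_model ng) cards1.
  have /isogP[f injf imf] := isoG => x Gx ox.
  have := Tr_isog p_pr; rewrite isog_Zp2 // => /andP[abT /eqP oT].
  apply: (@no_psq_elt _ (model g) (Tr p) (f x)) => //.
  - by rewrite -(sdprodW (model_sdprod g)) mulG_subl.
  - by rewrite -imf mem_morphim.
  by rewrite order_injm.
case: t => //= _ [cond_t shape_t].
- have [A [B [defG /Zpsq[cA oA] isoB]]] := setX_isog_dprod (C := Zp_group _) (D := Zp_group _) shape_t.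
  have oB : #|B| = q by apply/eqP; rewrite -isog_Zp_prime.
  have [oG oZ] := dprod_order_center defG oA oB; split=> //.
  by apply: (psq A); rewrite // -(dprodW defG) mulG_subl.
- have [N [H [defG isoN /Zpsq[cH oH] oZ]]] := shape_t.
  have oN : #|N| = q by apply/eqP; rewrite -isog_Zp_prime.
  split=> //; first by rewrite -(sdprod_card defG) oN oH mulnC.
  by apply: (psq H); rewrite // -(sdprodW defG) mulG_subr.
- have [N [H [defG isoN /Zpsq[cH oH] oZ]]] := shape_t.
  have oN : #|N| = q by apply/eqP; rewrite -isog_Zp_prime.
  split=> //; first by rewrite -(sdprod_card defG) oN oH mulnC.
    by rewrite oZ cards1.
  by apply: (psq H); rewrite // -(sdprodW defG) mulG_subr.
- have [N [H [[defG ncNH] /Zpsq[cN oN] isoH]]] := shape_t.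
  have oH : #|H| = q by apply/eqP; rewrite -isog_Zp_prime.
  split=> //; first by rewrite -(sdprod_card defG) oN oH.
    have coNH : coprime #|N| #|H| by rewrite oN oH coprime_p2q.
    have pN : p.-group N by rewrite /pgroup oN pnatX pnat_id.
    have [_ _ _ nNH _] := sdprod_context defG.
    rewrite (center_sdprod defG) ?(coprime_cyclic_cent_TI pN) //.
      by rewrite (prime_faithful _ ncNH) ?oH // cards1.
    by rewrite cyclic_abelian ?prime_cyclic ?oH.
  by apply: (psq N); rewrite // -(sdprodW defG) mulG_subl.
- have [A [B [defG isoA isoB]]] :=
    setX_isog_dprod (C := setX_group (Zp_group p) (Zp_group p)) (D := Zp_group _) shape_t.
  have oB : #|B| = q by apply/eqP; rewrite -isog_Zp_prime.
  move: isoA; rewrite isog_Zp2 // => /andP[abA /eqP oA].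
  have [oG oZ] := dprod_order_center defG oA oB; split=> //.
  by move=> x; apply: no_psq_elt abA oA oG; rewrite -(dprodW defG) mulG_subl.
- have [A [B [N [H [defG isoA ndB isoN isoH]]]]] := shape_t.
  have oA : #|A| = p by apply/eqP; rewrite -isog_Zp_prime.
  have oN : #|N| = p by apply/eqP; rewrite -isog_Zp_prime.
  have oH : #|H| = q by apply/eqP; rewrite -isog_Zp_prime.
  have [defB _] := ndB; have oG : #|G| = (p ^ 2 * q)%N.
    by rewrite -(dprod_card defG) -(sdprod_card defB) oA oN oH mulnA mulnn.
  have [||_ _ ZB] := nondirect_prime ndB; rewrite ?oN ?oH //.
  split=> //; first by rewrite (center_dprod_prime defG) ?oA.
  by apply: (dprod_no_psq defG oA _ oN oG); rewrite -(sdprodW defB) mulG_subl.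
have [A [B [N [H [defG isoA ndB isoN isoH]]]]] := shape_t.
have oA : #|A| = p by apply/eqP; rewrite -isog_Zp_prime.
have oN : #|N| = q by apply/eqP; rewrite -isog_Zp_prime.
have oH : #|H| = p by apply/eqP; rewrite -isog_Zp_prime.
have [defB _] := ndB; have oG : #|G| = (p ^ 2 * q)%N.
  by rewrite -(dprod_card defG) -(sdprod_card defB) oA oN oH mulnCA mulnC mulnn.
have [||_ _ ZB] := nondirect_prime ndB; rewrite ?oN ?oH //.
split=> //; first by rewrite (center_dprod_prime defG) ?oA.
by apply: (dprod_no_psq defG oA _ oH oG); rewrite -(sdprodW defB) mulG_subr.
Qed.

End Invariants.

(** * Distinct types and isomorphism classes *)

Section Unique.

Variables p q : nat.
Hypotheses (p_pr : prime p) (q_pr : prime q) (neq_pq : p != q).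

Let p_gt0 : 0 < p. Proof. exact: prime_gt0. Qed.
Let q_gt0 : 0 < q. Proof. exact: prime_gt0. Qed.
Let p2_gt0 : 0 < p ^ 2. Proof. by rewrite expn_gt0 p_gt0. Qed.

Lemma model_isog_scalar (g h : {'GL_2['F_p]}) : #[g] = q -> #[h] = q ->
  model g \isog model h -> is_scalar_mx (GLval h) -> is_scalar_mx (GLval g).
Proof.
move=> og oh isog_gh sh.
have [k [i gk]] := model_isog_conj p_pr q_pr neq_pq og oh isog_gh.
have /is_scalar_mxP[b hb] : is_scalar_mx (GLval (h ^+ i)).
  have /is_scalar_mxP[a ha] := sh; apply/is_scalar_mxP; exists (a ^+ i)%R.
  by rewrite GL_X ha -rmorphXn.
have -> : g = (h ^+ i) ^ k^-1 by rewrite -gk conjgK.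
suffices -> : (h ^+ i) ^ k^-1 = h ^+ i by apply/is_scalar_mxP; exists b.
apply/conjg_fixP/commgP/cent1P; rewrite GL_cent1 hb; apply/eqP.
exact: scalar_mxC.
Qed.

Lemma model_isog_det1 (g h : {'GL_2['F_p]}) : #[g] = q -> #[h] = q ->
  model g \isog model h -> (\det (GLval h) = 1 -> \det (GLval g) = 1)%R.
Proof.
move=> og oh isog_gh dh.
have [k [i gk]] := model_isog_conj p_pr q_pr neq_pq og oh isog_gh.
have dhX j : (\det (GLval h ^+ j) = 1)%R.
  by elim: j => [|j IHj]; rewrite ?expr0 ?det1 // exprS -mulmxE det_mulmx dh IHj mulr1.
have : (\det (GLval (g ^ k)) = 1)%R by rewrite gk GL_X dhX.
rewrite conjgE; move: k {gk} => k; have kV : (\det (GLval k^-1) * \det (GLval k) = 1)%R.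
  rewrite -det_mulmx; have -> : (GLval k^-1 *m GLval k = GLval (k^-1 * k))%R by [].
  by rewrite mulVg det1.
have -> : (GLval (k^-1 * (g * k)) = GLval k^-1 *m (GLval g *m GLval k))%R by [].
by rewrite !det_mulmx mulrCA kV mulr1.
Qed.

(** The order of the centre and the presence of an element of order p^2
separate the types except 3 from 4, 6 from 11, and 7, 8, 9, 10 from each other.
The conditions on p and q separate 3 from 4, 6 from 11 and 10 from 7, 8, 9;
being scalar and having determinant 1 are invariant under conjugation and
taking powers, which separates 7, 8 and 9. *)
Lemma type_unique t t' (gT gT' : finGroupType)
    (G : {group gT}) (G' : {group gT'}) :
  has_type p q t G -> has_type p q t' G' -> G \isog G' -> t = t'.
Proof.
move=> tG tG' isoG; have [oG oZ psG] := has_type_invariants p_pr q_pr neq_pq tG.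
have [oG' oZ' psG'] := has_type_invariants p_pr q_pr neq_pq tG'.
have eqZ : center_class t = center_class t'.
  by apply: (center_order_inj p_pr (q := q)); rewrite -oZ -oZ' (card_isog (isog_center isoG)).
have eqS : has_psq t = has_psq t'.
  case/isogP: isoG => f injf imf; case: ifP psG => [_ [x Gx ox] | _ nG].
    by case: ifP psG' => // _ /(_ (f x)); rewrite -imf mem_morphim // order_injm // => /(_ isT).
  case: ifP psG' => // _ [y]; rewrite -imf => /morphimP[x _ Gx ->].
  by rewrite order_injm // => ox; case: (nG x).
have [ct _] := tG; have [ct' _] := tG'.
have psq_q : p ^ 2 %| q.-1 -> p %| q.-1.
  by apply: dvdn_trans; rewrite -{1}(expn1 p) dvdn_exp2l.
have noX : q %| p.-1 -> p %| q.-1 -> False := dvd_pred_excl p_pr q_pr.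
have no10 : 2 < q -> q %| p.+1 -> q %| p.-1 -> False := dvd_succ_pred_excl p_pr.
have noS10 : 3 < q -> 2 < q := @ltnW 3 q.
have lin (T T' : p2q_type) (rT rT' : finGroupType) (H : {group rT}) (H' : {group rT'}) :
    linear_type T -> linear_type T' -> has_type p q T H -> has_type p q T' H' ->
    H \isog H' ->
  exists g h : {'GL_2['F_p]}, [/\ linear_pred q T (GLval g), linear_pred q T' (GLval h),
    (is_scalar_mx (GLval h) -> is_scalar_mx (GLval g)) & (\det (GLval h) = 1 -> \det (GLval g) = 1)%R].
  move=> lT lT' tH tH' isoH.
  have [g [Pg og _ isog]] := linear_model p_pr q_pr lT tH.
  have [h [Ph oh _ isoh]] := linear_model p_pr q_pr lT' tH'.
  have isogh : model g \isog model h.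
    exact: isog_trans (isog_symr isog) (isog_trans isoH isoh).
  by exists g, h; split; rewrite //; [apply: model_isog_scalar | apply: model_isog_det1].
have no7 T (rT rT' : finGroupType) (H : {group rT}) (H' : {group rT'}) :
    T = Type8 \/ T = Type9 -> has_type p q T H -> has_type p q Type7 H' ->
    ~ H \isog H'.
  move=> T89 tH tH' isoH; have lT : linear_type T by case: T89 => ->.
  have [g [h [Pg [sh _] /(_ sh) sg _]]] := lin _ Type7 _ _ _ _ lT isT tH tH' isoH.
  by case: T89 Pg => -> [[_ /negP[]]].
have no8 (rT rT' : finGroupType) (H : {group rT}) (H' : {group rT'}) :
    has_type p q Type8 H -> has_type p q Type9 H' -> ~ H \isog H'.
  move=> tH tH' isoH.
  have [g [h [[_ dg] [_ dh] _ /(_ dh) dg']]] := lin Type8 Type9 _ _ _ _ isT isT tH tH' isoH.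
  exact: dg dg'.
have isoG' := isog_symr isoG; move: ct ct' tG tG' {psG psG' oZ oZ'}.
case: t eqZ eqS => eqZ eqS; case: t' eqZ eqS => //= _ _ ct ct' tG tG'; exfalso.
all: try by [case: noX; auto].
- by apply: no7 tG' tG isoG'; left.
- by apply: no7 tG' tG isoG'; right.
- by case: ct' => q2 qp; case: no10.
- by apply: no7 tG tG' isoG; left.
- exact: no8 tG tG' isoG.
- by case: ct' => q2 qp; case: no10; case: ct.
- by apply: no7 tG tG' isoG; right.
- exact: no8 tG' tG isoG'.
- by case: ct' => q2 qp; case: no10; case: ct.
- by case: ct => q2 qp; case: no10.
- by case: ct => q2 qp; case: no10; case: ct'.
by case: ct => q2 qp; case: no10; case: ct'.
Qed.

Lemma dprod_sdprod_isog (gT gT' : finGroupType) (A B N H G : {group gT})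
    (A' B' N' H' G' : {group gT'}) n m :
    prime n -> prime m ->
    A \x B = G -> A \isog Zp p -> nondirect_sdprod N H B -> N \isog Zp n -> H \isog Zp m ->
    A' \x B' = G' -> A' \isog Zp p -> nondirect_sdprod N' H' B' -> N' \isog Zp n -> H' \isog Zp m ->
  G \isog G'.
Proof.
move=> n_pr m_pr defG isoA ndB isoN isoH defG' isoA' ndB' isoN' isoH'.
have oN : #|N| = n by apply/eqP; rewrite -isog_Zp_prime.
have oH : #|H| = m by apply/eqP; rewrite -isog_Zp_prime.
have oN' : #|N'| = n by apply/eqP; rewrite -isog_Zp_prime.
have oH' : #|H'| = m by apply/eqP; rewrite -isog_Zp_prime.
have [||_ CHN _] := nondirect_prime ndB; rewrite ?oN ?oH //.
have [||_ CHN' _] := nondirect_prime ndB'; rewrite ?oN' ?oH' //.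
have [[defB _] [defB' _]] := (ndB, ndB').
apply: (isog_dprod defG defG'); first exact: isog_trans isoA (isog_symr isoA').
apply: (cyclic_faithful_isog defB defB'); rewrite ?oH ?oH' //.
  exact: isog_trans isoN (isog_symr isoN').
by rewrite Aut_prime_cyclic // oN'.
Qed.

(** If [H] centralised [N], the group would be abelian and equal to its centre.
*)
Lemma nonabelian_center t (gT : finGroupType) (N H G : {group gT}) :
    has_type p q t G -> center_class t != 2 -> N ><| H = G -> #|N| = q ->
    cyclic H ->
  [/\ ~~ (H \subset 'C(N)), 'C_N(H) = 1 & 'Z(G) = 'C_H(N)].
Proof.
move=> tG Zt defG oN cH; have [oG oZ _] := has_type_invariants p_pr q_pr neq_pq tG.
have ncNH : ~~ (H \subset 'C(N)).
  apply: contra Zt => cNH; apply/eqP/(@center_order_inj p q p_pr t Type1).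
  rewrite -oZ /= -oG; congr #|pred_of_set _|; apply/center_idP.
  by rewrite -(sdprodW defG) abelianM cNH (cyclic_abelian cH) cyclic_abelian ?prime_cyclic ?oN.
have CNH : 'C_N(H) = 1 by rewrite prime_cent_TI ?oN.
by split=> //; rewrite (center_sdprod defG) ?cyclic_abelian.
Qed.

Lemma type_isog t (gT gT' : finGroupType) (G : {group gT}) (G' : {group gT'}) :
  t <> Type8 -> has_type p q t G -> has_type p q t G' -> G \isog G'.
Proof.
move=> not8 tG tG'; have [lin_t | ] := boolP (linear_type t).
  have [g [Pg og _ isog]] := linear_model p_pr q_pr lin_t tG.
  have [h [Ph oh _ isoh]] := linear_model p_pr q_pr lin_t tG'.
  apply: isog_trans isog (isog_trans _ (isog_symr isoh)); have [ct _] := tG.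
  case: t lin_t {tG tG'} not8 Pg Ph ct => // _ _ Pg Ph ct.
  - exact: (scalar_model_isog q_pr).
  - exact: (D1_model_isog q_pr).
  by case: ct => q2 qp; apply: (Singer_model_isog p_pr q_pr neq_pq).
have Zpsq (rT : finGroupType) (N : {group rT}) : N \isog Zp (p ^ 2) -> cyclic N /\ #|N| = (p ^ 2)%N.
  by rewrite isog_Zp // => /andP[cN /eqP oN].
have Zq (rT : finGroupType) (N : {group rT}) : N \isog Zp q -> #|N| = q.
  by rewrite isog_Zp_prime // => /eqP.
case: t not8 tG tG' => //= _ tG tG' _; have [[_ sG] [_ sG']] := (tG, tG').
- exact: isog_trans sG (isog_symr sG').
- have [N [H [defG isoN /Zpsq[cH oH] oZ]]] := sG.
  have [N' [H' [defG' isoN' /Zpsq[cH' oH'] oZ']]] := sG'.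
  have [oN oN'] := (Zq _ _ isoN, Zq _ _ isoN').
  have [_ CNH ZC] := nonabelian_center tG isT defG oN cH.
  have [_ CNH' ZC'] := nonabelian_center tG' isT defG' oN' cH'.
  apply: (cyclic_unfaithful_isog p_pr defG defG'); rewrite ?oH ?oH' -?ZC -?ZC' //.
    exact: isog_trans isoN (isog_symr isoN').
  by rewrite Aut_prime_cyclic // oN'.
- have [N [H [defG isoN /Zpsq[cH oH] oZ]]] := sG.
  have [N' [H' [defG' isoN' /Zpsq[cH' oH'] oZ']]] := sG'.
  have [oN oN'] := (Zq _ _ isoN, Zq _ _ isoN').
  have [_ CNH ZC] := nonabelian_center tG isT defG oN cH.
  have [_ CNH' ZC'] := nonabelian_center tG' isT defG' oN' cH'.
  apply: (cyclic_faithful_isog defG defG'); rewrite ?oH ?oH' -?ZC -?ZC' //.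
    exact: isog_trans isoN (isog_symr isoN').
  by rewrite Aut_prime_cyclic // oN'.
- have [N [H [[defG ncNH] isoN isoH]]] := sG.
  have [N' [H' [[defG' ncNH'] isoN' isoH']]] := sG'.
  have [oH oH'] := (Zq _ _ isoH, Zq _ _ isoH').
  have [cN' oN'] := Zpsq _ _ isoN'.
  apply: (cyclic_faithful_isog defG defG'); rewrite ?oH ?oH' //.
  - exact: isog_trans isoN (isog_symr isoN').
  - exact: cyclic_Aut_psq oN'.
  - by apply: prime_faithful; rewrite ?oH.
  by apply: prime_faithful; rewrite ?oH'.
- exact: isog_trans sG (isog_symr sG').
- have [A [B [N [H [defG isoA ndB isoN isoH]]]]] := sG.
  have [A' [B' [N' [H' [defG' isoA' ndB' isoN' isoH']]]]] := sG'.
  exact: (dprod_sdprod_isog p_pr q_pr defG isoA ndB isoN isoH defG' isoA' ndB' isoN' isoH').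
have [A [B [N [H [defG isoA ndB isoN isoH]]]]] := sG.
have [A' [B' [N' [H' [defG' isoA' ndB' isoN' isoH']]]]] := sG'.
exact: (dprod_sdprod_isog q_pr p_pr defG isoA ndB isoN isoH defG' isoA' ndB' isoN' isoH').
Qed.

End Unique.

(** * Existence *)

Section Existence.

Lemma faithful_nondirect (gT : finGroupType) (N H G : {group gT}) :
  N ><| H = G -> 'C_H(N) = 1 -> 1 < #|H| -> nondirect_sdprod N H G.
Proof.
move=> defG CHN H1; split=> //; apply: contraL H1 => cNH.
by rewrite -leqNgt -(setIidPl cNH) CHN cards1.
Qed.

(** The witness is the direct product with C_n. *)
Lemma dprod_with_exists (n : nat) (rT : finGroupType) (N H B : {group rT}) :
    nondirect_sdprod N H B ->
  exists (gT : finGroupType) (G A B' N' H' : {group gT}),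
    [/\ A \x B' = G, A \isog Zp n, nondirect_sdprod N' H' B', N' \isog N & H' \isog H].
Proof.
case=> defB ncNH; pose e := (@pair1g 'Z_n rT).
have isoe (K : {group rT}) : e @* K \isog K.
  by rewrite isog_sym; apply: sub_isog (subsetT K) (injm_pair1g _ _).
exists _, (setX_group (Zp_group n) B), (setX_group (Zp_group n) 1), (e @* B)%G, (e @* N)%G, (e @* H)%G.
split=> //; rewrite ?isoe //.
- by rewrite /= morphim_pair1g; apply: setX_dprod.
- by rewrite isog_sym; apply: isog_setX1.
split.
  exact: injm_sdprod (subsetT B) (injm_pair1g _ _) defB.
apply: contra ncNH => /centsP cHN; apply/centsP=> h Hh n0 Nn.
suffices: commute (e h) (e n0) by case.
by apply: cHN; apply: mem_morphim; rewrite ?inE.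
Qed.

Variables p q : nat.
Hypotheses (p_pr : prime p) (q_pr : prime q) (neq_pq : p != q).

Let p_gt0 : 0 < p. Proof. exact: prime_gt0. Qed.
Let q_gt0 : 0 < q. Proof. exact: prime_gt0. Qed.
Let p2_gt0 : 0 < p ^ 2. Proof. by rewrite expn_gt0 p_gt0. Qed.

Lemma faithful_sdprod_exists n d : prime n -> 1 < d -> d %| n.-1 ->
  exists (gT : finGroupType) (G N H : {group gT}),
    [/\ N ><| H = G, N \isog Zp n, cyclic H, #|H| = d & 'C_H(N) = 1].
Proof.
move=> n_pr d_gt1 dn; have oN : #|Zp n| = n by rewrite card_Zp ?prime_gt0.
have [||gT [N [H [defG isoN cH oH CHN]]]] := @cyclic_sdprod_exists _ (Zp_group n) d.
- by rewrite Aut_prime_cyclic //= oN.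
- by rewrite (card_Aut_prime n_pr).
by exists gT, (N <*> H)%G, N, H.
Qed.

Lemma type_exists t : type_cond p q t ->
  exists (gT : finGroupType) (G : {group gT}), has_type p q t G.
Proof.
have lin T (g : {'GL_2['F_p]}) : type_cond p q T -> linear_type T -> #[g] = q ->
    linear_pred q T (GLval g) -> has_type p q T (model g).
  move=> cT lT og Pg; split=> //.
  have := model_matrix_sdprod Pg; rewrite og; by case: T lT {cT Pg}.
have prod n m : prime n -> prime m -> m %| n.-1 ->
    exists (gT : finGroupType) (G A B N H : {group gT}),
    [/\ A \x B = G, A \isog Zp p, nondirect_sdprod N H B, N \isog Zp n & H \isog Zp m].
  move=> n_pr m_pr mn.
  have [rT [B [N [H [defB isoN _ oH CHN]]]]] := faithful_sdprod_exists n_pr (prime_gt1 m_pr) mn.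
  have ndB : nondirect_sdprod N H B by apply: faithful_nondirect; rewrite // oH prime_gt1.
  have [gT [G [A [B' [N' [H' [defG isoA ndB' isoN' isoH']]]]]]] := dprod_with_exists p ndB.
  exists gT, G, A, B', N', H'; split=> //; first exact: isog_trans isoN' isoN.
  by apply: isog_trans isoH' _; rewrite isog_Zp_prime // oH.
case: t => /= ct.
- by exists _, (setX_group (Zp_group (p ^ 2)) (Zp_group q)); split=> //; apply: isog_refl.
- have [rT [B [N [H [defB isoN _ oH CHN]]]]] := faithful_sdprod_exists q_pr (prime_gt1 p_pr) ct.
  have oN : #|N| = q by apply/eqP; rewrite -isog_Zp_prime.
  have [_ ncNH] : nondirect_sdprod N H B by apply: faithful_nondirect; rewrite // oH prime_gt1.
  have CNH : 'C_N(H) = 1 by rewrite prime_cent_TI ?oN.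
  have [gT [N1 [H1 [defG isoN1 cH1 oH1 oZ]]]] := fibre_sdprod_exists p_pr defB oH CHN CNH.
  exists gT, (N1 <*> H1)%G; split=> //; exists N1, H1; split=> //.
    exact: isog_trans isoN1 isoN.
  by rewrite isog_Zp // cH1 oH1 /=.
- have p2_gt1 : 1 < p ^ 2 by rewrite -(exp1n 2) ltn_exp2r ?prime_gt1.
  have [rT [B [N [H [defB isoN cH oH CHN]]]]] := faithful_sdprod_exists q_pr p2_gt1 ct.
  have oN : #|N| = q by apply/eqP; rewrite -isog_Zp_prime.
  have [_ ncNH] : nondirect_sdprod N H B by apply: faithful_nondirect; rewrite // oH.
  exists rT, B; split=> //; exists N, H; split=> //; first by rewrite isog_Zp // cH oH /=.
  by rewrite (center_sdprod defB) ?cyclic_abelian // prime_cent_TI ?oN.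
- have oP : #|Zp (p ^ 2)| = (p ^ 2)%N by rewrite card_Zp.
  have cP : cyclic (Zp (p ^ 2)) := Zp_cyclic _.
  have [||gT [N [H [defG isoN cH oH CHN]]]] := @cyclic_sdprod_exists _ (Zp_group (p ^ 2)) q.
  - exact: (cyclic_Aut_psq p_pr).
  - by rewrite (card_Aut_psq p_pr) // dvdn_mull.
  exists gT, (N <*> H)%G; split=> //; exists N, H; split=> //.
    by apply: faithful_nondirect; rewrite // oH prime_gt1.
  by rewrite isog_Zp_prime // oH.
- by exists _, (setX_group (setX_group (Zp_group p) (Zp_group p)) (Zp_group q)); split=> //; apply: isog_refl.
- have [gT [G [A [B [N [H data]]]]]] := prod p q p_pr q_pr ct.
  by exists gT, G; split=> //; exists A, B, N, H.
- by have [g og sg] := scalar_exists p_pr q_pr ct; exists _, (model g); apply: (lin Type7).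
- have [q3 qp] := ct; have [g og sg] := D0_exists p_pr q_pr q3 qp.
  by exists _, (model g); apply: (lin Type8).
- have [q3 qp] := ct; have [g og sg] := D1_exists p_pr q_pr q3 qp.
  by exists _, (model g); apply: (lin Type9).
- have [q3 qp] := ct; have [g og sg] := Singer_exists p_pr q_pr q3 qp.
  by exists _, (model g); apply: (lin Type10).
have [gT [G [A [B [N [H data]]]]]] := prod q p q_pr p_pr ct.
by exists gT, G; split=> //; exists A, B, N, H.
Qed.

End Existence.

(** * Automorphism groups *)

(** An element of [G] whose n-th power is trivial has a trivial component in
[A], so [B] is generated by all such elements of [G]. *)
Lemma dprod_exp_char (gT : finGroupType) (A B G : {group gT}) n :
    A \x B = G -> coprime #|A| n -> B \subset <<[set x in B | x ^+ n == 1]>> ->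
  B \char G.
Proof.
move=> defG coAn genB; have [_ defAB cAB tiAB] := dprodP defG.
have sBG : B \subset G by rewrite -defAB mulG_subr.
have inB x : x \in G -> x ^+ n = 1 -> x \in B.
  rewrite -defAB => /mulsgP[a b Aa Bb ->] abn.
  suffices -> : a = 1 by rewrite mul1g.
  have cab : commute a b by apply/commute_sym/(centsP cAB).
  have /set1gP an1 : a ^+ n \in [1].
    rewrite -tiAB inE groupX //= -[a ^+ n]invgK groupV.
    by move: abn; rewrite expgMn // => /eqP; rewrite -eq_invg_mul => /eqP->; rewrite groupX.
  apply/eqP; rewrite -order_eq1 -dvdn1 -(eqP coAn) dvdn_gcd order_dvdG //=.
  by rewrite order_dvdn an1.
apply/charP; split=> // f injf imf.
apply/eqP; rewrite eqEcard card_injm // leqnn andbT.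
apply: subset_trans (morphimS f genB) _.
have sSG : [set x in B | x ^+ n == 1] \subset G.
  by apply: subset_trans sBG; apply/subsetP=> x; rewrite inE => /andP[].
rewrite morphim_gen // gen_subG; apply/subsetP=> _ /morphimP[x Gx Sx ->].
have /andP[Bx /eqP xn] : (x \in B) && (x ^+ n == 1) by rewrite inE in Sx.
have Gfx : f x \in f @* G by apply: mem_morphim.
apply: inB; first by rewrite imf in Gfx.
by rewrite -morphX // xn morph1.
Qed.

Lemma Aut_sdprod_cyclic_Hol (gT rT : finGroupType) (V Q G : {group gT})
    (W : {group rT}) :
    V ><| Q = G -> abelian V -> cyclic (Aut V) -> coprime #|V| #|Q| ->
    'C_Q(V) = 1 -> 'C_V(Q) = 1 -> V \isog W ->
  Aut G \isog Hol W.
Proof.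
move=> defG abV cAV coVQ CQV CVQ isoV.
apply: isog_trans (Hol_isog isoV); apply: Aut_sdprod_Hol (defG) _ _ _ _ _ => //.
apply: abelian_Aut_act; last exact: cyclic_abelian.
by have [] := sdprod_context defG.
Qed.

Section AutTypes.

Variables p q : nat.
Hypotheses (p_pr : prime p) (q_pr : prime q) (neq_pq : p != q).

Let p_gt0 : 0 < p. Proof. exact: prime_gt0. Qed.
Let q_gt0 : 0 < q. Proof. exact: prime_gt0. Qed.
Let p2_gt0 : 0 < p ^ 2. Proof. by rewrite expn_gt0 p_gt0. Qed.

Lemma Aut_prime_isog (gT : finGroupType) (N : {group gT}) n :
  prime n -> #|N| = n -> Aut N \isog Zp n.-1.
Proof.
move=> n_pr oN; rewrite isog_Zp ?Aut_prime_cyclic ?oN //=.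
  by rewrite (card_Aut_prime n_pr).
by rewrite -ltnS prednK ?prime_gt1 ?prime_gt0.
Qed.

Lemma Aut_psq_isog (gT : finGroupType) (N : {group gT}) :
  cyclic N -> #|N| = (p ^ 2)%N -> Aut N \isog setX (Zp p) (Zp p.-1).
Proof.
move=> cN oN; have p1_gt0 : 0 < p.-1 by rewrite -ltnS prednK ?prime_gt1.
have co : coprime p p.-1.
  by rewrite -[X in coprime X _](prednK p_gt0) coprimeSn.
have cX : cyclic (setX_group (Zp_group p) (Zp_group p.-1)).
  rewrite (cyclic_dprod (setX_dprod _ _)) ?cardsX ?cards1 ?mul1n ?muln1 ?card_Zp //.
    by rewrite -(isog_cyclic (isog_setX1 _ _)) Zp_cyclic.
  by rewrite -(isog_cyclic (isog_set1X _ _)) Zp_cyclic.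
rewrite -[setX _ _]/(gval (setX_group (Zp_group p) (Zp_group p.-1))).
rewrite isog_sym (isog_cyclic_card _ cX) (cyclic_Aut_psq p_pr) //=.
by rewrite (card_Aut_psq p_pr) // cardsX !card_Zp.
Qed.

(** The automorphism group of the plane is that of its copy [Tr] in the affine
group, on which [Li] acts faithfully and fully. *)
Lemma Aut_plane_isog (gT : finGroupType) (V : {group gT}) :
  V \isog setX (Zp p) (Zp p) -> Aut V \isog 'GL_2(p).
Proof.
move=> isoV; have isoT := isog_trans isoV (isog_symr (Tr_isog p_pr)).
apply: isog_trans (isog_Aut isoT) _.
have [_ _ _ nTL _] := sdprod_context (affine_sdprod p).
have imL : conj_aut (Tr p) @* Li p = Aut (Tr p).
  apply/eqP; rewrite eqEcard Aut_conj_aut card_conj_aut ?affine_full //.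
  exact: affine_faithful.
apply: (@isog_trans _ _ _ _ (Li p)); last first.
  by rewrite isog_sym; apply: sub_isog (subxx _) (injm_lin p).
have injL : 'injm (restrm nTL (conj_aut (Tr p))).
  by rewrite ker_restrm ker_conj_aut affine_faithful.
rewrite isog_sym; have := sub_isog (subxx _) injL.
by rewrite morphim_restrm setIid imL.
Qed.

Lemma Aut_coprime_dprod (gT aT rT : finGroupType) (A B G : {group gT})
    (C : {group aT}) (D : {group rT}) :
    A \x B = G -> coprime #|A| #|B| -> Aut A \isog C -> Aut B \isog D ->
  Aut G \isog setX C D.
Proof.
move=> defG coAB isoA isoB.
have chA : A \char G by apply: coprime_sdprod_char (dprodWsd defG) coAB.
have chB : B \char G.
  by apply: coprime_sdprod_char (dprodWsdC defG) _; rewrite coprime_sym.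
exact: isog_trans (Aut_dprod defG chA chB) (setX_isog isoA isoB).
Qed.

(** The direct factor [A] is the centre of [G]. The factor [B] is
characteristic too, since it is generated by its elements of order [q]: [H]
consists of such elements, and [N = [~: N, H]] of products of conjugates of
them. *)
Lemma Aut_dprod_Frobenius (gT : finGroupType) (A B N H G : {group gT}) :
    A \x B = G -> #|A| = p -> nondirect_sdprod N H B -> #|N| = p -> #|H| = q ->
  Aut G \isog setX (Zp p.-1) (Hol (Zp_group p)).
Proof.
move=> defG oA ndB oN oH; have [defB _] := ndB.
have [_ _ _ nNH _] := sdprod_context defB.
have [||CNH CHN ZB] := nondirect_prime ndB; rewrite ?oN ?oH //.
have coNH : coprime #|N| #|H| by rewrite oN oH coprime_pq.
have abN : abelian N by rewrite cyclic_abelian ?prime_cyclic ?oN.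
have defZ : 'Z(G) = A.
  have := center_dprod defG; rewrite ZB dprodg1 => <-.
  by apply/center_idP; rewrite cyclic_abelian ?prime_cyclic ?oA.
have chA : A \char G by rewrite -defZ center_char.
pose S := [set x in B | x ^+ q == 1]; pose K := <<S>>%G.
have sHK : H \subset K.
  apply/subsetP=> h Hh; apply: mem_gen; rewrite inE -(sdprodW defB) (subsetP (mulG_subr _ _)) //=.
  by rewrite -oH expg_cardG.
have sNB : N \subset B by rewrite -(sdprodW defB) mulG_subl.
have sHB : H \subset B by rewrite -(sdprodW defB) mulG_subr.
have sNK : N \subset K.
  have := coprime_abel_dprod nNH coNH abN; rewrite CNH dprodg1 => <-.
  rewrite gen_subG; apply/subsetP=> _ /imset2P[n0 h Nn Hh ->].
  rewrite commgEr; apply: groupM; last exact: (subsetP sHK).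
  apply: mem_gen.
  rewrite inE -conjXg -[X in _ ^+ X]oH expgVn expg_cardG // invg1 conj1g eqxx andbT.
  by rewrite groupJ ?groupV ?(subsetP sHB h) ?(subsetP sNB n0).
have chB : B \char G.
  apply: (@dprod_exp_char _ A B G q) => //; first by rewrite oA coprime_pq.
  by rewrite -{1}(sdprodW defB) mul_subG.
apply: isog_trans (Aut_dprod defG chA chB) _.
apply: (setX_isog (C := Zp_group _)); first exact: Aut_prime_isog.
apply: (Aut_sdprod_cyclic_Hol defB) => //.
  by rewrite Aut_prime_cyclic ?oN.
by rewrite isog_Zp_prime ?oN.
Qed.

Lemma Aut_normal_q (gT aT : finGroupType) (N P G : {group gT}) (W : {group aT}) :
    N ><| P = G -> #|N| = q -> #|P| = (p ^ 2)%N -> 'C_N(P) = 1 ->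
    act_Aut N P \isog W ->
  Aut G \isog setX W (Hol (Zp_group q)).
Proof.
move=> defG oN oP CNP isoL; have cN : cyclic N by rewrite prime_cyclic ?oN.
have coNP : coprime #|N| #|P| by rewrite oN oP coprime_sym coprime_p2q.
have cAN : cyclic (Aut N) by rewrite Aut_prime_cyclic ?oN.
have isoG := Aut_sdprod_unfaithful defG coNP (cyclic_abelian cN)
  (cyclic_abelian cAN) CNP (act_AutP N P).
apply: isog_trans isoG _; apply: setX_isog isoL _.
by apply: Hol_isog; rewrite isog_Zp_prime ?oN.
Qed.

Lemma has_type_Aut t (gT : finGroupType) (G : {group gT}) :
  has_type p q t G -> type_Aut p q t (Aut_group G).
Proof.
move=> tG; have Zpsq (N : {group gT}) : N \isog Zp (p ^ 2) -> cyclic N /\ #|N| = (p ^ 2)%N.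
  by rewrite isog_Zp // => /andP[cN /eqP oN].
have oZ n (N : {group gT}) : prime n -> N \isog Zp n -> #|N| = n.
  by move=> n_pr; rewrite isog_Zp_prime // => /eqP.
have [lin_t | ] := boolP (linear_type t).
  have [g [Pg og ng isog]] := linear_model p_pr q_pr lin_t tG.
  have cog : coprime p #[g] by rewrite og coprime_pq.
  have isoA := isog_Aut isog; have isoN := isog_trans isoA (Aut_model p_pr cog ng).
  have [ct _] := tG; case: t lin_t {tG} Pg ct => // _ Pg ct.
  - exact: isog_trans isoA (Aut_model_scalar p_pr cog Pg).
  - exact: isog_trans isoA (Aut_model_D0 p_pr q_pr (coprime_pq p_pr q_pr neq_pq) og Pg).
  - exact: isog_C2_Hol_Hol (isog_symr isoN) (model_norm_D1 p_pr Pg).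
  have [q2 qp] := ct; have [nog dg] := noeig_Singer p_pr q_pr q2 qp og.
  exact: isog_C2_Singer (isog_symr isoN) (model_norm_Singer p_pr nog dg).
case: t tG => //= tG _; have [_ sG] := tG.
- have [A [B [defG isoA isoB]]] := setX_isog_dprod (C := Zp_group _) (D := Zp_group _) sG.
  have [cA oA] := Zpsq _ isoA; have oB := oZ _ _ q_pr isoB.
  apply: (Aut_coprime_dprod (C := setX_group (Zp_group p) (Zp_group p.-1)) (D := Zp_group _) defG).
  - by rewrite oA oB coprime_p2q.
  - exact: Aut_psq_isog.
  exact: Aut_prime_isog.
- have [N [P [defG isoN isoP oZG]]] := sG.
  have [cP oP] := Zpsq _ isoP; have oN := oZ _ _ q_pr isoN.
  have [_ CNP ZC] := nonabelian_center p_pr q_pr neq_pq tG isT defG oN cP.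
  apply: (Aut_normal_q (W := Zp_group p) defG) => //.
  have [_ _ _ nNP _] := sdprod_context defG.
  by apply: (act_Aut_cyclic p_pr); rewrite // -ZC.
- have [N [P [defG isoN isoP oZG]]] := sG.
  have [cP oP] := Zpsq _ isoP; have oN := oZ _ _ q_pr isoN.
  have [_ CNP ZC] := nonabelian_center p_pr q_pr neq_pq tG isT defG oN cP.
  have cN : cyclic N by rewrite prime_cyclic ?oN.
  apply: (Aut_sdprod_cyclic_Hol defG) => //; rewrite -?ZC //.
  - exact: cyclic_abelian.
  - by rewrite Aut_prime_cyclic ?oN.
  by rewrite oN oP coprime_sym coprime_p2q.
- have [P [Q [[defG ncPQ] isoP isoQ]]] := sG.
  have [cP oP] := Zpsq _ isoP; have oQ := oZ _ _ q_pr isoQ.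
  have [_ _ _ nPQ _] := sdprod_context defG.
  have coPQ : coprime #|P| #|Q| by rewrite oP oQ coprime_p2q.
  have pP : p.-group P by rewrite /pgroup oP pnatX pnat_id.
  apply: (Aut_sdprod_cyclic_Hol defG) => //.
  - exact: cyclic_abelian.
  - exact: (cyclic_Aut_psq p_pr).
  - by apply: prime_faithful; rewrite ?oQ.
  exact: (coprime_cyclic_cent_TI pP).
- have [A [B [defG isoA isoB]]] :=
    setX_isog_dprod (C := setX_group (Zp_group p) (Zp_group p)) (D := Zp_group _) sG.
  have oB := oZ _ _ q_pr isoB.
  have oA : #|A| = (p ^ 2)%N by move: isoA; rewrite isog_Zp2 // => /andP[_ /eqP].
  apply: (Aut_coprime_dprod (C := 'GL_2(p)%G) (D := Zp_group _) defG).
  - by rewrite oA oB coprime_p2q.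
  - exact: Aut_plane_isog.
  exact: Aut_prime_isog.
- have [A [B [N [H [defG isoA ndB isoN isoH]]]]] := sG.
  apply: (Aut_dprod_Frobenius defG _ ndB); exact: oZ.
have [A [B [N [H [defG isoA ndB isoN isoH]]]]] := sG.
have [[oA oN] oH] := (oZ _ _ p_pr isoA, oZ _ _ q_pr isoN, oZ _ _ p_pr isoH).
have [||CNH CHN ZB] := nondirect_prime ndB; rewrite ?oN ?oH //.
have [defB _] := ndB; have [_ defAB cAB tiAB] := dprodP defG.
have sNB : N \subset B by rewrite -(sdprodW defB) mulG_subl.
have sHB : H \subset B by rewrite -(sdprodW defB) mulG_subr.
have [_ _ _ nNH tiNH] := sdprod_context defB.
have defP : A \x H = (A <*> H)%G.
  by rewrite dprodEY ?(subset_trans sHB) //; apply/trivgP; rewrite -tiAB setIS.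
have oP : #|A <*> H| = (p ^ 2)%N by rewrite -(dprod_card defP) oA oH mulnn.
have cAN : A \subset 'C(N) by rewrite centsC (subset_trans sNB).
have nNP : A <*> H \subset 'N(N) by rewrite join_subG (subset_trans cAN) ?cent_sub.
have CPN : 'C_(A <*> H)(N) = A.
  by rewrite -(dprodW defP) -group_modl // CHN mulg1.
have defG2 : N ><| (A <*> H)%G = G.
  apply: coprime_sdprodE.
  - rewrite /normal (subset_trans sNB) -?defAB ?mulG_subr //=.
    rewrite mul_subG ?(subset_trans cAN) ?cent_sub //.
    by rewrite -(sdprodW defB) mul_subG ?normG.
  - by rewrite join_subG -defAB mulG_subl (subset_trans sHB) ?mulG_subr.
  - by rewrite oP oN coprime_sym coprime_p2q.
  by rewrite -(dprod_card defG) -(sdprod_card defB) oP oA oN oH mulnCA mulnn.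
apply: (Aut_normal_q defG2) => //.
  by apply/trivgP; rewrite -CNH setIS // centS // joing_subr.
exact: (act_Aut_dprod p_pr nNP defP).
Qed.

End AutTypes.

Theorem mainTheorem1 (p q : nat) (p_pr : prime p) (q_pr : prime q)
    (neq_pq : p != q) :
  [/\ (forall (gT : finGroupType) (G : {group gT}),
         #|G| = (p ^ 2 * q)%N <-> exists t : p2q_type, has_type p q t G),
      (forall t : p2q_type, type_cond p q t ->
         exists (gT : finGroupType) (G : {group gT}), has_type p q t G),
      (forall (t t' : p2q_type) (gT gT' : finGroupType)
              (G : {group gT}) (G' : {group gT'}),
         has_type p q t G -> has_type p q t' G' -> G \isog G' -> t = t'),
      (forall (t : p2q_type) (gT gT' : finGroupType)
              (G : {group gT}) (G' : {group gT'}),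
         t <> Type8 ->
         has_type p q t G -> has_type p q t G' -> G \isog G')
    & (forall (t : p2q_type) (gT : finGroupType) (G : {group gT}),
         has_type p q t G -> type_Aut p q t (Aut_group G))].
Proof.
split=> [gT G | t | t t' gT gT' G G' | t gT gT' G G' | t gT G].
- split; first exact: classify.
  by case=> t /(has_type_invariants p_pr q_pr neq_pq)[].
- exact: type_exists.
- exact: type_unique.
- exact: type_isog.
exact: has_type_Aut.
Qed.
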